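(* Let $G$ be a cograph with countably many vertices. The following are equivalent: (i) $sib(G)=1$; (ii) $sib_c(G)=1$; (iii) $G$ is a lexicographic sum, indexed by a finite graph, of graphs each of which is a clique or an independent set.
   Context: Graphs are undirected and loopless; a cograph is a graph with no induced subgraph isomorphic to the path $P_4$ on four vertices. $G$ embeds into $G'$ if $G$ is isomorphic to an induced subgraph of $G'$; $G,G'$ are equimorphic if each embeds into the other. $sib(G)$ is the number of isomorphism classes of graphs equimorphic to $G$. $sib_{conn}(G)$ is the number of isomorphism classes of connected graphs equimorphic to $G$. $sib_c(G):=sib_{conn}(G)$ if $G$ is connected and $sib_c(G):=sib_{conn}(G^c)$ if $G$ is disconnected, where $G^c$ is the complement of $G$. If $H$ is a graph on a vertex set $J$ and $(L_j)_{j\in J}$ are graphs, the lexicographic sum of the $L_j$ indexed by $H$ is the graph on the disjoint union of the vertex sets of the $L_j$ in which two vertices of the same $L_j$ are adjacent iff they are adjacent in $L_j$, and $x\in L_i$, $y\in L_j$ with $i\neq j$ are adjacent iff $\{i,j\}$ is an edge of $H$. Cliques and independent sets here may be infinite. *)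

(* Defs.v *)
From Stdlib Require Import Relations List Eqdep.

Record graph := Graph {
  vert : Type;
  adj : vert -> vert -> Prop;
  adj_sym : forall x y, adj x y -> adj y x;
  adj_irrefl : forall x, ~ adj x x }.

Arguments adj {g} _ _.

Definition injective {A B : Type} (f : A -> B) := forall x y, f x = f y -> x = y.

Definition embeds (G G' : graph) : Prop :=
  exists f : vert G -> vert G', injective f /\
    forall x y, adj x y <-> adj (f x) (f y).

Definition equimorphic (G G' : graph) : Prop := embeds G G' /\ embeds G' G.

Definition isomorphic (G G' : graph) : Prop :=
  exists (f : vert G -> vert G') (g : vert G' -> vert G),
    (forall x, g (f x) = x) /\ (forall y, f (g y) = y) /\
    (forall x y, adj x y <-> adj (f x) (f y)).

Definition countable_graph (G : graph) : Prop :=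
  exists f : vert G -> nat, injective f.

(* connected: any two vertices joined by a path (the empty graph is connected) *)
Definition connected (G : graph) : Prop :=
  forall x y : vert G, clos_refl_trans (vert G) adj x y.

Definition compl_adj (G : graph) (x y : vert G) : Prop := x <> y /\ ~ adj x y.

Lemma compl_adj_sym (G : graph) x y : compl_adj G x y -> compl_adj G y x.
Proof.
  intros [H1 H2]; split.
  - intro e; apply H1; symmetry; exact e.
  - intro a; apply H2; apply adj_sym; exact a.
Qed.

Lemma compl_adj_irrefl (G : graph) x : ~ compl_adj G x x.
Proof. intros [H _]; apply H; reflexivity. Qed.

Definition complement (G : graph) : graph :=
  Graph (vert G) (compl_adj G) (compl_adj_sym G) (compl_adj_irrefl G).

Definition cograph (G : graph) : Prop :=
  ~ exists a b c d : vert G,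
      adj a b /\ adj b c /\ adj c d /\
      a <> c /\ b <> d /\ a <> d /\
      ~ adj a c /\ ~ adj b d /\ ~ adj a d.

Definition one_iso_class (P : graph -> Prop) : Prop :=
  exists H0 : graph, P H0 /\ forall H : graph, P H -> isomorphic H H0.

Definition sib_is_one (G : graph) : Prop :=
  one_iso_class (fun H => equimorphic H G).

Definition sib_conn_is_one (G : graph) : Prop :=
  one_iso_class (fun H => connected H /\ equimorphic H G).

Definition sib_c_is_one (G : graph) : Prop :=
  (connected G -> sib_conn_is_one G) /\
  (~ connected G -> sib_conn_is_one (complement G)).

Definition is_clique (G : graph) : Prop := forall x y : vert G, x <> y -> adj x y.
Definition is_independent (G : graph) : Prop := forall x y : vert G, ~ adj x y.

Definition finite_type (T : Type) : Prop := exists l : list T, forall x, In x l.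

Section LexSum.
Variables (H : graph) (L : vert H -> graph).

Inductive lex_adj : {j : vert H & vert (L j)} -> {j : vert H & vert (L j)} -> Prop :=
| lex_in (j : vert H) (x y : vert (L j)) :
    adj x y -> lex_adj (existT _ j x) (existT _ j y)
| lex_out (i j : vert H) (x : vert (L i)) (y : vert (L j)) :
    i <> j -> adj i j -> lex_adj (existT _ i x) (existT _ j y).

Lemma lex_adj_sym u v : lex_adj u v -> lex_adj v u.
Proof.
  destruct 1.
  - apply lex_in, adj_sym; assumption.
  - apply lex_out; [intro e; subst; contradiction | apply adj_sym; assumption].
Qed.

Lemma lex_adj_irrefl u : ~ lex_adj u u.
Proof.
  intro h. assert (E : forall v w, lex_adj v w -> v = w -> False).
  { clear. intros v w h e. destruct h.
    - apply inj_pair2 in e. subst. eapply adj_irrefl; eassumption.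
    - inversion e; contradiction. }
  exact (E u u h eq_refl).
Qed.

Definition lexsum : graph :=
  Graph {j : vert H & vert (L j)} lex_adj lex_adj_sym lex_adj_irrefl.
End LexSum.

Definition finite_lexsum_of_cliques_or_indeps (G : graph) : Prop :=
  exists (H : graph) (L : vert H -> graph),
    finite_type (vert H) /\
    (forall j, is_clique (L j) \/ is_independent (L j)) /\
    isomorphic G (lexsum H L).

(* Main.v *)
(** For (iii) => (i), condition (iii) says that there are finitely many twin classes. If [H] and [G] embed
    into each other, some power of the resulting self-embedding of [G] preserves every twin class, and the
    Cantor-Bernstein bijection then respects twin classes, hence adjacency.

    For (ii) => (iii), the key fact is that the induced subgraphs of a countable cograph are
    well-quasi-ordered by embeddability. Seen from a vertex [x], a cograph is a word: the other vertices are
    linearly preordered by their distance to [x] in the decomposition tree, and the letters are again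
    cographs. [A] embeds into [B] as soon as player II survives the game in which player I picks a vertex of
    [A], player II answers in [B], and player I selects one of the sides into which these vertices cut the
    two words. A bad sequence gives winning strategies of player I, that is, a bad array in the sense of
    better-quasi-ordering; playing one round simultaneously in all games and applying Ramsey's theorem to
    the selected sides gives a smaller bad array, against the existence of minimal bad arrays.

    Now suppose that there are infinitely many twin classes, but that all connected (or all co-connected)
    siblings are isomorphic, and take an induced subgraph [M], minimal for embeddability, in this situation.
    Up to complementation all co-connected siblings of [M] are isomorphic. If [M] is disconnected, siblings
    with different numbers of isolated vertices are found. Otherwise the word of [M] has no last letter, and
    there are two siblings, one where all letters of a final segment have several vertices (repeat each of
    its letters) and one where one-vertex letters are cofinal. *)

Require Import Defs.
From Stdlib Require Import Classical ClassicalEpsilon Lia Arith List Wellfounded Relations Bool Eqdep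
  FunctionalExtensionality PropExtensionality ProofIrrelevance.

(** Inclusion of vertex sets is not well-founded, so positions alone would not give minimal bad
    arrays. Each position therefore carries a clock bounding the length of player I's win, and every
    round lowers it. In the simultaneous round for [s] and [tl s], the answer of player II is player
    I's own move in the game for [tl s] and [tl (tl s)]; this is why arrays on infinite sets replace
    sequences. A word need not contain its double; a single vertex does not. What holds is that
    finitely many stacked copies of a word contain it doubled. Cut a word without last letter into
    countably many pieces: from some point on every piece recurs infinitely often up to embedding,
    which supplies the copies, so a final segment can be doubled. The word depends on the vertex
    from which it is seen, and isomorphisms need not respect that vertex. The property separating
    the two siblings is therefore stated for some root and refuted for all roots; this works because
    comparisons with a node [v] are the same from [x] and from [r] as soon as a node with a label
    other than that of [v] lies between [r] and [v]. *)

Definition subset {T : Type} (A B : T -> Prop) := forall v, A v -> B v.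
Definition infinite (s : nat -> Prop) := forall n, exists m, n <= m /\ s m.
(** The shift of better-quasi-ordering theory: [s] without its least element. *)
Definition tl (s : nat -> Prop) : nat -> Prop := fun n => s n /\ exists m, s m /\ m < n.
Definition agree (N : nat) (s t : nat -> Prop) := forall k, k < N -> (s k <-> t k).

Lemma subset_trans {T : Type} (A B C : T -> Prop) : subset A B -> subset B C -> subset A C.
Proof. unfold subset; auto. Qed.

Lemma tl_subset s : subset (tl s) s.
Proof. intros v [H _]; exact H. Qed.

Lemma tl_infinite s : infinite s -> infinite (tl s).
Proof.
  intros H n. destruct (H 0) as [m0 [_ H0]].
  destruct (H (S (n + m0))) as [m [h1 h2]].
  exists m; split; [lia|]. split; [exact h2|]. exists m0; split; [exact H0|lia].
Qed.

Lemma agree_tl N s t : agree N s t -> agree N (tl s) (tl t).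
Proof.
  intros H k hk; unfold tl; split; intros [h1 [m [h2 h3]]]; split.
  - apply H; auto.
  - exists m; split; [apply H; [lia|auto]|auto].
  - apply H; auto.
  - exists m; split; [apply H; [lia|auto]|auto].
Qed.

Lemma agree_sym N s t : agree N s t -> agree N t s.
Proof. intros H k hk; symmetry; auto. Qed.

Lemma agree_trans N s t u : agree N s t -> agree N t u -> agree N s u.
Proof. intros H1 H2 k hk; rewrite (H1 k hk); auto. Qed.

Lemma agree_le M N s t : M <= N -> agree N s t -> agree M s t.
Proof. intros h H k hk; apply H; lia. Qed.

(** [Q] is the invariant that keeps every step possible; [R] depends on the stage so that a
    construction can serve the n-th requirement at stage [n]. *)
Lemma dependent_choice {T : Type} (Q : T -> Prop) (R : nat -> T -> T -> Prop) (s0 : T) :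
  Q s0 -> (forall n s, Q s -> exists s', Q s' /\ R n s s') ->
  exists u : nat -> T, u 0 = s0 /\ (forall n, Q (u n)) /\ forall n, R n (u n) (u (S n)).
Proof.
  intros H0 Hs.
  pose (next := fun n (s : {s : T | Q s}) =>
    let w := constructive_indefinite_description _ (Hs n (proj1_sig s) (proj2_sig s)) in
    exist Q (proj1_sig w) (proj1 (proj2_sig w))).
  pose (U := fix U n : {s : T | Q s} := match n with 0 => exist Q s0 H0 | S n => next n (U n) end).
  exists (fun n => proj1_sig (U n)); split; [reflexivity|split].
  - intro n; exact (proj2_sig (U n)).
  - intro n; simpl.
    exact (proj2 (proj2_sig (constructive_indefinite_description _ (Hs n (proj1_sig (U n)) (proj2_sig (U n)))))).
Qed.

(** * Ramsey's theorem for clopen partitions *)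

Section Ramsey.
Variables (H : nat -> Prop) (P : (nat -> Prop) -> Prop).
Hypothesis contP : forall s, subset s H -> infinite s ->
  exists N, forall t, subset t H -> infinite t -> agree N s t -> (P s <-> P t).

Definition cylinder (p : nat) (b B s : nat -> Prop) :=
  infinite s /\ agree p s b /\ forall k, p <= k -> s k -> B k.

Definition homogenizable (p : nat) (b : nat -> Prop) :=
  forall A, subset A H -> infinite A -> exists B, subset B A /\ infinite B /\
    exists c : bool, forall s, cylinder p b B s -> (P s <-> c = true).

Definition add_point (p : nat) (b : nat -> Prop) (k : nat) : nat -> Prop :=
  fun j => (j < p /\ b j) \/ j = k.

(** Fusion: choose increasing points [K n] with shrinking reservoirs such that [P] has the constant
    colour [C n] on the sets whose first element from [p] on is [K n]. Keeping only the points of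
    one colour that occurs infinitely often makes the colour independent of that first element. *)
Lemma homogenizable_step p b :
  (forall k, H k -> p <= k -> homogenizable (S k) (add_point p b k)) -> homogenizable p b.
Proof.
  intros Hom A AH Ainf.
  (* A stage consists of the chosen point [k], the reservoir [B] for later points and the colour [c]
     of the stem that ends in [k]. *)
  pose (Q := fun st : nat * (nat -> Prop) * bool =>
    let '(k, B, c) := st in
    p <= k /\ subset B A /\ infinite B /\ A k /\ (forall j, B j -> k < j) /\
    forall s, cylinder (S k) (add_point p b k) B s -> (P s <-> c = true)).
  assert (Hnext : forall B, subset B A -> infinite B -> exists st, Q st /\
     let '(k, B', c) := st in subset B' B /\ B k).
  { intros B BA Binf. destruct (Binf p) as [k [hk Bk]].
    destruct (Hom k (AH _ (BA _ Bk)) hk (fun j => B j /\ k < j)) as [B' [h1 [h2 [c h3]]]].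
    - intros j [h _]; auto.
    - intros n. destruct (Binf (n + S k)) as [m [h1 h2]]. exists m; split; [lia|split; [auto|lia]].
    - exists (k, B', c); simpl; repeat split; auto.
      + intros j hj; apply BA, (h1 j hj).
      + intros j hj; apply (h1 j hj).
      + apply h3; auto.
      + apply h3; auto.
      + intros j hj; apply (h1 j hj). }
  destruct (Hnext A (fun _ h => h) Ainf) as [st0 [Q0 _]].
  destruct (dependent_choice Q (fun _ st st' => let '(_, B, _) := st in let '(k', B', _) := st' in
     subset B' B /\ B k') st0 Q0) as [u [_ [uQ uR]]].
  { intros _ [[k B] c] [h1 [h2 [h3 h4]]]. destruct (Hnext B h2 h3) as [[[k' B'] c'] [h5 h6]].
    exists (k', B', c'); split; auto. }
  pose (K := fun n => fst (fst (u n))). pose (Bs := fun n => snd (fst (u n))). pose (C := fun n => snd (u n)).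
  assert (hQ : forall n, p <= K n /\ subset (Bs n) A /\ A (K n) /\ (forall j, Bs n j -> K n < j) /\
    forall s, cylinder (S (K n)) (add_point p b (K n)) (Bs n) s -> (P s <-> C n = true)).
  { intro n. specialize (uQ n). unfold K, Bs, C. destruct (u n) as [[k B] c]. simpl in *. tauto. }
  assert (hR : forall n, subset (Bs (S n)) (Bs n) /\ Bs n (K (S n))).
  { intro n. specialize (uR n). unfold K, Bs. destruct (u n) as [[k B] c]. destruct (u (S n)) as [[k' B'] c'].
    exact uR. }
  assert (hsub : forall n m, n <= m -> subset (Bs m) (Bs n)).
  { induction 1; [intros v h; exact h|]. intros v h. apply IHle, (proj1 (hR m)), h. }
  assert (hKB : forall n m, n < m -> Bs n (K m)).
  { intros n m h. destruct m; [lia|]. apply (hsub n m); [lia|]. apply hR. }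
  assert (hKlt : forall n m, n < m -> K n < K m).
  { intros n m h. apply hQ. auto. }
  assert (hKge : forall n, n <= K n).
  { induction n; [lia|]. specialize (hKlt n (S n)). lia. }
  assert (Hc : exists c, forall n, exists m, n <= m /\ C m = c).
  { destruct (classic (forall n, exists m, n <= m /\ C m = true)) as [h|h]; [exists true; exact h|].
    exists false. apply not_all_ex_not in h. destruct h as [n0 h].
    intro n. exists (n + n0); split; [lia|]. destruct (C (n + n0)) eqn:E; auto.
    exfalso; apply h. exists (n + n0); split; [lia|auto]. }
  destruct Hc as [c Hc].
  exists (fun k => exists n, K n = k /\ C n = c). split; [|split].
  - intros k [n [<- _]]. apply hQ.
  - intros n. destruct (Hc n) as [m [h1 h2]]. exists (K m); split; [specialize (hKge m); lia|eauto].
  - exists c. intros s [s1 [s2 s3]].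
    destruct (s1 p) as [m [hm sm]]. destruct (s3 m hm sm) as [n0 [e0 c0]].
    (* For the least such [n], [K n] is the first element of [s] from [p] on, so [s] continues the
       stem that ends in [K n]. *)
    assert (exists n, C n = c /\ s (K n) /\ forall n', n' < n -> ~ (C n' = c /\ s (K n'))) as [n [n1 [n2 n3]]].
    { clear - e0 c0 sm. assert (h : C n0 = c /\ s (K n0)) by (subst m; auto). clear - h.
      induction n0 as [n0 IH] using lt_wf_ind.
      destruct (classic (exists n', n' < n0 /\ C n' = c /\ s (K n'))) as [[n' [h1 h2]]|h'].
      - eapply IH; eauto.
      - exists n0; repeat split; try tauto. intros n' h1 h2; apply h'; eauto. }
    rewrite <- n1. apply (hQ n). split; [exact s1|split].
    + intros k hk. unfold add_point. split.
      * intro sk. destruct (le_lt_dec p k) as [h|h].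
        -- right. destruct (s3 k h sk) as [n' [e' c']]. destruct (lt_eq_lt_dec n' n) as [[h'|h']|h'].
           ++ exfalso; apply (n3 n' h'). subst k; auto.
           ++ subst; auto.
           ++ specialize (hKlt _ _ h'). lia.
        -- left; split; auto. apply s2; auto.
      * intros [[h1 h2]|h1]; [apply s2; auto|subst; auto].
    + intros k hk sk. destruct (s3 k) as [n' [e' c']]; [|auto|].
      * destruct (hQ n). lia.
      * subst k. apply hKB. destruct (le_lt_dec n' n); auto.
        destruct (Nat.eq_dec n' n); [subst; lia|]. assert (n' < n) by lia. specialize (hKlt _ _ H0). lia.
Qed.

(** If the empty stem were not homogenizable, [homogenizable_step] would extend bad stems forever.
    Near their union, an infinite set, [P] is constant by [contP], so a late stem is homogenizable
    after all. *)
Theorem clopen_ramsey : infinite H -> exists K, subset K H /\ infinite K /\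
  ((forall s, subset s K -> infinite s -> P s) \/ (forall s, subset s K -> infinite s -> ~ P s)).
Proof.
  intro Hinf.
  assert (Hom : homogenizable 0 (fun _ => False)).
  { apply NNPP; intro hn.
    destruct (dependent_choice (fun st : nat * (nat -> Prop) => ~ homogenizable (fst st) (snd st) /\ subset (snd st) H)
      (fun _ st st' => exists k, H k /\ fst st <= k /\ st' = (S k, add_point (fst st) (snd st) k))
      (0, fun _ => False)) as [u [u0 [uQ uR]]].
    { split; [exact hn|]. intros v []. }
    { intros _ [p b] [h1 h2]; simpl in *. apply NNPP; intro h3. apply h1, homogenizable_step.
      intros k Hk pk. apply NNPP; intro h4. apply h3. exists (S k, add_point p b k). split.
      - split; auto. simpl. intros j [[_ h]|h]; [auto|subst; auto].
      - exists k; auto. }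
    pose (p := fun n => fst (u n)). pose (b := fun n => snd (u n)).
    assert (hR : forall n, exists k, H k /\ p n <= k /\ p (S n) = S k /\ b (S n) = add_point (p n) (b n) k).
    { intro n. destruct (uR n) as [k [h1 [h2 h3]]]. exists k. unfold p, b in *. rewrite h3. auto. }
    assert (hp : forall n m, n <= m -> p n <= p m).
    { induction 1; auto. destruct (hR m) as [k [_ [h1 [h2 _]]]]. lia. }
    assert (hpn : forall n, n <= p n).
    { induction n; [lia|]. destruct (hR n) as [k [_ [h1 [h2 _]]]]. lia. }
    assert (hag : forall n m, n <= m -> agree (p n) (b m) (b n)).
    { induction 1; [intros k _; tauto|]. intros j hj. rewrite <- (IHle j hj).
      destruct (hR m) as [k [_ [h1 [h2 h3]]]]. rewrite h3. unfold add_point. specialize (hp _ _ H0).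
      split; [intros [h|h]; [tauto|lia]|intro h; left; split; [lia|auto]]. }
    (* The union of the stems: since [j < p (S j)], the stem of stage [S j] has already decided
       [j]. *)
    pose (s := fun j => b (S j) j).
    assert (sag : forall n, agree (p n) s (b n)).
    { intros n j hj. unfold s. destruct (le_lt_dec n (S j)) as [h|h].
      - apply hag; auto.
      - symmetry. apply (hag (S j) n); [lia|]. specialize (hpn (S j)). lia. }
    assert (sH : subset s H). { intros j hj. apply (proj2 (uQ (S j))). exact hj. }
    assert (sinf : infinite s).
    { intro n. destruct (hR n) as [k [h0 [h1 [h2 h3]]]]. exists k. split; [specialize (hpn n); lia|].
      apply (sag (S n)); [lia|]. rewrite h3. right; auto. }
    destruct (contP s sH sinf) as [N hN].
    apply (proj1 (uQ N)). intros A AH Ainf. exists A; split; [intros v h; exact h|split; auto].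
    exists (if excluded_middle_informative (P s) then true else false).
    intros t [t1 [t2 t3]].
    assert (tH : subset t H).
    { intros j hj. destruct (le_lt_dec (fst (u N)) j) as [h|h]; [apply AH; auto|].
      apply sH. apply (sag N); auto. apply t2; auto. }
    rewrite <- (hN t tH t1).
    - destruct (excluded_middle_informative (P s)); split; auto; congruence.
    - intros j hj. rewrite (sag N j), (t2 j); [tauto| |]; unfold p; specialize (hpn N); unfold p in hpn; lia. }
  destruct (Hom H (fun _ h => h) Hinf) as [K [h1 [h2 [c h3]]]].
  exists K; split; auto; split; auto.
  assert (hc : forall s, subset s K -> infinite s -> (P s <-> c = true)).
  { intros s h4 h5. apply h3. split; auto. split; [intros k hk; lia|auto]. }
  destruct c.
  - left; intros; apply hc; auto.
  - right; intros s h4 h5 h6. apply hc in h6; auto; congruence.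
Qed.

End Ramsey.

(** * Minimal bad arrays *)

Section Arrays.
Variable D : Type.

Definition continuous (H : nat -> Prop) (f : (nat -> Prop) -> D) :=
  forall s, subset s H -> infinite s ->
  exists N, forall t, subset t H -> infinite t -> agree N s t -> f t = f s.

Lemma continuous_subset H K f : subset K H -> continuous H f -> continuous K f.
Proof.
  intros h c s h1 h2. destruct (c s) as [N hN]; [eapply subset_trans; eauto|auto|].
  exists N; intros; apply hN; auto. eapply subset_trans; eauto.
Qed.

Variable R : D -> D -> Prop.

(* [R d e] is to be read as [d] not being below [e]. *)
Definition bad_array (H : nat -> Prop) (f : (nat -> Prop) -> D) :=
  infinite H /\ continuous H f /\ forall s, subset s H -> infinite s -> R (f s) (f (tl s)).

Variable lt : D -> D -> Prop.
Hypothesis lt_wf : well_founded lt.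
Hypothesis lt_trans : forall a b c, lt a b -> lt b c -> lt a c.
Hypothesis R_lt : forall d e e', R d e -> lt e' e -> R d e'.

Definition wlt d e := d = e \/ lt d e.

Lemma lt_wlt_trans a b c : lt a b -> wlt b c -> lt a c.
Proof. intros h [<-|h']; eauto. Qed.

Lemma wlt_trans a b c : wlt a b -> wlt b c -> wlt a c.
Proof. intros [->|h] h'; auto. right; eapply lt_wlt_trans; eauto. Qed.

Definition pointwise (H : nat -> Prop) (f g : (nat -> Prop) -> D) (r : D -> D -> Prop) :=
  forall s, subset s H -> infinite s -> r (f s) (g s).

(** Failure of minimality near [s], seen through the stem of [s] below [p]: some smaller bad array
    keeps this stem in its domain. *)
Definition reducible (H : nat -> Prop) (f : (nat -> Prop) -> D) (p : nat) (s : nat -> Prop) :=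
  exists K g, subset K H /\ bad_array K g /\ (forall j, j < p -> s j -> K j) /\ pointwise K g f lt.

Lemma reducible_mono H f H' f' p p' s s' : reducible H' f' p' s' -> p <= p' -> subset H' H ->
  pointwise H' f' f wlt -> agree p s s' -> reducible H f p s.
Proof.
  intros [K [g [h1 [h2 [h3 h4]]]]] hp hH hf ha. exists K, g. repeat split; try apply h2.
  - eapply subset_trans; eauto.
  - intros j hj sj. apply h3; [lia|]. apply ha; auto.
  - intros s0 h5 h6. eapply lt_wlt_trans; [apply h4; auto|]. apply hf; auto. eapply subset_trans; eauto.
Qed.

(** The last clause allows a value to change only where the stem was reducible; it makes the values
    stabilize in the limit. *)
Definition refines (p : nat) (H : nat -> Prop) f H' f' :=
  subset H' H /\ agree p H' H /\ bad_array H' f' /\ pointwise H' f' f wlt /\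
  forall s, subset s H' -> infinite s -> f' s = f s \/ reducible H f p s.

Lemma refines_trans p H f H' f' H'' f'' :
  refines p H f H' f' -> refines p H' f' H'' f'' -> refines p H f H'' f''.
Proof.
  intros [a1 [a2 [a3 [a4 a5]]]] [b1 [b2 [b3 [b4 b5]]]].
  assert (c1 : subset H'' H) by (eapply subset_trans; eauto).
  split; [auto|split; [eapply agree_trans; eauto|split; [auto|split]]].
  - intros s h1 h2. eapply wlt_trans; [apply b4; auto|]. apply a4; auto. eapply subset_trans; eauto.
  - intros s h1 h2. destruct (b5 s h1 h2) as [e|r].
    + rewrite e. apply a5; auto. eapply subset_trans; eauto.
    + right. eapply reducible_mono; eauto. intros k _; tauto.
Qed.

(** If [K] and [g] witness reducibility, use [g] on the sets whose part below [p] lies in [K], and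
    [f] elsewhere. The result is bad: if [s] is on the side of [g], so is [tl s], and a passage from
    [f] to [g] only lowers the second argument of [R]. *)
Lemma refines_one p H f b : bad_array H f -> exists H' f', refines p H f H' f' /\
  ((forall s, subset s H' -> infinite s -> agree p s b -> lt (f' s) (f s)) \/ ~ reducible H' f' p b).
Proof.
  intros [a1 [a2 a3]]. destruct (classic (reducible H f p b)) as [r|r].
  2:{ exists H, f. split; [|auto]. split; [intros v h; auto|split; [intros k _; tauto|split; [split; auto|]]].
      split; [intros s _ _; left; auto|auto]. }
  assert (r' := r). destruct r' as [K [g [h1 [h2 [h3 h4]]]]].
  pose (H' := fun k => (k < p /\ H k) \/ (p <= k /\ K k)).
  pose (in_K := fun s : nat -> Prop => forall j, j < p -> s j -> K j).
  pose (f' := fun s => if excluded_middle_informative (in_K s) then g s else f s).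
  assert (H'H : subset H' H). { intros k [h|h]; [tauto|apply h1; tauto]. }
  assert (inK : forall s, subset s H' -> in_K s -> subset s K).
  { intros s s1 s2 k sk. destruct (s1 k sk) as [h|h]; [apply s2; tauto|tauto]. }
  assert (f'K : forall s, in_K s -> f' s = g s).
  { intros s h. unfold f'. destruct (excluded_middle_informative (in_K s)); tauto. }
  assert (f'H : forall s, ~ in_K s -> f' s = f s).
  { intros s h. unfold f'. destruct (excluded_middle_informative (in_K s)); tauto. }
  assert (f'wlt : pointwise H' f' f wlt).
  { intros s s1 s2. destruct (classic (in_K s)) as [i|i].
    - rewrite f'K; auto. right. apply h4; auto.
    - rewrite f'H; auto. left; auto. }
  exists H', f'. split; [split; [auto|split; [|split; [split; [|split]|split]]]|].
  - intros k hk. unfold H'. split; [intros [h|h]; [tauto|lia]|tauto].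
  - intro n. destruct (proj1 h2 (n + p)) as [m [h5 h6]]. exists m; split; [lia|]. right; split; [lia|auto].
  - intros s s1 s2. destruct (classic (in_K s)) as [i|i].
    + destruct (proj1 (proj2 h2) s) as [N hN]; auto.
      exists (N + p). intros t t1 t2 t3.
      assert (j : in_K t). { intros k hk tk. apply i; auto. apply t3; [lia|auto]. }
      rewrite !f'K; auto. apply hN; auto. eapply agree_le; [|eauto]; lia.
    + destruct (a2 s) as [N hN]; auto. { eapply subset_trans; eauto. }
      exists (N + p). intros t t1 t2 t3.
      assert (j : ~ in_K t). { intro j. apply i. intros k hk tk. apply j; auto. apply t3; [lia|auto]. }
      rewrite !f'H; auto. apply hN; auto. { eapply subset_trans; eauto. } eapply agree_le; [|eauto]; lia.
  - intros s s1 s2. destruct (classic (in_K s)) as [i|i].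
    + assert (j : in_K (tl s)). { intros k hk tk. apply i; auto. apply tl_subset; auto. }
      rewrite !f'K; auto. apply h2; auto.
    + rewrite (f'H s); auto.
      assert (t1 : subset (tl s) H'). { eapply subset_trans; [apply tl_subset|auto]. }
      assert (q : R (f s) (f (tl s))). { apply a3; auto. eapply subset_trans; eauto. }
      destruct (f'wlt (tl s) t1 (tl_infinite _ s2)) as [e|e]; [rewrite e; auto|eauto].
  - exact f'wlt.
  - intros s s1 s2. destruct (classic (in_K s)) as [i|i]; [|left; auto].
    right. exists K, g. auto.
  - left. intros s s1 s2 s3. assert (i : in_K s). { intros k hk sk. apply h3; auto. apply s3; auto. }
    rewrite f'K; auto.
Qed.

Fixpoint bool_lists (p : nat) : list (list bool) :=
  match p with 0 => nil :: nil
  | S p => map (cons true) (bool_lists p) ++ map (cons false) (bool_lists p) end.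

Lemma bool_lists_complete p : forall s : nat -> Prop, exists l, In l (bool_lists p) /\
  agree p s (fun k => nth k l false = true).
Proof.
  induction p; intro s.
  - exists nil; split; [left; auto|intros k hk; lia].
  - destruct (IHp (fun k => s (S k))) as [l [h1 h2]].
    exists ((if excluded_middle_informative (s 0) then true else false) :: l). split.
    + simpl. apply in_or_app. destruct (excluded_middle_informative (s 0)); [left|right]; apply in_map; auto.
    + intros [|k] hk; simpl.
      * destruct (excluded_middle_informative (s 0)); split; auto; try congruence; tauto.
      * apply h2; lia.
Qed.

(** There are finitely many stems below [p], and what [refines_one] achieves for one of them
    survives the treatment of the others. *)
Lemma refines_all p H f : bad_array H f -> exists H' f', refines p H f H' f' /\
  forall s, subset s H' -> infinite s -> lt (f' s) (f s) \/ ~ reducible H' f' p s.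
Proof.
  intro a.
  assert (h : forall ls, exists H' f', refines p H f H' f' /\
    forall l, In l ls -> (forall s, subset s H' -> infinite s -> agree p s (fun k => nth k l false = true) -> lt (f' s) (f s))
      \/ ~ reducible H' f' p (fun k => nth k l false = true)).
  { induction ls as [|l ls IH].
    - exists H, f. split; [|intros l []]. split; [intros v h; auto|split; [intros k _; tauto|split; [auto|]]].
      split; [intros s _ _; left; auto|auto].
    - destruct IH as [H1 [f1 [r1 q1]]].
      destruct (refines_one p H1 f1 (fun k => nth k l false = true)) as [H2 [f2 [r2 q2]]]; [apply r1|].
      exists H2, f2. split; [eapply refines_trans; eauto|].
      destruct r2 as [b1 [b2 [b3 [b4 b5]]]]. destruct r1 as [a1 [a2 [a3 [a4 a5]]]].
      intros l' [<-|hl'].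
      + destruct q2 as [q2|q2]; [left|right; auto].
        intros s s1 s2 s3. eapply lt_wlt_trans; [apply q2; auto|]. apply a4; auto. eapply subset_trans; eauto.
      + destruct (q1 l' hl') as [q|q].
        * left. intros s s1 s2 s3.
          assert (s1' : subset s H1) by (eapply subset_trans; eauto).
          destruct (b4 s s1 s2) as [e|e]; [rewrite e; auto|]. eapply lt_trans; eauto.
        * right. intro q'. apply q. eapply reducible_mono; eauto. intros k _; tauto. }
  destruct (h (bool_lists p)) as [H' [f' [r q]]]. exists H', f'; split; auto.
  intros s s1 s2. destruct (bool_lists_complete p s) as [l [l1 l2]].
  destruct (q l l1) as [q'|q']; [left; auto|right].
  intro q''. apply q'. eapply reducible_mono; eauto.
  - intros v hv; exact hv.
  - intros t _ _; left; auto.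
  - apply agree_sym; auto.
Qed.

(** The minimal bad array of Nash-Williams, as a fusion: stage [n] freezes the domain below [p n]
    while values go down. Well-foundedness of [lt] stops the descent at every set, and the limit
    array cannot be lowered any more. *)
Theorem minimal_bad_array H0 f0 : bad_array H0 f0 ->
  (forall H f, subset H H0 -> bad_array H f -> pointwise H f f0 wlt ->
     exists K g, subset K H /\ bad_array K g /\ pointwise K g f lt) -> False.
Proof.
  intros a0 red.
  pose (St := (nat * (nat -> Prop) * ((nat -> Prop) -> D))%type).
  destruct (dependent_choice (T := St) (fun st => let '(p, H, f) := st in
     subset H H0 /\ bad_array H f /\ pointwise H f f0 wlt)
    (fun _ st st' => let '(p, H, f) := st in let '(p', H', f') := st' in
      refines p H f H' f' /\ (forall s, subset s H' -> infinite s -> lt (f' s) (f s) \/ ~ reducible H' f' p s) /\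
      exists k, p <= k /\ k < p' /\ H' k) (0, H0, f0)) as [u [u0 [uQ uR]]].
  { split; [intros v h; auto|split; [auto|intros s _ _; left; auto]]. }
  { intros _ [[p H] f] [h1 [h2 h3]]. destruct (refines_all p H f h2) as [H' [f' [r q]]].
    destruct (proj1 (proj1 (proj2 (proj2 r))) p) as [k [k1 k2]].
    exists (S k, H', f'). destruct r as [b1 [b2 [b3 [b4 b5]]]]. split; [split; [|split; auto]|].
    - eapply subset_trans; eauto.
    - intros s s1 s2. eapply wlt_trans; [apply b4; auto|]. apply h3; auto. eapply subset_trans; eauto.
    - split; [split; auto|split; auto]. exists k; auto. }
  pose (p := fun n => fst (fst (u n))). pose (H := fun n => snd (fst (u n))). pose (f := fun n => snd (u n)).
  assert (hQ : forall n, subset (H n) H0 /\ bad_array (H n) (f n) /\ pointwise (H n) (f n) f0 wlt).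
  { intro n. specialize (uQ n). unfold H, f. destruct (u n) as [[? ?] ?]. exact uQ. }
  assert (hR : forall n, refines (p n) (H n) (f n) (H (S n)) (f (S n)) /\
    (forall s, subset s (H (S n)) -> infinite s -> lt (f (S n) s) (f n s) \/ ~ reducible (H (S n)) (f (S n)) (p n) s) /\
    exists k, p n <= k /\ k < p (S n) /\ H (S n) k).
  { intro n. specialize (uR n). unfold H, f, p. destruct (u n) as [[? ?] ?]. destruct (u (S n)) as [[? ?] ?]. exact uR. }
  clear uQ uR.
  assert (Hsub : forall n m, n <= m -> subset (H m) (H n)).
  { induction 1; [intros v h; auto|]. eapply subset_trans; [apply (hR m)|auto]. }
  assert (ple : forall n m, n <= m -> p n <= p m).
  { induction 1; auto. destruct (hR m) as [_ [_ [k [k1 [k2 _]]]]]. lia. }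
  assert (pn : forall n, n <= p n).
  { induction n; [lia|]. destruct (hR n) as [_ [_ [k [k1 [k2 _]]]]]. lia. }
  assert (Hag : forall n m, n <= m -> agree (p n) (H m) (H n)).
  { induction 1; [intros k _; tauto|]. eapply agree_trans; [|apply IHle].
    eapply agree_le; [apply (ple n m); auto|]. apply (hR m). }
  pose (HI := fun k => forall n, H n k).
  assert (HIn : forall n, subset HI (H n)). { intros n k h; apply h. }
  assert (HIag : forall n k, k < p n -> H n k -> HI k).
  { intros n k hk h m. destruct (le_lt_dec n m).
    - apply (Hag n m); auto.
    - apply (Hsub m n); [lia|auto]. }
  (* Every stage freezes one more element of the domain, between [p n] and [p (S n)]. *)
  assert (HIinf : infinite HI).
  { intro n. destruct (hR n) as [_ [_ [k [k1 [k2 k3]]]]]. exists k. split; [specialize (pn n); lia|].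
    eapply HIag; eauto. }
  assert (fle : forall n m, n <= m -> forall s, subset s (H m) -> infinite s -> wlt (f m s) (f n s)).
  { induction 1; intros s s1 s2; [left; auto|]. eapply wlt_trans; [apply (hR m); auto|].
    apply IHle; auto. eapply subset_trans; [eauto|apply (hR m)]. }
  assert (stab : forall s, subset s HI -> infinite s -> exists m, ~ reducible (H (S m)) (f (S m)) (p m) s).
  { intros s s1 s2. apply NNPP; intro hn.
    assert (dec : forall n, lt (f (S n) s) (f n s)).
    { intro n. destruct (proj1 (proj2 (hR n)) s) as [h|h]; auto.
      - eapply subset_trans; eauto.
      - exfalso; eauto. }
    assert (forall d n, f n s = d -> False).
    { induction d as [d IH] using (well_founded_ind lt_wf). intros n e. subst d. eapply IH; [apply (dec n)|reflexivity]. }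
    exact (H1 _ 0 eq_refl). }
  (* Once the stem of [s] below [p m] is irreducible, no later stage changes the values on sets with
     this stem. Hence the limit [fI] is continuous. *)
  assert (const : forall m s t, ~ reducible (H (S m)) (f (S m)) (p m) s -> subset t HI -> infinite t ->
     agree (p m) s t -> forall n, S m <= n -> f n t = f (S m) t).
  { intros m s t hr t1 t2 ta n hn. induction hn; auto. rewrite <- IHhn.
    destruct (proj2 (proj2 (proj2 (proj2 (proj1 (hR m0))))) t) as [e|r]; auto.
    - eapply subset_trans; eauto.
    - exfalso. apply hr. eapply reducible_mono; [exact r| | | |exact ta].
      + apply ple; lia.
      + apply Hsub; auto.
      + intros v v1 v2; apply fle; auto. }
  pose (M := fun s => epsilon (inhabits 0) (fun m => ~ reducible (H (S m)) (f (S m)) (p m) s)).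
  assert (hM : forall s, subset s HI -> infinite s -> ~ reducible (H (S (M s))) (f (S (M s))) (p (M s)) s).
  { intros s s1 s2. apply (epsilon_spec (inhabits 0) (fun m => ~ reducible (H (S m)) (f (S m)) (p m) s)). auto. }
  pose (fI := fun s => f (S (M s)) s).
  assert (fIn : forall m s t, ~ reducible (H (S m)) (f (S m)) (p m) s -> subset t HI -> infinite t ->
     agree (p m) s t -> forall n, S m <= n -> f n t = fI t).
  { intros m s t hr t1 t2 ta n hn. unfold fI.
    rewrite (const m s t hr t1 t2 ta n hn).
    assert (h := const (M t) t t (hM t t1 t2) t1 t2 (fun _ _ => iff_refl _)).
    destruct (le_lt_dec m (M t)) as [l|l].
    - symmetry. apply (const m s t); auto. lia.
    - apply h. lia. }
  assert (aI : bad_array HI fI).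
  { split; [auto|split].
    - intros s s1 s2. destruct (proj1 (proj2 (proj1 (proj2 (hQ (S (M s)))))) s) as [N hN]; auto.
      { eapply subset_trans; eauto. }
      exists (N + p (M s)). intros t t1 t2 ta.
      rewrite <- (fIn (M s) s t (hM s s1 s2) t1 t2 (agree_le _ _ _ _ (Nat.le_add_l _ _) ta) (S (M s)) (le_n _)).
      unfold fI. apply hN; auto. { eapply subset_trans; eauto. } eapply agree_le; [|eauto]; lia.
    - intros s s1 s2.
      assert (t1 : subset (tl s) HI) by (eapply subset_trans; [apply tl_subset|auto]).
      assert (t2 := tl_infinite s s2).
      pose (n := S (M s) + S (M (tl s))).
      rewrite <- (fIn (M s) s s (hM s s1 s2) s1 s2 (fun _ _ => iff_refl _) n) by (unfold n; lia).
      rewrite <- (fIn (M (tl s)) (tl s) (tl s) (hM _ t1 t2) t1 t2 (fun _ _ => iff_refl _) n) by (unfold n; lia).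
      apply (hQ n); auto. eapply subset_trans; eauto. }
  destruct (red HI fI) as [K [g [k1 [k2 k3]]]]; auto.
  { eapply subset_trans; [apply (HIn 0)|apply hQ]. }
  { intros s s1 s2. unfold fI. apply (hQ (S (M s))); auto. eapply subset_trans; eauto. }
  (* The set [K] itself has a stem that is irreducible at stage [M K], but [g] is a smaller array
     whose domain contains all of [K]. *)
  apply (hM K k1 (proj1 k2)). exists K, g. split; [eapply subset_trans; eauto|split; auto]. split; auto.
  intros s s1 s2.
  assert (s3 : subset s HI) by (eapply subset_trans; eauto).
  eapply lt_wlt_trans; [apply k3; auto|].
  pose (n := S (M s) + S (M K)).
  rewrite <- (fIn (M s) s s (hM s s3 s2) s3 s2 (fun _ _ => iff_refl _) n) by (unfold n; lia).
  apply fle; auto; [unfold n; lia|]. eapply subset_trans; eauto.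
Qed.

End Arrays.

(** * The embedding game *)

Section Game.
Variables (V : Type) (adj : V -> V -> Prop) (blt : V -> V -> V -> Prop).

Definition same x y z := ~ blt x y z /\ ~ blt x z y.

(* [PP A] is the graph induced on [A]; [PW x A] is the same graph seen from [x], i.e. the word whose
   letters are the classes of [A] that [blt x] does not separate. *)
Inductive pos := PP (A : V -> Prop) | PW (x : V) (A : V -> Prop).

(** Clocks: well-founded trees whose branches are indexed by the answers of player II, so that the
    time left may depend on the answer. *)
Inductive ord := ozero | olim (h : V -> ord).

Inductive osub : ord -> ord -> Prop := osub_intro h v : osub (h v) (olim h).
Definition olt := clos_trans ord osub.

Lemma olt_wf : well_founded olt.
Proof.
  apply wf_clos_trans. intro t. induction t as [|h IH]; constructor; intros t' H; inversion H; subst; auto.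
Qed.

(* Player I picks a vertex of [p], player II answers in [q] and player I chooses the side (closer to the
   root, farther from it, or the same letter) on which the game goes on; player I must win within [t]. *)
Fixpoint Iwin (t : ord) (p q : pos) : Prop :=
  match t, p, q with
  | olim h, PP A, PP B => exists x, A x /\ forall x', B x' ->
      Iwin (h x') (PW x (fun v => A v /\ v <> x)) (PW x' (fun v => B v /\ v <> x'))
  | olim h, PW x A, PW x' B => exists y, A y /\ forall y', B y' ->
      ~ (adj x y <-> adj x' y')
      \/ Iwin (h y') (PW x (fun v => A v /\ blt x v y)) (PW x' (fun v => B v /\ blt x' v y'))
      \/ Iwin (h y') (PW x (fun v => A v /\ blt x y v)) (PW x' (fun v => B v /\ blt x' y' v))
      \/ Iwin (h y') (PP (fun v => A v /\ same x v y)) (PP (fun v => B v /\ same x' v y'))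
  | _, _, _ => False
  end.

Definition psub (p q : pos) : Prop :=
  match p, q with
  | PP A, PP B => subset A B
  | PW x A, PW y B => x = y /\ subset A B
  | _, _ => False
  end.

Lemma psub_trans p q r : psub p q -> psub q r -> psub p r.
Proof.
  destruct p, q, r; simpl; try tauto.
  - apply subset_trans.
  - intros [-> h] [-> h']; split; auto. eapply subset_trans; eauto.
Qed.

(** A smaller position of player II leaves fewer answers to refute. *)
Lemma Iwin_subset t : forall p q q', Iwin t p q -> psub q' q -> Iwin t p q'.
Proof.
  induction t as [|h IH]; simpl; [tauto|].
  intros [A|x A] [B|x' B] [C|z C]; try tauto; simpl.
  - intros [y [h1 h2]] s. exists y; split; auto. intros y' c. eapply IH; [apply h2; auto|].
    split; auto. intros v [? ?]; split; auto.
  - intros [y [h1 h2]] [-> s]. exists y; split; auto. intros y' c.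
    destruct (h2 y' (s _ c)) as [h3|[h3|[h3|h3]]]; [tauto|right; left|right; right; left|right; right; right];
      (eapply IH; [exact h3|]); simpl; lazymatch goal with |- _ /\ _ => split; [reflexivity|] | _ => idtac end;
      intros v [? ?]; split; auto.
Qed.

Definition state := (pos * ord)%type.
Definition wins (d e : state) := Iwin (snd d) (fst d) (fst e).
Definition state_lt (d e : state) := psub (fst d) (fst e) /\ olt (snd d) (snd e).

Lemma state_lt_wf : well_founded state_lt.
Proof.
  assert (h : forall t p, Acc state_lt (p, t)).
  { induction t as [t IH] using (well_founded_ind olt_wf). intro p. constructor.
    intros [q u] [_ h]. apply IH. exact h. }
  intros [p t]; apply h.
Qed.

Lemma state_lt_trans a b c : state_lt a b -> state_lt b c -> state_lt a c.
Proof. intros [h1 h2] [h3 h4]; split; [eapply psub_trans; eauto|eapply t_trans; eauto]. Qed.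

Lemma wins_lt d e e' : wins d e -> state_lt e' e -> wins d e'.
Proof. intros h [h1 _]; eapply Iwin_subset; eauto. Qed.

Definition plain (d : state) := exists A, fst d = PP A.
Definition word (d : state) := exists x A, fst d = PW x A.

Definition carrier (p : pos) := match p with PP A => A | PW _ A => A end.
Definition root (v0 : V) (p : pos) := match p with PP _ => v0 | PW x _ => x end.
Definition sub_ord (t : ord) (v : V) := match t with ozero => ozero | olim h => h v end.

Lemma continuous_tail {T U : Type} H (f : (nat -> Prop) -> T) (F : T -> T -> T -> U) :
  continuous T H f -> continuous U H (fun s => F (f s) (f (tl s)) (f (tl (tl s)))).
Proof.
  intros c s s1 s2.
  assert (t1 : subset (tl s) H) by (eapply subset_trans; [apply tl_subset|auto]).
  assert (t2 : subset (tl (tl s)) H) by (eapply subset_trans; [apply tl_subset|auto]).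
  assert (i1 := tl_infinite _ s2). assert (i2 := tl_infinite _ i1).
  destruct (c s s1 s2) as [N hN]. destruct (c _ t1 i1) as [N' hN']. destruct (c _ t2 i2) as [N'' hN''].
  exists (N + N' + N''). intros t h1 h2 h3.
  assert (u1 : subset (tl t) H) by (eapply subset_trans; [apply tl_subset|auto]).
  assert (u2 : subset (tl (tl t)) H) by (eapply subset_trans; [apply tl_subset|auto]).
  assert (j1 := tl_infinite _ h2). assert (j2 := tl_infinite _ j1).
  rewrite (hN t), (hN' (tl t)), (hN'' (tl (tl t))); auto.
  - eapply agree_le; [|apply agree_tl, agree_tl; exact h3]; lia.
  - eapply agree_le; [|apply agree_tl; exact h3]; lia.
  - eapply agree_le; [|exact h3]; lia.
Qed.

Lemma ramsey_continuous H (g : (nat -> Prop) -> state) (Q : state -> state -> Prop) :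
  infinite H -> continuous state H g ->
  exists K, subset K H /\ infinite K /\ ((forall s, subset s K -> infinite s -> Q (g s) (g (tl s))) \/
    (forall s, subset s K -> infinite s -> ~ Q (g s) (g (tl s)))).
Proof.
  intros Hi c. apply (clopen_ramsey H (fun s => Q (g s) (g (tl s)))); auto.
  intros s s1 s2. destruct (continuous_tail H g (fun a b _ => Q a b) c s s1 s2) as [N hN].
  exists N. intros t t1 t2 t3. rewrite <- (hN t t1 t2 t3). tauto.
Qed.

(** One round of [Iwin] with the move [y] and the answer [y'] made explicit. *)
Definition winning_reply (d e : state) (y y' : V) : Prop :=
  match fst d, fst e with
  | PP A, PP B => Iwin (sub_ord (snd d) y') (PW y (fun v => A v /\ v <> y)) (PW y' (fun v => B v /\ v <> y'))
  | PW x A, PW x' B => ~ (adj x y <-> adj x' y')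
      \/ Iwin (sub_ord (snd d) y') (PW x (fun v => A v /\ blt x v y)) (PW x' (fun v => B v /\ blt x' v y'))
      \/ Iwin (sub_ord (snd d) y') (PW x (fun v => A v /\ blt x y v)) (PW x' (fun v => B v /\ blt x' y' v))
      \/ Iwin (sub_ord (snd d) y') (PP (fun v => A v /\ same x v y)) (PP (fun v => B v /\ same x' v y'))
  | _, _ => False
  end.

Definition move (v0 : V) (d e : state) : V := epsilon (inhabits v0) (fun y => carrier (fst d) y /\
  forall y', carrier (fst e) y' -> winning_reply d e y y').

Lemma move_spec v0 d e : wins d e -> carrier (fst d) (move v0 d e) /\
  forall y', carrier (fst e) y' ->
  olt (sub_ord (snd d) y') (snd d) /\ winning_reply d e (move v0 d e) y'.
Proof.
  intro r.
  assert (h : carrier (fst d) (move v0 d e) /\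
    forall y', carrier (fst e) y' -> winning_reply d e (move v0 d e) y').
  { unfold move. apply epsilon_spec. destruct d as [p [|h]]; [destruct r|].
    destruct e as [q ?]. unfold wins in r. unfold winning_reply. simpl in *.
    destruct p as [A|x A], q as [B|x' B]; try tauto; exact r. }
  destruct h as [h1 h2]; split; [exact h1|]. intros y' hy'; split; [|auto].
  destruct d as [p [|h]]; [destruct r|]. apply t_step. simpl. constructor.
Qed.

(** The state after one round of [d] against [e], where the answer in [e] is player I's own move for
    [e] against [e']. Sides 0, 1 and 2 are the closer part, the farther part and the node of the
    move in a word; the remaining case turns a plain position into the word seen from the move. *)
Definition derive (side : nat) (v0 : V) (d e e' : state) : state :=
  let y := move v0 d e in let t := sub_ord (snd d) (move v0 e e') in
  let x := root v0 (fst d) in let A := carrier (fst d) in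
  match side with
  | 0 => (PW x (fun v => A v /\ blt x v y), t)
  | 1 => (PW x (fun v => A v /\ blt x y v), t)
  | 2 => (PP (fun v => A v /\ same x v y), t)
  | _ => (PW y (fun v => A v /\ v <> y), t)
  end.

(** After the labels of the moves have been made equal, Ramsey's theorem selects one winning side.
    Sides 0 and 1 give words below the old ones; side 2 gives plain states, which [psub] does not
    compare with words, hence the alternative. *)
Lemma word_step (v0 : V) H f : bad_array state wins H f -> (forall s, subset s H -> infinite s -> word (f s)) ->
  exists K g, subset K H /\ bad_array state wins K g /\
    (pointwise state K g f state_lt \/
     forall s, subset s K -> infinite s -> plain (g s) /\ subset (carrier (fst (g s))) (carrier (fst (f s))) /\
        olt (snd (g s)) (snd (f s))).
Proof.
  intros a w. assert (a' := a). destruct a' as [Hi [c r]].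
  assert (sub_tl : forall K s, subset s K -> subset (tl s) K).
  { intros K s h. eapply subset_trans; [apply tl_subset|auto]. }
  pose (lab := fun s => adj (root v0 (fst (f s))) (move v0 (f s) (f (tl s)))).
  assert (exists K0, subset K0 H /\ infinite K0 /\ forall s, subset s K0 -> infinite s -> (lab s <-> lab (tl s)))
    as [K0 [k1 [k2 k3]]].
  { destruct (ramsey_continuous H f (fun d e => adj (root v0 (fst d)) (move v0 d e)) Hi c) as [K [h1 [h2 [h3|h3]]]];
      exists K; split; auto; split; auto; intros s s1 s2; split; intro h.
    - apply h3; auto using tl_infinite.
    - apply h3; auto.
    - exfalso; eapply h3; eauto.
    - exfalso. apply (h3 (tl s)); auto using tl_infinite. }
  pose (g := fun n s => derive n v0 (f s) (f (tl s)) (f (tl (tl s)))).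
  assert (gc : forall n K, subset K H -> continuous state K (g n)).
  { intros n K h. apply (continuous_tail K f (derive n v0)). eapply continuous_subset; eauto. }
  assert (spec : forall s, subset s K0 -> infinite s ->
    olt (sub_ord (snd (f s)) (move v0 (f (tl s)) (f (tl (tl s))))) (snd (f s)) /\
    (wins (g 0 s) (g 0 (tl s)) \/ wins (g 1 s) (g 1 (tl s)) \/ wins (g 2 s) (g 2 (tl s)))).
  { intros s s1 s2.
    assert (s3 : subset s H) by (eapply subset_trans; eauto).
    assert (i1 := tl_infinite _ s2).
    destruct (move_spec v0 _ _ (r s s3 s2)) as [h1 h2].
    destruct (move_spec v0 _ _ (r (tl s) (sub_tl _ _ s3) i1)) as [h3 _].
    destruct (h2 _ h3) as [h4 h5]. split; auto.
    specialize (k3 s s1 s2). unfold lab in k3. unfold wins, g, derive. unfold winning_reply in h5.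
    destruct (w s s3 s2) as [x [A e1]]. destruct (w (tl s) (sub_tl _ _ s3) i1) as [x' [B e2]].
    rewrite e1, e2 in *. simpl in *. destruct h5 as [h5|h5]; [tauto|]. exact h5. }
  assert (fin : forall n K, n < 3 -> subset K K0 -> infinite K ->
     (forall s, subset s K -> infinite s -> wins (g n s) (g n (tl s))) -> exists K g, subset K H /\ bad_array state wins K g /\
    (pointwise state K g f state_lt \/
     forall s, subset s K -> infinite s -> plain (g s) /\ subset (carrier (fst (g s))) (carrier (fst (f s))) /\
        olt (snd (g s)) (snd (f s)))).
  { intros n K hn h1 h2 h3.
    assert (h1' : subset K H) by (eapply subset_trans; eauto).
    exists K, (g n). split; [auto|split; [split; [auto|split; auto]|]].
    assert (aux : forall s, subset s K -> infinite s -> (exists x A, fst (f s) = PW x A) /\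
      olt (sub_ord (snd (f s)) (move v0 (f (tl s)) (f (tl (tl s))))) (snd (f s))).
    { intros s s1 s2. split; [apply w|apply spec]; auto; eapply subset_trans; eauto. }
    destruct n as [|[|[|n]]]; [left|left|right|lia]; intros s s1 s2;
      destruct (aux s s1 s2) as [[x [A e1]] h4];
      unfold g, derive, state_lt; simpl; rewrite ?e1; simpl.
    - split; [split; auto; intros v [h _]; auto|auto].
    - split; [split; auto; intros v [h _]; auto|auto].
    - split; [eexists; reflexivity|split; auto; intros v [h _]; auto]. }
  destruct (ramsey_continuous K0 (g 0) wins k2 (gc 0 K0 k1)) as [K1 [l1 [l2 [l3|l3]]]].
  { apply (fin 0 K1); auto. }
  destruct (ramsey_continuous K1 (g 1) wins l2) as [K2 [m1 [m2 [m3|m3]]]].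
  { apply gc. eapply subset_trans; eauto. }
  { apply (fin 1 K2); auto. eapply subset_trans; eauto. }
  (* On [K2] sides 0 and 1 never win, so [spec] leaves side 2. *)
  apply (fin 2 K2); auto. { eapply subset_trans; eauto. }
  intros s s1 s2.
  assert (s3 : subset s K1) by (eapply subset_trans; eauto).
  assert (s4 : subset s K0) by (eapply subset_trans; eauto).
  destruct (proj2 (spec s s4 s2)) as [h|[h|h]]; auto.
  - exfalso; eapply l3; eauto.
  - exfalso; eapply m3; eauto.
Qed.

(** Otherwise [word_step] would lower every bad array of words below [f], against
    [minimal_bad_array]. *)
Lemma word_to_plain (v0 : V) H f : bad_array state wins H f -> (forall s, subset s H -> infinite s -> word (f s)) ->
  exists K g, subset K H /\ bad_array state wins K g /\
    forall s, subset s K -> infinite s -> plain (g s) /\ subset (carrier (fst (g s))) (carrier (fst (f s))) /\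
        olt (snd (g s)) (snd (f s)).
Proof.
  intros a w. apply NNPP; intro no.
  apply (minimal_bad_array state wins state_lt state_lt_wf state_lt_trans wins_lt H f a).
  intros K f' k1 a' le.
  assert (w' : forall s, subset s K -> infinite s -> word (f' s)).
  { intros s s1 s2. destruct (w s) as [x [A e]]; auto. { eapply subset_trans; eauto. }
    destruct (le s s1 s2) as [->|[h _]]; [exists x, A; auto|].
    rewrite e in h. destruct (fst (f' s)) as [B|y B] eqn:E; simpl in h; [tauto|]. exists y, B; auto. }
  destruct (word_step v0 K f' a' w') as [K' [g [h1 [h2 [h3|h3]]]]]; [exists K', g; auto|].
  exfalso; apply no. exists K', g. split; [eapply subset_trans; eauto|split; auto].
  intros s s1 s2. destruct (h3 s s1 s2) as [h4 [h5 h6]]. split; auto.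
  assert (s3 : subset s K) by (eapply subset_trans; eauto).
  destruct (le s s3 s2) as [<-|[h7 h8]]; [auto|]. split; [|eapply t_trans; eauto].
  eapply subset_trans; [exact h5|]. destruct (fst (f' s)), (fst (f s)); simpl in *; tauto.
Qed.

(** One round turns a plain bad array into a bad array of words with smaller sets and clocks, and
    [word_to_plain] leads back to a plain one strictly below the first. So no plain bad array is
    minimal. *)
Lemma no_plain_bad_array (v0 : V) H f : bad_array state wins H f -> (forall s, subset s H -> infinite s -> plain (f s)) -> False.
Proof.
  intros a w. apply (minimal_bad_array state wins state_lt state_lt_wf state_lt_trans wins_lt H f a).
  intros K f' k1 [Ki [c r]] le.
  assert (w' : forall s, subset s K -> infinite s -> plain (f' s)).
  { intros s s1 s2. destruct (w s) as [A e]; auto. { eapply subset_trans; eauto. }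
    destruct (le s s1 s2) as [->|[h _]]; [exists A; auto|].
    rewrite e in h. destruct (fst (f' s)) as [B|y B] eqn:E; simpl in h; [|tauto]. exists B; auto. }
  pose (g := fun s => derive 3 v0 (f' s) (f' (tl s)) (f' (tl (tl s)))).
  assert (spec : forall s, subset s K -> infinite s ->
    olt (snd (g s)) (snd (f' s)) /\ wins (g s) (g (tl s))).
  { intros s s1 s2.
    assert (t1 : subset (tl s) K) by (eapply subset_trans; [apply tl_subset|auto]).
    assert (i1 := tl_infinite _ s2).
    destruct (move_spec v0 _ _ (r s s1 s2)) as [h1 h2].
    destruct (move_spec v0 _ _ (r (tl s) t1 i1)) as [h3 _].
    destruct (h2 _ h3) as [h4 h5]. split; auto.
    unfold wins, g, derive. unfold winning_reply in h5.
    destruct (w' s s1 s2) as [A e1]. destruct (w' (tl s) t1 i1) as [B e2].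
    rewrite e1, e2 in *. simpl in *. exact h5. }
  destruct (word_to_plain v0 K g) as [K' [g' [h1 [h2 h3]]]].
  - split; [auto|split]. + apply (continuous_tail K f' (derive 3 v0) c). + intros s s1 s2; apply spec; auto.
  - intros s _ _. eexists; eexists; reflexivity.
  - exists K', g'. split; [auto|split; auto]. intros s s1 s2.
    assert (s3 : subset s K) by (eapply subset_trans; eauto).
    destruct (h3 s s1 s2) as [[A e] [h4 h5]]. destruct (w' s s3 s2) as [B e'].
    split; [|eapply t_trans; [exact h5|apply spec; auto]].
    rewrite e, e' in *. unfold g, derive in h4. simpl in *. rewrite e' in h4. simpl in h4.
    intros v hv. apply h4 in hv. tauto.
Qed.

Lemma no_word_bad_array (v0 : V) H f : bad_array state wins H f -> (forall s, subset s H -> infinite s -> word (f s)) -> False.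
Proof.
  intros a w. destruct (word_to_plain v0 H f a w) as [K [g [h1 [h2 h3]]]].
  apply (no_plain_bad_array v0 K g h2). intros s s1 s2; apply h3; auto.
Qed.

Definition minimum (s : nat -> Prop) : nat := epsilon (inhabits 0) (fun n => s n /\ forall m, s m -> n <= m).

Lemma minimum_spec s : infinite s -> s (minimum s) /\ forall m, s m -> minimum s <= m.
Proof.
  intro h. unfold minimum. apply epsilon_spec. destruct (h 0) as [n [_ sn]].
  induction n as [n IH] using lt_wf_ind.
  destruct (classic (exists m, s m /\ m < n)) as [[m [h1 h2]]|h']; [eapply IH; eauto|].
  exists n; split; auto. intros m hm. destruct (le_lt_dec n m); auto. exfalso; eauto.
Qed.

Lemma minimum_agree s t : infinite s -> infinite t -> agree (S (minimum s)) s t -> minimum t = minimum s.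
Proof.
  intros hs ht a. destruct (minimum_spec s hs) as [h1 h2]. destruct (minimum_spec t ht) as [h3 h4].
  assert (minimum t <= minimum s) by (apply h4, a; auto).
  assert (minimum s <= minimum t). { apply h2, a; auto. lia. } lia.
Qed.

(** The clock of the game for [p i] and [p j] depends on both indices, so the state attached to [s]
    uses its two least elements. *)
Lemma sequence_good (v0 : V) (p : nat -> pos) :
  (forall i, exists A, p i = PP A) \/ (forall i, exists x A, p i = PW x A) ->
  exists i j, i < j /\ ~ exists t, Iwin t (p i) (p j).
Proof.
  intro sort. apply NNPP; intro no.
  assert (h : forall i j, i < j -> exists t, Iwin t (p i) (p j)).
  { intros i j hij. apply NNPP; intro h. apply no; exists i, j; auto. }
  pose (T := fun i j => epsilon (inhabits ozero) (fun t => Iwin t (p i) (p j))).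
  assert (hT : forall i j, i < j -> Iwin (T i j) (p i) (p j)).
  { intros i j hij. unfold T. apply epsilon_spec. auto. }
  pose (f := fun s => (p (minimum s), T (minimum s) (minimum (tl s)))).
  assert (hm : forall s, infinite s -> minimum s < minimum (tl s)).
  { intros s hs. destruct (minimum_spec _ (tl_infinite s hs)) as [[h1 [m [h2 h3]]] _].
    destruct (minimum_spec s hs) as [_ h4]. specialize (h4 m h2). lia. }
  assert (a : bad_array state wins (fun _ => True) f).
  { split; [intro n; exists n; auto|split].
    - intros s _ s2. exists (S (minimum s) + S (minimum (tl s))). intros t _ t2 ta.
      unfold f. rewrite (minimum_agree s t), (minimum_agree (tl s) (tl t)); auto using tl_infinite.
      + eapply agree_le; [|apply agree_tl; exact ta]; lia.
      + eapply agree_le; [|exact ta]; lia.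
    - intros s _ s2. unfold wins, f; simpl. apply hT. auto. }
  destruct sort as [w|w].
  - apply (no_plain_bad_array v0 _ f a). intros s _ _. exact (w (minimum s)).
  - apply (no_word_bad_array v0 _ f a). intros s _ _. exact (w (minimum s)).
Qed.

End Game.

Arguments PP {V} A.
Arguments PW {V} x A.

(** * Countable cographs are well-quasi-ordered *)

Definition embeds_in {V : Type} (adj : V -> V -> Prop) (A B : V -> Prop) :=
  exists f : V -> V, (forall v, A v -> B (f v)) /\
    forall v w, A v -> A w -> v <> w -> f v <> f w /\ (adj v w <-> adj (f v) (f w)).

Definition rooted_embeds_in {V : Type} (adj : V -> V -> Prop) (x : V) (A B : V -> Prop) :=
  exists f : V -> V, (forall v, A v -> B (f v) /\ (adj x v <-> adj x (f v))) /\
    forall v w, A v -> A w -> v <> w -> f v <> f w /\ (adj v w <-> adj (f v) (f w)).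

Section Embedding.
Variables (V : Type) (adj : V -> V -> Prop) (blt : V -> V -> V -> Prop) (e : V -> nat).
Hypothesis e_inj : forall v w, e v = e w -> v = w.
Hypothesis adj_sym : forall v w, adj v w -> adj w v.
Hypothesis blt_asym : forall x y z, blt x y z -> ~ blt x z y.
Hypothesis blt_weak : forall x y z w, blt x y z -> blt x y w \/ blt x w z.
Hypothesis blt_adj : forall x y z, blt x y z -> (adj y z <-> adj x z).
Hypothesis same_label : forall x y z, same V blt x y z -> (adj x y <-> adj x z).

Notation Iwin := (Iwin V adj blt).
Notation same := (same V blt).

Definition not_lost (p q : pos V) := ~ exists t, Iwin t p q.

(** If every answer lost within some clock, these clocks would be the branches of one clock for the
    whole game. *)
Lemma not_lost_plain A B x : not_lost (PP A) (PP B) -> A x ->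
  exists x', B x' /\ not_lost (PW x (fun v => A v /\ v <> x)) (PW x' (fun v => B v /\ v <> x')).
Proof.
  intros n a. apply NNPP; intro no. apply n.
  pose (h := fun x' => epsilon (inhabits (ozero V)) (fun t =>
    Iwin t (PW x (fun v => A v /\ v <> x)) (PW x' (fun v => B v /\ v <> x')))).
  exists (olim V h). exists x; split; auto. intros x' b. unfold h. apply epsilon_spec.
  apply NNPP; intro l. apply no; exists x'; split; auto.
Qed.

Lemma not_lost_word x A x' B y : not_lost (PW x A) (PW x' B) -> A y ->
  exists y', B y' /\ (adj x y <-> adj x' y')
    /\ not_lost (PW x (fun v => A v /\ blt x v y)) (PW x' (fun v => B v /\ blt x' v y'))
    /\ not_lost (PW x (fun v => A v /\ blt x y v)) (PW x' (fun v => B v /\ blt x' y' v))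
    /\ not_lost (PP (fun v => A v /\ same x v y)) (PP (fun v => B v /\ same x' v y')).
Proof.
  intros n a. apply NNPP; intro no. apply n.
  pose (h := fun y' => epsilon (inhabits (ozero V)) (fun t =>
    ~ (adj x y <-> adj x' y')
      \/ Iwin t (PW x (fun v => A v /\ blt x v y)) (PW x' (fun v => B v /\ blt x' v y'))
      \/ Iwin t (PW x (fun v => A v /\ blt x y v)) (PW x' (fun v => B v /\ blt x' y' v))
      \/ Iwin t (PP (fun v => A v /\ same x v y)) (PP (fun v => B v /\ same x' v y')))).
  exists (olim V h). exists y; split; auto. intros y' b. unfold h. apply epsilon_spec.
  apply NNPP; intro l. apply no; exists y'; split; auto.
  assert (l' : forall t, ~ (~ (adj x y <-> adj x' y')
      \/ Iwin t (PW x (fun v => A v /\ blt x v y)) (PW x' (fun v => B v /\ blt x' v y'))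
      \/ Iwin t (PW x (fun v => A v /\ blt x y v)) (PW x' (fun v => B v /\ blt x' y' v))
      \/ Iwin t (PP (fun v => A v /\ same x v y)) (PP (fun v => B v /\ same x' v y')))) by eauto.
  split; [apply NNPP; intro; apply (l' (ozero V)); auto|].
  repeat split; intros [t ht]; apply (l' t); auto.
Qed.

Definition good_reply (p q : pos V) (y y' : V) : Prop :=
  match p, q with
  | PP A, PP B => B y' /\ not_lost (PW y (fun v => A v /\ v <> y)) (PW y' (fun v => B v /\ v <> y'))
  | PW x A, PW x' B => B y' /\ (adj x y <-> adj x' y')
    /\ not_lost (PW x (fun v => A v /\ blt x v y)) (PW x' (fun v => B v /\ blt x' v y'))
    /\ not_lost (PW x (fun v => A v /\ blt x y v)) (PW x' (fun v => B v /\ blt x' y' v))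
    /\ not_lost (PP (fun v => A v /\ same x v y)) (PP (fun v => B v /\ same x' v y'))
  | _, _ => False
  end.

Definition reply (p q : pos V) (y : V) : V := epsilon (inhabits y) (good_reply p q y).

Definition least (A : V -> Prop) (x : V) := A x /\ forall u, A u -> e x <= e u.

Lemma least_unique A x y : least A x -> least A y -> x = y.
Proof. intros [h1 h2] [h3 h4]. apply e_inj. specialize (h2 y h3). specialize (h4 x h1). lia. Qed.

Lemma least_exists A v : A v -> exists x, least A x.
Proof.
  intro a. remember (e v) as n. revert v a Heqn. induction n as [n IH] using lt_wf_ind. intros v a E. subst.
  destruct (classic (exists u, A u /\ e u < e v)) as [[u [h1 h2]]|h]; [eapply IH; eauto|].
  exists v; split; auto. intros u hu. destruct (le_lt_dec (e v) (e u)); auto. exfalso; eauto.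
Qed.

(* Player I always plays the least vertex, player II uses [reply]; [v] is answered by [v']. *)
Inductive image : pos V -> pos V -> V -> V -> Prop :=
| image_root A B x : least A x -> image (PP A) (PP B) x (reply (PP A) (PP B) x)
| image_plain A B x v v' : least A x -> A v -> v <> x ->
    image (PW x (fun v => A v /\ v <> x))
          (PW (reply (PP A) (PP B) x) (fun v => B v /\ v <> reply (PP A) (PP B) x)) v v' ->
    image (PP A) (PP B) v v'
| image_lower x A x' B y v v' : least A y -> A v -> blt x v y ->
    image (PW x (fun v => A v /\ blt x v y))
          (PW x' (fun v => B v /\ blt x' v (reply (PW x A) (PW x' B) y))) v v' ->
    image (PW x A) (PW x' B) v v'
| image_upper x A x' B y v v' : least A y -> A v -> blt x y v ->
    image (PW x (fun v => A v /\ blt x y v))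
          (PW x' (fun v => B v /\ blt x' (reply (PW x A) (PW x' B) y) v)) v v' ->
    image (PW x A) (PW x' B) v v'
| image_same x A x' B y v v' : least A y -> A v -> same x v y ->
    image (PP (fun v => A v /\ same x v y))
          (PP (fun v => B v /\ same x' v (reply (PW x A) (PW x' B) y))) v v' ->
    image (PW x A) (PW x' B) v v'.

Lemma reply_plain A B x : not_lost (PP A) (PP B) -> least A x -> good_reply (PP A) (PP B) x (reply (PP A) (PP B) x).
Proof. intros n [l _]. unfold reply. apply epsilon_spec. exact (not_lost_plain A B x n l). Qed.

Lemma reply_word x A x' B y : not_lost (PW x A) (PW x' B) -> least A y ->
  good_reply (PW x A) (PW x' B) y (reply (PW x A) (PW x' B) y).
Proof. intros n [l _]. unfold reply. apply epsilon_spec. exact (not_lost_word x A x' B y n l). Qed.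

Lemma same_refl x y : same x y y.
Proof. split; intro h; exact (blt_asym _ _ _ h h). Qed.

(** The codes occurring in the position are at least [k], and playing the least vertex raises this
    bound, so the play reaches [v]. *)
Lemma image_total n : forall k v, e v <= k + n ->
  (forall A B, A v -> (forall u, A u -> k <= e u) -> exists v', image (PP A) (PP B) v v') /\
  (forall x A x' B, A v -> (forall u, A u -> k <= e u) -> exists v', image (PW x A) (PW x' B) v v').
Proof.
  induction n as [|n IH]; intros k v hv.
  - assert (L : forall A : V -> Prop, A v -> (forall u, A u -> k <= e u) -> least A v).
    { intros A a l. split; auto. intros u hu. specialize (l u hu). lia. }
    assert (G : forall A B, A v -> (forall u, A u -> k <= e u) -> exists v', image (PP A) (PP B) v v').
    { intros A B a l. eexists. apply image_root; auto. }
    split; auto. intros x A x' B a l.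
    destruct (G (fun u => A u /\ same x u v) (fun u => B u /\ same x' u (reply (PW x A) (PW x' B) v))) as [v' h].
    + split; [auto|apply same_refl].
    + intros u [hu _]; auto.
    + exists v'. eapply image_same; eauto. apply same_refl.
  (* Entering the node of [y] removes no vertex, since [y] lies in it; only the plain round after
     that does. So the plain case is settled first, for the same [n], and the word case falls back
     on it. *)
  - assert (G : forall A B, A v -> (forall u, A u -> k <= e u) -> exists v', image (PP A) (PP B) v v').
    { intros A B a l. destruct (least_exists A v a) as [x lx].
      destruct (classic (v = x)) as [->|ne]; [eexists; apply image_root; auto|].
      destruct (proj2 (IH (S k) v ltac:(lia)) x (fun v => A v /\ v <> x)
        (reply (PP A) (PP B) x) (fun v => B v /\ v <> reply (PP A) (PP B) x)) as [v' h]; auto.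
      - intros u [h1 h2]. destruct lx as [l1 l2]. specialize (l x l1). specialize (l2 u h1).
        assert (e u <> e x) by (intro E; apply h2, e_inj; auto). lia.
      - exists v'. eapply image_plain; eauto. }
    split; auto. intros x A x' B a l. destruct (least_exists A v a) as [y ly].
    assert (step : forall u, A u -> u <> y -> S k <= e u).
    { intros u h1 h2. destruct ly as [l1 l2]. specialize (l y l1). specialize (l2 u h1).
      assert (e u <> e y) by (intro E; apply h2, e_inj; auto). lia. }
    destruct (classic (blt x v y)) as [b1|b1]; [|destruct (classic (blt x y v)) as [b2|b2]].
    + destruct (proj2 (IH (S k) v ltac:(lia)) x (fun v => A v /\ blt x v y)
        x' (fun v => B v /\ blt x' v (reply (PW x A) (PW x' B) y))) as [v' h]; auto.
      * intros u [h1 h2]. apply step; auto. intros ->. exact (blt_asym _ _ _ h2 h2).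
      * exists v'. eapply image_lower; eauto.
    + destruct (proj2 (IH (S k) v ltac:(lia)) x (fun v => A v /\ blt x y v)
        x' (fun v => B v /\ blt x' (reply (PW x A) (PW x' B) y) v)) as [v' h]; auto.
      * intros u [h1 h2]. apply step; auto. intros ->. exact (blt_asym _ _ _ h2 h2).
      * exists v'. eapply image_upper; eauto.
    + destruct (G (fun u => A u /\ same x u y) (fun u => B u /\ same x' u (reply (PW x A) (PW x' B) y))) as [v' h].
      * split; [auto|split; auto].
      * intros u [hu _]; auto.
      * exists v'. eapply image_same; eauto. split; auto.
Qed.

Lemma image_mem p q v v' : image p q v v' -> not_lost p q -> carrier V q v' /\
  match p, q with PW x _, PW x' _ => adj x v <-> adj x' v' | _, _ => True end.
Proof.
  induction 1 as [A B x l|A B x v v' l a ne i IH|x A x' B y v v' l a b i IH|x A x' B y v v' l a b i IH|x A x' B y v v' l a b i IH];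
    intro n.
  - split; auto. apply (reply_plain A B x n l).
  - split; auto. apply IH. apply (reply_plain A B x n l).
  - destruct IH as [h1 h2]; [apply (reply_word x A x' B y n l)|]. split; auto. apply h1.
  - destruct IH as [h1 h2]; [apply (reply_word x A x' B y n l)|]. split; auto. apply h1.
  - destruct (reply_word x A x' B y n l) as [g1 [g2 [g3 [g4 g5]]]].
    destruct IH as [[h1 h2] _]; auto. split; auto.
    rewrite (same_label x v y b), g2. symmetry. apply same_label; auto.
Qed.

Lemma adj_iff v w : adj v w <-> adj w v.
Proof. split; apply adj_sym. Qed.

(* The vertices answering [v] and [w] lie on the same sides, so [blt_adj] computes both adjacencies. *)
Lemma blt_image x v w x' v' w' : blt x v w -> blt x' v' w' -> (adj x w <-> adj x' w') ->
  v' <> w' /\ (adj v w <-> adj v' w').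
Proof.
  intros b b' l. split.
  - intros ->. exact (blt_asym _ _ _ b' b').
  - rewrite (blt_adj _ _ _ b), (blt_adj _ _ _ b'); auto.
Qed.

Lemma blt_same_r x v w y : blt x v y -> same x w y -> blt x v w.
Proof. intros b [h1 h2]. destruct (blt_weak x v y w b); tauto. Qed.

Lemma blt_same_l x v w y : blt x y w -> same x v y -> blt x v w.
Proof. intros b [h1 h2]. destruct (blt_weak x y w v b); tauto. Qed.

Lemma blt_trans x u v w : blt x u v -> blt x v w -> blt x u w.
Proof. intros b1 b2. destruct (blt_weak x u v w b1); auto. exfalso; eapply blt_asym; eauto. Qed.

(** Names [j] the premise produced by inverting [i]: it concerns the same [w] and [w'], at other
    positions. *)
Ltac name_new i w w' := lazymatch type of i with ?T =>
  match goal with h : image _ _ w w' |- _ => lazymatch type of h with T => fail | _ => rename h into j end end end.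

(** Induction along the play that reaches [v]. If [w] is on the same side, the play continues;
    otherwise one round separates both [v] from [w] and their answers, and the labels determine the
    adjacency. *)
Lemma image_embeds p q v v' : image p q v v' -> not_lost p q -> forall w w', image p q w w' -> v <> w ->
  v' <> w' /\ (adj v w <-> adj v' w').
Proof.
  assert (swap : forall v w v' w' : V, w' <> v' /\ (adj w v <-> adj w' v') -> v' <> w' /\ (adj v w <-> adj v' w')).
  { intros ? ? ? ? [h1 h2]; split; [congruence|]. rewrite (adj_iff v0), (adj_iff v'0). exact h2. }
  induction 1 as [A B x l|A B x v v' l a ne i IH|x A x' B y v v' l a b i IH|x A x' B y v v' l a b i IH|x A x' B y v v' l a b i IH];
    intros n w w' i' ne'.
  - inversion i'; subst; [exfalso; apply ne'; eapply least_unique; eauto|]. name_new i' w w'.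
    assert (x0 = x) by (eapply least_unique; eauto); subst x0.
    destruct (reply_plain A B x n l) as [g1 g2].
    destruct (image_mem _ _ _ _ j g2) as [[h1 h2] h3]. split; [congruence|exact h3].
  - destruct (reply_plain A B x n l) as [g1 g2].
    inversion i'; subst.
    + assert (w = x) by (eapply least_unique; eauto); subst w.
      destruct (image_mem _ _ _ _ i g2) as [[h1 h2] h3]. apply swap; split; [congruence|exact h3].
    + assert (x0 = x) by (eapply least_unique; eauto); subst x0. apply IH; auto.
  - destruct (reply_word x A x' B y n l) as [g1 [g2 [g3 [g4 g5]]]].
    assert (m := image_mem _ _ _ _ i g3).
    inversion i'; subst; (assert (y0 = y) by (eapply least_unique; eauto); subst y0); name_new i' w w'.
    + apply IH; auto.
    + assert (m' := image_mem _ _ _ _ j g4). simpl in m, m'.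
      apply (blt_image x v w x'); [eapply blt_trans; eauto|eapply blt_trans; [apply m|apply m']|apply m'].
    + assert (m' := image_mem _ _ _ _ j g5). assert (m'' := image_mem _ _ _ _ i' n). simpl in m, m', m''.
      apply (blt_image x v w x'); [eapply blt_same_r; eauto|eapply blt_same_r; [apply m|apply m']|apply m''].
  - destruct (reply_word x A x' B y n l) as [g1 [g2 [g3 [g4 g5]]]].
    assert (m := image_mem _ _ _ _ i g4).
    inversion i'; subst; (assert (y0 = y) by (eapply least_unique; eauto); subst y0); name_new i' w w'.
    + assert (m' := image_mem _ _ _ _ j g3). simpl in m, m'.
      apply swap, (blt_image x w v x'); [eapply blt_trans; eauto|eapply blt_trans; [apply m'|apply m]|apply m].
    + apply IH; auto.
    + assert (m' := image_mem _ _ _ _ j g5). simpl in m, m'.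
      apply swap, (blt_image x w v x'); [eapply blt_same_l; eauto|eapply blt_same_l; [apply m|apply m']|apply m].
  - destruct (reply_word x A x' B y n l) as [g1 [g2 [g3 [g4 g5]]]].
    assert (m := image_mem _ _ _ _ i g5).
    assert (mv : adj x v <-> adj x' v').
    { apply (image_mem (PW x A) (PW x' B)); auto. eapply image_same; eauto. }
    inversion i'; subst; (assert (y0 = y) by (eapply least_unique; eauto); subst y0); name_new i' w w'.
    + assert (m' := image_mem _ _ _ _ j g3). simpl in m, m'.
      apply swap, (blt_image x w v x'); [eapply blt_same_r; eauto|eapply blt_same_r; [apply m'|apply m]|auto].
    + assert (m' := image_mem _ _ _ _ j g4). simpl in m, m'.
      apply (blt_image x v w x'); [eapply blt_same_l; eauto|eapply blt_same_l; [apply m'|apply m]|apply m'].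
    + apply IH; auto.
Qed.

Lemma image_function p q : not_lost p q -> exists f : V -> V, forall v, carrier V p v ->
  (match p, q with PP _, PP _ => True | PW _ _, PW _ _ => True | _, _ => False end) -> image p q v (f v).
Proof.
  intro n. exists (fun v => epsilon (inhabits v) (fun v' => image p q v v')).
  intros v a s. apply epsilon_spec.
  destruct (image_total (e v) 0 v ltac:(lia)) as [h1 h2].
  destruct p, q; try tauto; [apply h1|apply h2]; auto; intros; lia.
Qed.

Theorem subsets_wqo (A : nat -> V -> Prop) : exists i j, i < j /\ embeds_in adj (A i) (A j).
Proof.
  destruct (classic (inhabited V)) as [[v0]|nv].
  2:{ exists 0, 1. split; auto. exists (fun v => v). split; intros v; exfalso; apply nv; constructor; exact v. }
  destruct (sequence_good V adj blt v0 (fun i => PP (A i))) as [i [j [h n]]]; [left; eauto|].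
  exists i, j; split; auto. destruct (image_function _ _ n) as [f hf]. simpl in hf.
  exists f; split.
  - intros v a. apply (image_mem _ _ _ _ (hf v a I) n).
  - intros v w a b ne. apply (image_embeds _ _ _ _ (hf v a I) n w _ (hf w b I) ne).
Qed.

Theorem rooted_subsets_wqo x (A : nat -> V -> Prop) : exists i j, i < j /\ rooted_embeds_in adj x (A i) (A j).
Proof.
  destruct (sequence_good V adj blt x (fun i => PW x (A i))) as [i [j [h n]]]; [right; eauto|].
  exists i, j; split; auto. destruct (image_function _ _ n) as [f hf]. simpl in hf.
  exists f; split.
  - intros v a. apply (image_mem _ _ _ _ (hf v a I) n).
  - intros v w a b ne. apply (image_embeds _ _ _ _ (hf v a I) n w _ (hf w b I) ne).
Qed.

End Embedding.

(** * The order of a cograph seen from one of its vertices *)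

Section CographOrder.
Variable G : graph.
Hypothesis cog : cograph G.

(* [y] lies in a strong module containing [x] but not [z]. *)
Definition closer (x y z : vert G) : Prop :=
  (~ (adj x y <-> adj x z) /\ (adj y z <-> adj x z)) \/
  ((adj x y <-> adj x z) /\ exists w, ~ (adj x w <-> adj x y) /\ (adj y w <-> adj x w) /\ (adj w z <-> adj x z)).

Lemma gadj_iff (v w : vert G) : adj v w <-> adj w v.
Proof. split; apply adj_sym. Qed.

Lemma no_P4 (a b c d : vert G) : adj a b -> adj b c -> adj c d ->
  a <> c -> b <> d -> a <> d -> ~ adj a c -> ~ adj b d -> ~ adj a d -> False.
Proof. intros; apply cog. exists a, b, c, d. tauto. Qed.

(** Equivalently, the traces on the non-neighbours of [x] of the neighbourhoods of its neighbours
    form a chain. A crossing contains an induced path, located by whether [n], [n'] and [m], [m']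
    are adjacent. *)
Lemma no_crossing (x n n' m m' : vert G) : adj x n -> adj x n' -> ~ adj x m -> ~ adj x m' ->
  adj n m -> adj n' m' -> ~ adj n m' -> ~ adj n' m -> False.
Proof.
  intros h1 h2 h3 h4 h5 h6 h7 h8.
  assert (s := gadj_iff).
  assert (m <> x) by (intros ->; apply h8, s; auto).
  assert (m' <> x) by (intros ->; apply h7, s; auto).
  assert (n <> n') by (intros ->; auto).
  assert (m <> m') by (intros ->; auto).
  assert (n <> m') by (intros ->; auto).
  assert (n' <> m) by (intros ->; auto).
  assert (n <> m) by (intros ->; eapply adj_irrefl; eauto).
  destruct (classic (adj n n')) as [q|q].
  - destruct (classic (adj m m')) as [r|r].
    + apply (no_P4 x n m m'); auto; congruence.
    + apply (no_P4 m n n' m'); auto; try congruence; rewrite s; auto.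
  - apply (no_P4 m n x n'); auto; try congruence; rewrite s; auto.
Qed.

Lemma closer_asym x y z : closer x y z -> ~ closer x z y.
Proof.
  assert (s := gadj_iff).
  intros [[h1 h2]|[h1 [w [w1 [w2 w3]]]]] [[k1 k2]|[k1 [u [u1 [u2 u3]]]]]; try tauto.
  - rewrite (s z y) in k2. tauto.
  - rewrite (s w z) in w3. rewrite (s u y) in u3.
    destruct (classic (adj x y)) as [a|a].
    + apply (no_crossing x z y w u); tauto.
    + apply (no_crossing x w u y z); try tauto; rewrite s; tauto.
Qed.

Lemma closer_total x y z : ~ (adj x y <-> adj x z) -> closer x y z \/ closer x z y.
Proof.
  intro h. destruct (classic (adj y z <-> adj x z)) as [k|k]; [left; left; auto|].
  right; left. rewrite (gadj_iff z y). tauto.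
Qed.

(** Vertices of equal label are compared through one of the other label; this lemma and
    [closer_between] reduce every comparison to pairs of different labels. *)
Lemma closer_via x y w z : (adj x y <-> adj x z) -> ~ (adj x w <-> adj x y) ->
  closer x y w -> closer x w z -> closer x y z.
Proof.
  intros h k [a|a] [b|b]; try tauto. right; split; auto. exists w; tauto.
Qed.

Lemma closer_between x y z : (adj x y <-> adj x z) -> closer x y z ->
  exists w, ~ (adj x w <-> adj x y) /\ closer x y w /\ closer x w z.
Proof.
  intros h [a|[_ [w [w1 [w2 w3]]]]]; [tauto|]. exists w. split; auto. split; left; tauto.
Qed.

(** Negative transitivity: incomparability becomes an equivalence, so the vertices form a linearly
    ordered family of nodes. *)
Lemma closer_weak x y z w : closer x y z -> closer x y w \/ closer x w z.
Proof.
  intro c. destruct (classic (adj x y <-> adj x z)) as [h|h].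
  - destruct (classic (adj x w <-> adj x y)) as [k|k].
    + destruct (closer_between x y z h c) as [u [u1 [u2 u3]]].
      destruct (closer_total x u w) as [q|q]; [tauto| |].
      * left. apply (closer_via x y u w); tauto.
      * right. apply (closer_via x w u z); tauto.
    + destruct (closer_total x y w) as [q|q]; [tauto|auto|].
      destruct (closer_total x w z) as [r|r]; [tauto|auto|].
      exfalso. apply (closer_asym x y z c). apply (closer_via x z w y); tauto.
  - destruct (classic (adj x w <-> adj x y)) as [k|k].
    + destruct (closer_total x w z) as [q|q]; [tauto|auto|].
      left. apply (closer_via x y z w); tauto.
    + destruct (closer_total x y w) as [q|q]; [tauto|auto|].
      right. apply (closer_via x w y z); tauto.
Qed.

(** For different labels this is part of the definition; for equal ones a violation makes [x], [y],
    [z] and the intermediate [w] an induced path. *)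
Lemma closer_adj x y z : closer x y z -> (adj y z <-> adj x z).
Proof.
  assert (s := gadj_iff).
  intros [h|[h [w [w1 [w2 w3]]]]]; [tauto|].
  destruct (classic (adj x y)) as [a|a].
  - assert (az : adj x z) by tauto. assert (nw : ~ adj x w) by tauto.
    assert (h1 : ~ adj y w) by tauto. assert (h2 : adj w z) by tauto.
    split; [auto|intros _]. apply NNPP; intro ny.
    assert (y <> z) by (intros ->; apply h1, s; auto).
    assert (x <> w) by (intros ->; apply h1, s; auto).
    assert (y <> w) by (intros ->; auto).
    apply (no_P4 y x z w); auto; apply s; auto.
  - assert (az : ~ adj x z) by tauto. assert (nw : adj x w) by tauto.
    assert (h1 : adj y w) by tauto. assert (h2 : ~ adj w z) by tauto.
    split; [intro yz|tauto]. exfalso.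
    assert (z <> w) by (intros ->; auto).
    assert (y <> x) by (intros ->; auto).
    assert (z <> x) by (intros ->; apply h2, s; auto).
    apply (no_P4 z y w x); auto; try (apply s; auto); rewrite s; auto.
Qed.

Lemma same_closer_label x y z : same (vert G) closer x y z -> (adj x y <-> adj x z).
Proof. intros [h1 h2]. apply NNPP; intro h. destruct (closer_total x y z h); auto. Qed.

End CographOrder.

Theorem cograph_subsets_wqo (G : graph) (A : nat -> vert G -> Prop) : cograph G -> countable_graph G ->
  exists i j, i < j /\ embeds_in adj (A i) (A j).
Proof.
  intros c [e inj]. apply (subsets_wqo (vert G) adj (closer G) e inj (adj_sym G));
    intros x y z; [apply closer_asym|apply closer_weak|apply closer_adj|apply same_closer_label]; auto.
Qed.

Theorem cograph_rooted_wqo (G : graph) x (A : nat -> vert G -> Prop) : cograph G -> countable_graph G ->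
  exists i j, i < j /\ rooted_embeds_in adj x (A i) (A j).
Proof.
  intros c [e inj]. apply (rooted_subsets_wqo (vert G) adj (closer G) e inj (adj_sym G));
    intros x' y z; [apply closer_asym|apply closer_weak|apply closer_adj|apply same_closer_label]; auto.
Qed.

(** * Embeddings, complements and twin classes *)

Lemma embeds_refl G : embeds G G.
Proof. exists (fun v => v); split; [intros x y h; exact h|tauto]. Qed.

Lemma embeds_trans G H K : embeds G H -> embeds H K -> embeds G K.
Proof.
  intros [f [f1 f2]] [g [g1 g2]]. exists (fun v => g (f v)); split.
  - intros x y h. auto.
  - intros x y. rewrite f2, g2. tauto.
Qed.

Lemma isomorphic_sym G H : isomorphic G H -> isomorphic H G.
Proof.
  intros [f [g [h1 [h2 h3]]]]. exists g, f. repeat split; auto.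
  - intro h. apply h3. rewrite !h2; auto.
  - intro h. apply h3 in h. rewrite !h2 in h; auto.
Qed.

Lemma isomorphic_trans G H K : isomorphic G H -> isomorphic H K -> isomorphic G K.
Proof.
  intros [f [g [h1 [h2 h3]]]] [f' [g' [k1 [k2 k3]]]].
  exists (fun v => f' (f v)), (fun v => g (g' v)). split; [|split].
  - intro x. rewrite k1; auto.
  - intro x. rewrite h2; auto.
  - intros x y. rewrite h3, k3. tauto.
Qed.

Lemma isomorphic_embeds G H : isomorphic G H -> embeds G H.
Proof.
  intros [f [g [h1 [h2 h3]]]]. exists f; split; auto. intros x y E. rewrite <- (h1 x), <- (h1 y), E; auto.
Qed.

Lemma isomorphic_refl G : isomorphic G G.
Proof. exists (fun v => v), (fun v => v). repeat split; auto. Qed.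

Lemma isomorphic_of_bijection G H (f : vert G -> vert H) :
  injective f -> (forall y, exists x, f x = y) -> (forall x y, adj x y <-> adj (f x) (f y)) -> isomorphic G H.
Proof.
  intros h1 h2 h3.
  pose (g := fun y => proj1_sig (constructive_indefinite_description _ (h2 y))).
  assert (hg : forall y, f (g y) = y).
  { intro y. unfold g. apply (proj2_sig (constructive_indefinite_description _ (h2 y))). }
  exists f, g. split; [|split; auto]. intro x. apply h1, hg.
Qed.

Lemma equimorphic_trans G H K : equimorphic G H -> equimorphic H K -> equimorphic G K.
Proof. intros [a b] [c d]; split; eapply embeds_trans; eauto. Qed.

Lemma isomorphic_equimorphic G H : isomorphic G H -> equimorphic G H.
Proof. intro i; split; apply isomorphic_embeds; auto. apply isomorphic_sym; auto. Qed.

Lemma countable_embeds G H : embeds G H -> countable_graph H -> countable_graph G.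
Proof. intros [f [f1 _]] [e he]. exists (fun v => e (f v)). intros x y E; auto. Qed.

Lemma cograph_embeds G H : embeds G H -> cograph H -> cograph G.
Proof.
  intros [f [f1 f2]] c [x [y [z [w q]]]]. apply c. exists (f x), (f y), (f z), (f w).
  rewrite <- !f2. destruct q as [? [? [? [? [? [? ?]]]]]]. repeat split; try tauto; intro E; apply f1 in E; auto.
Qed.

Definition induced (G : graph) (A : vert G -> Prop) : graph :=
  Graph {v | A v} (fun x y => adj (proj1_sig x) (proj1_sig y))
    (fun x y => adj_sym G (proj1_sig x) (proj1_sig y)) (fun x => adj_irrefl G (proj1_sig x)).

Lemma sig_eq {T : Type} {A : T -> Prop} (x y : {v | A v}) : proj1_sig x = proj1_sig y -> x = y.
Proof. destruct x as [x hx], y as [y hy]; simpl; intros ->; f_equal; apply proof_irrelevance. Qed.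

Lemma induced_embeds G A : embeds (induced G A) G.
Proof. exists (@proj1_sig _ _); split; [intros x y; apply sig_eq|simpl; tauto]. Qed.

Lemma embeds_in_of_induced G A B : embeds (induced G A) (induced G B) -> embeds_in (@adj G) A B.
Proof.
  intros [f [f1 f2]].
  exists (fun v => match excluded_middle_informative (A v) with
    | left a => proj1_sig (f (exist A v a)) | right _ => v end).
  split.
  - intros v a. destruct (excluded_middle_informative (A v)); [|tauto]. apply proj2_sig.
  - intros v w a b ne. destruct (excluded_middle_informative (A v)); [|tauto].
    destruct (excluded_middle_informative (A w)); [|tauto]. split.
    + intro E. apply sig_eq, f1 in E. inversion E; auto.
    + apply (f2 (exist A v a0) (exist A w a1)).
Qed.

Lemma induced_embeds_of {G H : graph} (A : vert G -> Prop) (B : vert H -> Prop) (f : vert G -> vert H) :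
  (forall v, A v -> B (f v)) ->
  (forall v w, A v -> A w -> v <> w -> f v <> f w /\ (adj v w <-> adj (f v) (f w))) ->
  embeds (induced G A) (induced H B).
Proof.
  intros h1 h2. exists (fun x => exist B (f (proj1_sig x)) (h1 _ (proj2_sig x))). split.
  - intros [x a] [y b] E. simpl in E. inversion E. apply sig_eq; simpl.
    apply NNPP; intro ne. destruct (h2 x y a b ne); auto.
  - intros [x a] [y b]; simpl. destruct (classic (x = y)) as [->|ne].
    + split; intro h; exfalso; eapply adj_irrefl; eauto.
    + apply h2; auto.
Qed.

Lemma embeds_induced_of {G H : graph} (B : vert H -> Prop) (f : vert G -> vert H) :
  (forall v, B (f v)) ->
  (forall v w, v <> w -> f v <> f w /\ (adj v w <-> adj (f v) (f w))) ->
  embeds G (induced H B).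
Proof.
  intros h1 h2. exists (fun x => exist B (f x) (h1 x)). split.
  - intros x y E. inversion E. apply NNPP; intro ne. destruct (h2 x y ne); auto.
  - intros x y; simpl. destruct (classic (x = y)) as [->|ne].
    + split; intro h; exfalso; eapply adj_irrefl; eauto.
    + apply h2; auto.
Qed.

Lemma induced_induced_embeds G A B : embeds_in (@adj G) A B -> embeds (induced G A) (induced G B).
Proof. intros [f [h1 h2]]. exact (induced_embeds_of A B f h1 h2). Qed.

Lemma complement_embeds G H : embeds G H -> embeds (complement G) (complement H).
Proof.
  intros [f [f1 f2]]. exists f; split; auto. intros x y. simpl. unfold compl_adj.
  rewrite f2. split; intros [h1 h2]; split; auto; congruence.
Qed.

Lemma complement_isomorphic G H : isomorphic G H -> isomorphic (complement G) (complement H).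
Proof.
  intros [f [g [h1 [h2 h3]]]]. exists f, g. split; [auto|split; [auto|]]. intros x y. simpl. unfold compl_adj.
  rewrite h3. split; intros [k1 k2]; split; auto; congruence.
Qed.

Lemma complement_involutive G : isomorphic (complement (complement G)) G.
Proof.
  exists (fun v => v), (fun v => v). split; [auto|split; [auto|]]. intros x y. simpl. unfold compl_adj. simpl.
  unfold compl_adj. split.
  - intros [h1 h2]. apply NNPP; intro h. apply h2; auto.
  - intro h. split; [intros ->; eapply adj_irrefl; eauto|tauto].
Qed.

Lemma complement_equimorphic G H : equimorphic G H -> equimorphic (complement G) (complement H).
Proof. intros [a b]; split; apply complement_embeds; auto. Qed.

Lemma complement_cograph G : cograph G -> cograph (complement G).
Proof.
  intros c [x [y [z [w [[a1 a2] [[b1 b2] [[c1 c2] [d1 [d2 [d3 [e1 [e2 e3]]]]]]]]]]]]. simpl in *. unfold compl_adj in *.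
  assert (N : forall u v : vert G, u <> v -> ~ (u <> v /\ ~ adj u v) -> adj u v).
  { intros u v h1 h2. apply NNPP; intro h3; apply h2; auto. }
  (* The path is self-complementary: the non-edges of [x], [y], [z], [w] form the path [y], [w],
     [x], [z]. *)
  apply c. exists y, w, x, z. repeat split; auto.
  - apply adj_sym. auto.
  - intro h. apply a2, adj_sym; auto.
  - intro h. apply c2, adj_sym; auto.
Qed.

Lemma complement_countable G : countable_graph G -> countable_graph (complement G).
Proof. intros [e h]; exists e; exact h. Qed.

Lemma clos_map {T U : Type} (R : T -> T -> Prop) (S : U -> U -> Prop) (f : T -> U) :
  (forall x y, R x y -> S (f x) (f y)) -> forall x y, clos_refl_trans T R x y -> clos_refl_trans U S (f x) (f y).
Proof.
  intros h x y c. induction c.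
  - apply rt_step; auto.
  - apply rt_refl.
  - eapply rt_trans; eauto.
Qed.

Lemma clos_sym {T : Type} (R : T -> T -> Prop) : (forall x y, R x y -> R y x) ->
  forall x y, clos_refl_trans T R x y -> clos_refl_trans T R y x.
Proof.
  intros h x y c. induction c.
  - apply rt_step; auto.
  - apply rt_refl.
  - eapply rt_trans; eauto.
Qed.

Lemma connected_isomorphic G H : isomorphic G H -> connected G -> connected H.
Proof.
  intros [f [g [h1 [h2 h3]]]] c x y. rewrite <- (h2 x), <- (h2 y).
  apply (clos_map (@adj G) (@adj H) f); auto. intros u v; apply h3.
Qed.

Definition coconnected (G : graph) := connected (complement G).

Lemma coconnected_isomorphic G H : isomorphic G H -> coconnected G -> coconnected H.
Proof. intros i. apply connected_isomorphic, complement_isomorphic, i. Qed.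

Lemma disconnected_coconnected G : ~ connected G -> coconnected G.
Proof.
  intros nc. unfold connected in nc. apply not_all_ex_not in nc. destruct nc as [a nc].
  apply not_all_ex_not in nc. destruct nc as [b nab].
  pose (C := fun v => clos_refl_trans _ (@adj G) a v).
  assert (sep : forall u v, C u -> ~ C v -> compl_adj G u v).
  { intros u v cu cv. split; [intros ->; auto|]. intro h. apply cv. eapply rt_trans; [exact cu|apply rt_step; auto]. }
  assert (Ca : C a) by apply rt_refl.
  assert (Nb : ~ C b) by exact nab.
  assert (to_a : forall v, clos_refl_trans (vert G) (compl_adj G) a v).
  { intro v. destruct (classic (C v)) as [cv|cv].
    - eapply rt_trans; [apply rt_step, (sep a b); auto|]. apply rt_step, compl_adj_sym, sep; auto.
    - apply rt_step, sep; auto. }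
  intros u v. apply rt_trans with a; [|apply to_a].
  apply (clos_sym (compl_adj G) (compl_adj_sym G)), to_a.
Qed.

(** * Twin classes *)

Section Twins.
Variable G : graph.

Definition twin (x y : vert G) := forall z, z <> x -> z <> y -> (adj x z <-> adj y z).

Lemma twin_refl x : twin x x.
Proof. intros z _ _; tauto. Qed.

Lemma twin_sym x y : twin x y -> twin y x.
Proof. intros h z h1 h2. symmetry; auto. Qed.

Lemma twin_trans x y z : twin x y -> twin y z -> twin x z.
Proof.
  intros h1 h2 w w1 w2. destruct (classic (w = y)) as [->|ne].
  - destruct (classic (x = z)) as [->|xz]; [tauto|].
    rewrite (gadj_iff G x y), (gadj_iff G z y).
    rewrite (h2 x) by congruence. rewrite (gadj_iff G z x), (h1 z) by congruence. tauto.
  - rewrite (h1 w w1 ne). auto.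
Qed.

(** All four vertices may lie in one class, so this also shows that a class is a clique or an
    independent set. *)
Lemma twin_adj x y u v : twin x u -> twin y v -> x <> y -> u <> v -> (adj x y <-> adj u v).
Proof.
  intros h1 h2 xy uv. assert (s := gadj_iff G).
  destruct (classic (y = u)) as [->|yu].
  - destruct (classic (v = x)) as [->|vx]; [apply s|].
    rewrite (s x u), (h2 x) by congruence. rewrite (s v x), (h1 v) by congruence. tauto.
  - rewrite (h1 y) by congruence. rewrite (s u y), (h2 u) by congruence. apply s.
Qed.

(** Finitely many twin classes, given by representatives; this is the intrinsic form of condition
    (iii). *)
Definition simple := exists l : list (vert G), forall x, exists y, In y l /\ twin x y.

End Twins.

Lemma twin_reflect G H (f : vert G -> vert H) (x y : vert G) : injective f -> (forall x y, adj x y <-> adj (f x) (f y)) ->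
  twin H (f x) (f y) -> twin G x y.
Proof.
  intros i a t z z1 z2. rewrite a, (a y). apply t; intro E; apply i in E; auto.
Qed.

Lemma infinite_pigeonhole {T : Type} (l : list T) (P : nat -> T -> Prop) : forall E, infinite E ->
  (forall n, E n -> exists c, In c l /\ P n c) -> exists c, In c l /\ infinite (fun n => E n /\ P n c).
Proof.
  induction l as [|c l IH]; intros E Ei h.
  - destruct (Ei 0) as [n [_ En]]. destruct (h n En) as [c [[] _]].
  - destruct (classic (infinite (fun n => E n /\ P n c))) as [i|i]; [exists c; split; [left|]; auto|].
    destruct (IH (fun n => E n /\ ~ P n c)) as [d [d1 d2]].
    + apply not_all_ex_not in i. destruct i as [N i]. intro n. destruct (Ei (n + N)) as [m [m1 m2]].
      exists m. split; [lia|split; auto]. intro p. apply i. exists m; split; [lia|auto].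
    + intros n [En np]. destruct (h n En) as [d [[->|d1] d2]]; [tauto|eauto].
    + exists d. split; [right; auto|]. intro n. destruct (d2 n) as [m [m1 [[m2 _] m3]]]. exists m; auto.
Qed.

Lemma iter_embedding G (f : vert G -> vert G) n : injective f -> (forall x y, adj x y <-> adj (f x) (f y)) ->
  injective (Nat.iter n f) /\ forall x y, adj x y <-> adj (Nat.iter n f x) (Nat.iter n f y).
Proof.
  intros i a. induction n as [|n [IH1 IH2]]; simpl; [split; [intros x y h; exact h|tauto]|].
  split; [intros x y h; apply IH1, i, h|]. intros x y. rewrite IH2, a. tauto.
Qed.

(** Embeddings reflect twins but need not preserve them. By pigeonhole two powers of [f] agree, up
    to twins, on all representatives; cancelling the smaller one gives an exponent [m] that fixes
    their classes. If this power sends [x] into the class of [d], it sends [d] there too, so [x] and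
    [d] are twins by reflection. *)
Lemma power_preserves_twins G (f : vert G -> vert G) : simple G -> injective f ->
  (forall x y, adj x y <-> adj (f x) (f y)) -> exists n, forall x, twin G (Nat.iter (S n) f x) x.
Proof.
  intros [l hl] i a.
  assert (h : forall l', exists E, infinite E /\ forall y, In y l' -> forall m n, E m -> E n ->
     twin G (Nat.iter m f y) (Nat.iter n f y)).
  { induction l' as [|y l' [E [E1 E2]]].
    - exists (fun _ => True). split; [intro n; exists n; auto|intros y []].
    - destruct (infinite_pigeonhole l (fun n c => twin G (Nat.iter n f y) c) E E1) as [c [c1 c2]].
      { intros n _. apply hl. }
      exists (fun n => E n /\ twin G (Nat.iter n f y) c). split; auto.
      intros z [<-|hz] m n [m1 m2] [n1 n2]; [|auto]. eapply twin_trans; [exact m2|apply twin_sym; auto]. }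
  destruct (h l) as [E [E1 E2]].
  destruct (E1 0) as [p [_ Ep]]. destruct (E1 (S p)) as [q [pq Eq]].
  exists (q - S p). set (m := S (q - S p)).
  assert (hm : forall y, In y l -> twin G (Nat.iter m f y) y).
  { intros y hy. destruct (iter_embedding G f p i a) as [j1 j2].
    apply (twin_reflect G G (Nat.iter p f)); auto. rewrite <- Nat.iter_add.
    replace (p + m) with q by (unfold m; lia). auto. }
  intro x. destruct (hl (Nat.iter m f x)) as [d [d1 d2]].
  destruct (iter_embedding G f m i a) as [j1 j2].
  eapply twin_trans; [exact d2|]. apply twin_sym.
  apply (twin_reflect G G (Nat.iter m f)); auto. eapply twin_trans; [exact d2|]. apply twin_sym; auto.
Qed.

Lemma simple_sibling G H : simple G -> equimorphic H G -> isomorphic H G.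
Proof.
  intros s [[h [h1 h2]] [k [k1 k2]]].
  destruct (power_preserves_twins G (fun x => h (k x)) s) as [n hn].
  { intros x y E; auto. }
  { intros x y; rewrite k2, h2; tauto. }
  destruct (iter_embedding G (fun x => h (k x)) n) as [i1 i2].
  { intros x y E; auto. }
  { intros x y; rewrite k2, h2; tauto. }
  (* [h (k' x)] is the power [S n] of the self-embedding, so it stays in the twin class of [x]. *)
  pose (k' := fun x => k (Nat.iter n (fun x => h (k x)) x)).
  assert (k'i : injective k') by (intros x y E; auto).
  assert (k't : forall x, twin G (h (k' x)) x) by exact hn.
  (* Cantor-Bernstein for [h] and [k'] *)
  pose (g := fun x => h (k' x)).
  pose (S := fun x => exists m z, (forall w, h w <> z) /\ x = Nat.iter m g z).
  assert (pre : forall x, ~ S x -> exists w, h w = x).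
  { intros x hx. apply NNPP; intro no. apply hx. exists 0, x. split; auto. intros w E; eauto. }
  assert (Sg : forall x, S x -> S (g x)).
  { intros x [m [z [z1 ->]]]. exists (Datatypes.S m), z. split; auto. }
  assert (ex : forall x, exists y, (S x -> y = k' x) /\ (~ S x -> h y = x)).
  { intro x. destruct (classic (S x)) as [sx|sx]; [exists (k' x); tauto|].
    destruct (pre x sx) as [w e]. exists w; tauto. }
  pose (b := fun x => proj1_sig (constructive_indefinite_description _ (ex x))).
  assert (hb : forall x, (S x -> b x = k' x) /\ (~ S x -> h (b x) = x)).
  { intro x. unfold b. apply (proj2_sig (constructive_indefinite_description _ (ex x))). }
  assert (bt : forall x, twin G (h (b x)) x).
  { intro x. destruct (classic (S x)) as [sx|sx].
    - rewrite (proj1 (hb x) sx); auto.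
    - rewrite (proj2 (hb x) sx). apply twin_refl. }
  assert (binj : injective b).
  { assert (cross : forall x y, S x -> ~ S y -> b x = b y -> x = y).
    { intros x y sx sy E. exfalso. apply sy. rewrite <- (proj2 (hb y) sy), <- E, (proj1 (hb x) sx). apply Sg; auto. }
    intros x y E. destruct (classic (S x)) as [sx|sx], (classic (S y)) as [sy|sy]; auto.
    - apply k'i. rewrite <- (proj1 (hb x) sx), <- (proj1 (hb y) sy); auto.
    - symmetry; auto.
    - rewrite <- (proj2 (hb x) sx), <- (proj2 (hb y) sy), E; auto. }
  apply isomorphic_sym, (isomorphic_of_bijection G H b); auto.
  - intro w. destruct (classic (S (h w))) as [sw|sw].
    + destruct sw as [[|m] [z [z1 z2]]]; [exfalso; eapply z1; exact z2|].
      exists (Nat.iter m g z). rewrite (proj1 (hb _)) by (exists m, z; auto).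
      apply h1. exact (eq_sym z2).
    + exists (h w). apply h1. apply hb; auto.
  - intros x y. destruct (classic (x = y)) as [->|ne].
    + split; intro q; exfalso; eapply adj_irrefl; eauto.
    + rewrite h2. symmetry. apply twin_adj; auto.
Qed.

(** * Twin classes and lexicographic sums *)

Lemma lex_adj_same H L (j : vert H) (x y : vert (L j)) : lex_adj H L (existT _ j x) (existT _ j y) <-> adj x y.
Proof.
  split; [|apply lex_in]. intro h.
  remember (existT (fun j => vert (L j)) j x) as u. remember (existT (fun j => vert (L j)) j y) as v.
  destruct h as [j' x' y' h|i j' x' y' ne h].
  - inversion Hequ; subst. apply inj_pair2 in Hequ. apply inj_pair2 in Heqv. subst; auto.
  - inversion Hequ; inversion Heqv; congruence.
Qed.

Lemma lex_adj_diff H L (i j : vert H) (x : vert (L i)) (y : vert (L j)) : i <> j ->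
  (lex_adj H L (existT _ i x) (existT _ j y) <-> adj i j).
Proof.
  intro ne. split; [|apply lex_out; auto]. intro h.
  remember (existT (fun j => vert (L j)) i x) as u. remember (existT (fun j => vert (L j)) j y) as v.
  destruct h as [j' x' y' h|i' j' x' y' ne' h].
  - inversion Hequ; inversion Heqv; congruence.
  - inversion Hequ; inversion Heqv; subst; auto.
Qed.

(** Vertices of one summand are twins; empty summands have no representative, hence the case
    distinction in [reps]. *)
Lemma simple_of_lexsum G : finite_lexsum_of_cliques_or_indeps G -> simple G.
Proof.
  intros [H [L [[lH hlH] [hL [f [g [fg1 [fg2 fa]]]]]]]].
  pose (reps := fun j => match excluded_middle_informative (inhabited (vert (L j))) with
     | left i => g (existT _ j (epsilon i (fun _ => True))) :: nil | right _ => nil end).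
  exists (flat_map reps lH). intro x. destruct (f x) as [j a] eqn:E.
  assert (hr : exists y b, In y (reps j) /\ f y = existT _ j b).
  { unfold reps. destruct (excluded_middle_informative (inhabited (vert (L j)))) as [i|i].
    - eexists; eexists; split; [left; reflexivity|apply fg2].
    - exfalso; apply i; constructor; exact a. }
  destruct hr as [y [b [y1 y2]]].
  exists y. split; [apply in_flat_map; exists j; split; auto|].
  intros z zx zy. rewrite (fa x z), (fa y z), E, y2.
  destruct (f z) as [i c] eqn:Ez. simpl.
  destruct (classic (j = i)) as [->|ne].
  - rewrite !lex_adj_same.
    assert (a <> c). { intros ->. apply zx. rewrite <- (fg1 z), <- (fg1 x), E, Ez; auto. }
    assert (b <> c). { intros ->. apply zy. rewrite <- (fg1 z), <- (fg1 y), y2, Ez; auto. }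
    destruct (hL i) as [q|q]; [split; intros _; apply q; auto|split; intro h; exfalso; eapply q; eauto].
  - rewrite !lex_adj_diff by auto. tauto.
Qed.

(** The index graph is the quotient by twins. Its vertices are the classes as predicates, which
    extensionality identifies for twins. *)
Lemma lexsum_of_simple G : simple G -> finite_lexsum_of_cliques_or_indeps G.
Proof.
  intros [l hl].
  pose (VH := {c : vert G -> Prop | exists x, c = twin G x}).
  pose (cl := fun x => exist (fun c => exists x, c = twin G x) (twin G x) (ex_intro _ x eq_refl) : VH).
  assert (cl_eq : forall x y, twin G x y -> cl x = cl y).
  { intros x y t. apply sig_eq. simpl. apply functional_extensionality. intro z.
    apply propositional_extensionality. split; intro h.
    - eapply twin_trans; [apply twin_sym; exact t|exact h].
    - eapply twin_trans; eauto. }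
  pose (aH := fun c d : VH => c <> d /\ exists x y, proj1_sig c x /\ proj1_sig d y /\ adj x y).
  assert (aH_sym : forall c d, aH c d -> aH d c).
  { intros c d [h [x [y [h1 [h2 h3]]]]]. split; [congruence|]. exists y, x. repeat split; auto. apply adj_sym; auto. }
  assert (aH_irr : forall c, ~ aH c c) by (intros c [h _]; auto).
  pose (H := Graph VH aH aH_sym aH_irr).
  pose (L := fun c : vert H => induced G (proj1_sig (c : VH))).
  exists H, L. split; [|split].
  - exists (map cl l). intros [c [x ->]]. destruct (hl x) as [y [y1 y2]].
    apply in_map_iff. exists y. split; auto. rewrite <- (cl_eq x y y2). apply sig_eq; auto.
  - intros [c [x ->]]. destruct (classic (exists u v, twin G x u /\ twin G x v /\ u <> v /\ adj u v)) as [[u [v [h1 [h2 [h3 h4]]]]]|no].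
    + left. intros [a ha] [b hb] ne. simpl in *. apply (twin_adj G a b u v); auto.
      * eapply twin_trans; [apply twin_sym; exact ha|exact h1].
      * eapply twin_trans; [apply twin_sym; exact hb|exact h2].
      * intros ->. apply ne, sig_eq; auto.
    + right. intros [a ha] [b hb] h. simpl in *. apply no. exists a, b. split; [exact ha|split; [exact hb|split; [|exact h]]].
      intros ->. eapply adj_irrefl; eauto.
  - pose (F := fun x => existT (fun c : vert H => vert (L c)) (cl x) (exist (twin G x) x (twin_refl G x) : vert (L (cl x)))).
    assert (FL : forall (c : VH) (u : vert (L c)), existT (fun c : vert H => vert (L c)) c u = F (proj1_sig u)).
    { intros [c [x0 E]] [u hu]. subst c. simpl in hu. unfold F. simpl.
      assert (E := cl_eq x0 u hu). unfold cl in E.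
      (* The summand depends on its index; stated for arbitrary equal indices, the dependent
         equality follows by substitution. *)
      assert (G' : forall (c d : VH) (e : c = d) (p : proj1_sig c u) (q : proj1_sig d u),
        existT (fun c : vert H => vert (L c)) c (exist (proj1_sig c) u p : vert (L c)) =
        existT (fun c : vert H => vert (L c)) d (exist (proj1_sig d) u q : vert (L d))).
      { intros c d e p q. subst d. f_equal. apply sig_eq; auto. }
      apply (G' _ (cl u) E). }
    exists F, (fun w : {c : vert H & vert (L c)} => proj1_sig (projT2 w)). split; [auto|split].
    + intros [c u]. simpl. symmetry. apply FL.
    + intros x y. unfold F. simpl.
      destruct (classic (cl x = cl y)) as [E|ne].
      * assert (t : twin G x y).
        { assert (E' : twin G x y = twin G y y) by (apply (f_equal (fun c : VH => proj1_sig c y) E)).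
          rewrite E'. apply twin_refl. }
        assert (G' : forall (c d : VH) (e : c = d) (p : proj1_sig c x) (q : proj1_sig d y),
          lex_adj H L (existT (fun c : vert H => vert (L c)) c (exist (proj1_sig c) x p : vert (L c)))
             (existT (fun c : vert H => vert (L c)) d (exist (proj1_sig d) y q : vert (L d))) <-> adj x y).
        { intros c d e p q. subst d. apply (lex_adj_same H L c). }
        symmetry. apply (G' (cl x) (cl y) E).
      * eapply iff_trans; [|symmetry; apply (lex_adj_diff H L (cl x) (cl y)); auto]. simpl. split.
        -- intro h. split; auto. exists x, y. simpl. auto using twin_refl.
        -- intros [_ [u [v [h1 [h2 h3]]]]]. simpl in *.
           apply (twin_adj G x y u v); auto.
           ++ intros ->; auto.
           ++ intros ->. eapply adj_irrefl; eauto.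
Qed.

Lemma simple_complement G : simple G -> simple (complement G).
Proof.
  intros [l h]. exists l. intro x. destruct (h x) as [y [y1 y2]]. exists y; split; auto.
  intros z zx zy. simpl. unfold compl_adj. rewrite (y2 z zx zy). split; intros [? ?]; split; auto.
Qed.

Lemma simple_isomorphic G H : isomorphic G H -> simple G -> simple H.
Proof.
  intros [f [g [h1 [h2 h3]]]] [l h]. exists (map f l). intro x. destruct (h (g x)) as [y [y1 y2]].
  exists (f y). split; [apply in_map; auto|]. intros z zx zy.
  rewrite <- (h2 x), <- (h2 z), <- !h3. apply y2.
  - intro E. apply zx. rewrite <- (h2 z), <- (h2 x), E; auto.
  - intro E. apply zy. rewrite <- (h2 z), E; auto.
Qed.

(** * Disconnected graphs *)

(** Otherwise there are arbitrarily late terms that lie below only finitely many others, and a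
    sparse sequence of these is bad. *)
Lemma wqo_recurrent {T : Type} (R : T -> T -> Prop) (A : nat -> T) :
  (forall u : nat -> nat, exists i j, i < j /\ R (A (u i)) (A (u j))) ->
  exists k, forall n, k <= n -> forall p, exists j, p <= j /\ R (A n) (A j).
Proof.
  intro w. apply NNPP; intro no.
  assert (h : forall k, exists n p, k <= n /\ forall j, p <= j -> ~ R (A n) (A j)).
  { intro k. apply NNPP; intro h. apply no. exists k. intros n hn p. apply NNPP; intro h'. apply h.
    exists n, p. split; auto. intros j hj r. apply h'; eauto. }
  destruct (h 0) as [n0 [p0 [_ h0]]].
  destruct (dependent_choice (fun st : nat * nat => forall j, snd st <= j -> ~ R (A (fst st)) (A j))
    (fun _ st st' => snd st <= fst st' /\ fst st < fst st') (n0, p0) h0) as [u [_ [uQ uR]]].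
  { intros _ [n p] _. destruct (h (n + p + 1)) as [n' [p' [h1 h2]]]. exists (n', p'). simpl. split; auto. lia. }
  destruct (w (fun i => fst (u i))) as [i [j [ij r]]].
  assert (mono : forall m, S i <= m -> fst (u (S i)) <= fst (u m)).
  { induction 1; auto. destruct (uR m). lia. }
  apply (uQ i (fst (u j))); auto. destruct (uR i). specialize (mono j ij). lia.
Qed.

Lemma embeds_of_induced {G H : graph} (A : vert G -> Prop) (f : vert G -> vert H) :
  (forall v w, A v -> A w -> v <> w -> f v <> f w /\ (adj v w <-> adj (f v) (f w))) -> embeds (induced G A) H.
Proof.
  intro h. eapply embeds_trans; [|apply (induced_embeds H (fun _ => True))].
  apply (induced_embeds_of A _ f); auto.
Qed.

Definition conn (G : graph) (x y : vert G) := clos_refl_trans (vert G) adj x y.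

Lemma conn_sym G x y : conn G x y -> conn G y x.
Proof. apply clos_sym, adj_sym. Qed.

Lemma conn_trans G x y z : conn G x y -> conn G y z -> conn G x z.
Proof. intros; eapply rt_trans; eauto. Qed.

Lemma conn_adj G x y z : conn G x y -> adj y z -> conn G x z.
Proof. intros; eapply rt_trans; [eauto|apply rt_step; auto]. Qed.

Lemma conn_ext G x y : conn G x y -> conn G x = conn G y.
Proof.
  intro h. apply functional_extensionality; intro z. apply propositional_extensionality.
  split; intro k; [eapply conn_trans; [apply conn_sym|]|eapply conn_trans]; eauto.
Qed.

Lemma component_connected G x : connected (induced G (conn G x)).
Proof.
  assert (h : forall v, conn G x v -> forall hv hx, clos_refl_trans (vert (induced G (conn G x))) adj
     (exist (conn G x) x hx) (exist (conn G x) v hv)).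
  { intros v cv. apply clos_rt_rtn1 in cv. induction cv as [|v w a cv IH]; intros hv hx.
    - replace hv with hx by apply proof_irrelevance. apply rt_refl.
    - apply clos_rtn1_rt in cv. eapply rt_trans; [apply (IH cv)|]. apply rt_step. exact a. }
  intros [u hu] [v hv]. assert (hx : conn G x x) by apply rt_refl.
  eapply rt_trans; [|apply (h v hv hv hx)]. apply clos_sym; [apply adj_sym|]. apply h; auto.
Qed.

Lemma conn_of_induced G A (u v : vert (induced G A)) : conn (induced G A) u v -> conn G (proj1_sig u) (proj1_sig v).
Proof. apply clos_map. intros x y h; exact h. Qed.

Lemma induced_coconnected G (A : vert G -> Prop) u v : A u -> A v -> ~ conn G u v -> coconnected (induced G A).
Proof.
  intros hu hv n. apply disconnected_coconnected. intro c. apply n.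
  exact (conn_of_induced G A _ _ (c (exist A u hu) (exist A v hv))).
Qed.

Definition isolated (G : graph) (x : vert G) := forall y : vert G, ~ adj x y.

Lemma isolated_isomorphic G H (f : vert G -> vert H) (g : vert H -> vert G) x : (forall y, f (g y) = y) ->
  (forall x y, adj x y <-> adj (f x) (f y)) -> isolated G x -> isolated H (f x).
Proof. intros h1 h2 i y a. rewrite <- (h1 y) in a. apply h2 in a. eapply i; eauto. Qed.

Lemma conn_nonisolated G x y : ~ isolated G x -> conn G x y -> ~ isolated G y.
Proof.
  intros h c i. apply conn_sym in c. apply clos_rt_rt1n in c. inversion c; subst; auto. eapply i; eauto.
Qed.

Definition unique_coconnected (M : graph) := forall H, coconnected H -> equimorphic H M -> isomorphic H M.
Definition unique_connected (M : graph) := forall H, connected H -> equimorphic H M -> isomorphic H M.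

Section ManyComponents.
Variable M : graph.
Hypothesis cog : cograph M.
Hypothesis cnt : countable_graph M.
Variable r : nat -> vert M.
Hypothesis r_nonisolated : forall n, ~ isolated M (r n).
Hypothesis r_apart : forall i j, i <> j -> ~ conn M (r i) (r j).

(* Infinitely many nontrivial components absorb all isolated vertices, so there are siblings with
   and without isolated vertices. *)
Lemma many_components : ~ unique_coconnected M.
Proof.
  intro uniq. destruct cnt as [e e_inj].
  pose (C := fun n => conn M (r n)).
  assert (C_disj : forall i j x y, i <> j -> C i x -> C j y -> x <> y /\ ~ adj x y).
  { intros i j x y ij ci cj. split.
    - intros ->. apply (r_apart i j ij). eapply conn_trans; [exact ci|apply conn_sym; auto].
    - intro a. apply (r_apart i j ij). eapply conn_trans; [exact (conn_adj _ _ _ _ ci a)|apply conn_sym; auto]. }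
  destruct (wqo_recurrent (embeds_in (@adj M)) C) as [k hk].
  { intro u. apply (cograph_subsets_wqo M (fun i => C (u i))); auto. }
  destruct (hk k (le_n _) k) as [s0 [s0k s0e]].
  destruct (dependent_choice (fun m => k <= m)
    (fun n m m' => m + 2 <= m' /\ embeds_in (@adj M) (C (k + S n)) (C m')) s0 s0k) as [s [e0 [sk sR]]].
  { intros n m hm. destruct (hk (k + S n) ltac:(lia) (m + 2)) as [j [j1 j2]]. exists j. split; [lia|auto]. }
  assert (smono : forall n m, n < m -> s n + 2 <= s m).
  { induction 1; [apply sR|]. destruct (sR m). lia. }
  assert (sinj : forall n m, s n = s m -> n = m).
  { intros n m E. destruct (lt_eq_lt_dec n m) as [[h|h]|h]; auto; specialize (smono _ _ h); lia. }
  assert (sgap : forall n m, s n + 1 <> s m).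
  { intros n m E. destruct (lt_eq_lt_dec n m) as [[h|h]|h]; [|subst; lia|]; specialize (smono _ _ h); lia. }
  assert (semb : forall n, embeds_in (@adj M) (C (k + n)) (C (s n))).
  { intros [|n]; [rewrite Nat.add_0_r, e0; auto|apply sR]. }
  pose (phi := fun n => proj1_sig (constructive_indefinite_description _ (semb n))).
  assert (hphi : forall n, (forall v, C (k + n) v -> C (s n) (phi n v)) /\
    forall v w, C (k + n) v -> C (k + n) w -> v <> w -> phi n v <> phi n w /\ (adj v w <-> adj (phi n v) (phi n w))).
  { intro n. exact (proj2_sig (constructive_indefinite_description _ (semb n))). }
  assert (C_nonisolated : forall n v, C n v -> ~ isolated M v).
  { intros n v c. eapply conn_nonisolated; [apply (r_nonisolated n)|exact c]. }
  assert (step : forall v, exists w,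
    (isolated M v /\ w = r (s (S (e v)) + 1)) \/
    (exists n, C (k + n) v /\ w = phi n v) \/
    (~ isolated M v /\ (forall n, k <= n -> ~ C n v) /\ w = v)).
  { intro v. destruct (classic (isolated M v)) as [i|i]; [eexists; left; eauto|].
    destruct (classic (exists n, C (k + n) v)) as [[n c]|c]; [eexists; right; left; eauto|].
    exists v. right; right. repeat split; auto. intros n hn cn. apply c. exists (n - k).
    replace (k + (n - k)) with n by lia; auto. }
  pose (f := fun v => proj1_sig (constructive_indefinite_description _ (step v))).
  assert (hf : forall v,
    (isolated M v /\ f v = r (s (S (e v)) + 1)) \/
    (exists n, C (k + n) v /\ f v = phi n v) \/
    (~ isolated M v /\ (forall n, k <= n -> ~ C n v) /\ f v = v)).
  { intro v. exact (proj2_sig (constructive_indefinite_description _ (step v))). }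
  assert (loc : forall v, (exists j, k <= j /\ j <> s 0 + 1 /\ C j (f v)) \/
    (~ isolated M (f v) /\ forall n, k <= n -> ~ C n (f v))).
  { intro v. destruct (hf v) as [[i E]|[[n [c E]]|[i [c E]]]]; rewrite E.
    - left. exists (s (S (e v)) + 1). split; [specialize (sk (S (e v))); lia|split; [|apply rt_refl]].
      specialize (smono 0 (S (e v))). lia.
    - left. exists (s n). split; [apply sk|split; [intro E'; symmetry in E'; eapply sgap; eauto|apply hphi; auto]].
    - right; auto. }
  assert (out : forall j x y, k <= j -> C j x -> (forall n, k <= n -> ~ C n y) -> x <> y /\ ~ adj x y).
  { intros j x y hj cx cy. split; [intros ->; eapply cy; eauto|]. intro a. apply (cy j hj). eapply conn_adj; eauto. }
  assert (sym : forall x y : vert M, x <> y /\ ~ adj x y -> y <> x /\ ~ adj y x).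
  { intros x y [h1 h2]. split; [congruence|]. intro a; apply h2, adj_sym, a. }
  assert (femb : forall v w, v <> w -> f v <> f w /\ (adj v w <-> adj (f v) (f w))).
  { assert (glue : forall v w v' w' : vert M, ~ adj v w -> v' <> w' /\ ~ adj v' w' -> v' <> w' /\ (adj v w <-> adj v' w')) by tauto.
    intros v w vw.
    destruct (hf v) as [[i E]|[[n [c E]]|[i [c E]]]];
    destruct (hf w) as [[i' E']|[[n' [c' E']]|[i' [c' E']]]]; rewrite E, E'.
    - apply glue; [apply i|].
      apply (C_disj (s (S (e v)) + 1) (s (S (e w)) + 1)); [|apply rt_refl|apply rt_refl].
      intro q. apply vw, e_inj. assert (q' : s (S (e v)) = s (S (e w))) by lia. apply sinj in q'. lia.
    - apply glue; [apply i|].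
      apply (C_disj (s (S (e v)) + 1) (s n')); [apply sgap|apply rt_refl|apply hphi; auto].
    - apply glue; [apply i|].
      apply (out (s (S (e v)) + 1)); auto; [specialize (sk (S (e v))); lia|apply rt_refl].
    - apply glue; [intro a; eapply i'; apply adj_sym; eauto|].
      apply sym, (C_disj (s (S (e w)) + 1) (s n)); [apply sgap|apply rt_refl|apply hphi; auto].
    - destruct (Nat.eq_dec n n') as [<-|ne]; [apply hphi; auto|].
      apply glue.
      + apply (C_disj (k + n) (k + n')); auto. lia.
      + apply (C_disj (s n) (s n')); [|apply hphi; auto|apply hphi; auto]. intro q; apply ne; auto.
    - apply glue.
      + apply (out (k + n)); auto. lia.
      + apply (out (s n)); auto. apply hphi; auto.
    - apply glue; [intro a; eapply i'; apply adj_sym; eauto|].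
      apply sym, (out (s (S (e w)) + 1)); auto; [specialize (sk (S (e w))); lia|apply rt_refl].
    - apply glue.
      + apply (sym w v), (out (k + n')); auto. lia.
      + apply sym, (out (s n')); auto. apply hphi; auto.
    - tauto. }
  pose (z := s 0 + 1).
  pose (A := fun v => ~ isolated M v).
  pose (B := fun v => v = r z \/ (~ isolated M v /\ ~ C z v)).
  assert (zk : k <= z) by (unfold z; specialize (sk 0); lia).
  assert (fA : forall v, A (f v)).
  { intro v. destruct (loc v) as [[j [j1 [j2 j3]]]|[h _]]; auto. unfold A; eauto. }
  assert (fB : forall v, B (f v)).
  { intro v. right. split; [apply fA|]. destruct (loc v) as [[j [j1 [j2 j3]]]|[_ h]]; auto.
    intro c. destruct (C_disj j z (f v) (f v)); auto. }
  assert (coA : coconnected (induced M A)).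
  { apply (induced_coconnected M A (r (s 0)) (r (s 1))).
    - apply r_nonisolated.
    - apply r_nonisolated.
    - apply r_apart. specialize (smono 0 1). lia. }
  assert (coB : coconnected (induced M B)).
  { apply (induced_coconnected M B (r (s 0)) (r z)).
    - right. split; [apply r_nonisolated|]. intro c. apply (r_apart z (s 0)); auto. unfold z; lia.
    - left; auto.
    - apply r_apart. unfold z; lia. }
  assert (iA := uniq _ coA (conj (induced_embeds M A) (embeds_induced_of A f fA femb))).
  assert (iB := uniq _ coB (conj (induced_embeds M B) (embeds_induced_of B f fB femb))).
  destruct (isomorphic_trans _ _ _ iB (isomorphic_sym _ _ iA)) as [g [g' [g1 [g2 g3]]]].
  assert (iso_rz : isolated (induced M B) (exist B (r z) (or_introl eq_refl))).
  { intros [u [->|[hu1 hu2]]] a; simpl in a; [eapply adj_irrefl; eauto|]. apply hu2. apply rt_step; auto. }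
  assert (iso_g := isolated_isomorphic _ _ g g' _ g2 g3 iso_rz).
  destruct (g (exist B (r z) (or_introl eq_refl))) as [u hu]. apply hu. intros w a.
  assert (hw : A w) by (intro iw; eapply iw; apply adj_sym; eauto).
  apply (iso_g (exist A w hw)). exact a.
Qed.

End ManyComponents.

Section Component.
Variable M : graph.
Hypothesis cnt : countable_graph M.
Hypothesis uniq : unique_coconnected M.
Variables x y : vert M.
Hypothesis xy : ~ conn M x y.

(* Replacing every component isomorphic to that of [x] by a sibling [H] leaves a component
   isomorphic to that of [x] only if [H] is one. *)
Lemma component_unique_connected : unique_connected (induced M (conn M x)).
Proof.
  intros H cH [[a [a1 a2]] [b [b1 b2]]]. destruct cnt as [e e_inj].
  pose (T := fun v => isomorphic (induced M (conn M v)) (induced M (conn M x))).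
  assert (T_conn : forall v w, conn M v w -> T v -> T w).
  { intros v w c. unfold T. rewrite (conn_ext M v w c). auto. }
  assert (ex_rep : forall v, exists p, least (vert M) e (conn M v) p).
  { intro v. apply (least_exists (vert M) e (conn M v) v). apply rt_refl. }
  pose (rep := fun v => proj1_sig (constructive_indefinite_description _ (ex_rep v))).
  assert (hrep : forall v, least (vert M) e (conn M v) (rep v)).
  { intro v. exact (proj2_sig (constructive_indefinite_description _ (ex_rep v))). }
  assert (rep_conn : forall v, conn M v (rep v)) by (intro v; apply hrep).
  assert (rep_eq : forall v w, conn M v w -> rep v = rep w).
  { intros v w c. apply (least_unique (vert M) e e_inj (conn M v)); [apply hrep|]. rewrite (conn_ext M v w c). apply hrep. }
  assert (rep_conn' : forall v w, rep v = rep w -> conn M v w).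
  { intros v w E. eapply conn_trans; [apply rep_conn|]. rewrite E. apply conn_sym, rep_conn. }
  (* [inr (r, u)] is the vertex [u] in the copy of [H] that replaces the component with
     representative [r]; [inl] keeps the other components. *)
  pose (W := (vert M + vert M * vert H)%type).
  pose (aW := fun p q : W => match p, q with
    | inl v, inl w => adj v w
    | inr (r, u), inr (r', u') => r = r' /\ adj u u'
    | _, _ => False end).
  assert (aW_sym : forall p q, aW p q -> aW q p).
  { intros [v|[r u]] [w|[r' u']]; simpl; auto; [apply adj_sym|]. intros [-> h]; split; auto. apply adj_sym; auto. }
  assert (aW_irr : forall p, ~ aW p p).
  { intros [v|[r u]]; simpl; [apply adj_irrefl|]. intros [_ h]; eapply adj_irrefl; eauto. }
  pose (X := Graph W aW aW_sym aW_irr).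
  pose (dom := fun p : vert X => match p : W with inl v => ~ T v | inr (r, u) => T r /\ rep r = r end).
  assert (psi_ex : forall r, exists f : vert H -> vert M, T r -> (forall u, conn M r (f u)) /\
     forall u v, u <> v -> f u <> f v /\ (adj u v <-> adj (f u) (f v))).
  { intro r. destruct (classic (T r)) as [t|t].
    - destruct (isomorphic_embeds _ _ (isomorphic_sym _ _ t)) as [c [c1 c2]].
      exists (fun u => proj1_sig (c (a u))). intros _. split; [intro u; apply proj2_sig|].
      intros u v ne. split.
      + intro E. apply sig_eq, c1, a1 in E. auto.
      + rewrite a2, c2. simpl. tauto.
    - exists (fun _ => r). tauto. }
  pose (psi := fun r => proj1_sig (constructive_indefinite_description _ (psi_ex r))).
  assert (hpsi : forall r, T r -> (forall u, conn M r (psi r u)) /\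
     forall u v, u <> v -> psi r u <> psi r v /\ (adj u v <-> adj (psi r u) (psi r v))).
  { intro r. exact (proj2_sig (constructive_indefinite_description _ (psi_ex r))). }
  pose (h0 := b (exist (conn M x) x (rt_refl _ _ _))).
  assert (theta_ex : forall r, exists f : vert M -> vert H, T r ->
     forall u v, conn M r u -> conn M r v -> u <> v -> f u <> f v /\ (adj u v <-> adj (f u) (f v))).
  { intro r. destruct (classic (T r)) as [t|t].
    - destruct (isomorphic_embeds _ _ t) as [c [c1 c2]].
      exists (fun u => match excluded_middle_informative (conn M r u) with
        | left p => b (c (exist (conn M r) u p)) | right _ => h0 end).
      intros _ u v hu hv ne. destruct (excluded_middle_informative (conn M r u)); [|tauto].
      destruct (excluded_middle_informative (conn M r v)); [|tauto]. split.
      + intro E. apply b1, c1 in E. inversion E; auto.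
      + rewrite <- b2, <- c2. simpl. tauto.
    - exists (fun _ => h0). tauto. }
  pose (theta := fun r => proj1_sig (constructive_indefinite_description _ (theta_ex r))).
  assert (htheta : forall r, T r -> forall u v, conn M r u -> conn M r v -> u <> v ->
      theta r u <> theta r v /\ (adj u v <-> adj (theta r u) (theta r v))).
  { intro r. exact (proj2_sig (constructive_indefinite_description _ (theta_ex r))). }
  assert (e1 : embeds (induced X dom) M).
  { apply (embeds_of_induced (G := X) dom (fun p : W => match p with inl v => v | inr (r, u) => psi r u end)).
    assert (mixed : forall v r u, ~ T v -> T r -> v <> psi r u /\ ~ adj v (psi r u)).
    { intros v r u nt t. destruct (hpsi r t) as [h _]. split.
      - intros ->. apply nt. eapply T_conn; [apply h|auto].
      - intro q. apply nt. eapply T_conn; [|exact t]. eapply conn_adj; [apply h|]. apply adj_sym; exact q. }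
    intros [v|[r u]] [w|[r' u']]; simpl; intros d1 d2 ne.
    - split; [congruence|tauto].
    - destruct (mixed v r' u' d1 (proj1 d2)). split; tauto.
    - destruct (mixed w r u d2 (proj1 d1)) as [h1 h2]. split; [congruence|].
      rewrite (gadj_iff M (psi r u)). tauto.
    - destruct d1 as [t E], d2 as [t' E']. destruct (hpsi r t) as [h1 h2]. destruct (hpsi r' t') as [h3 h4].
      destruct (classic (r = r')) as [<-|nr].
      + destruct (h2 u u') as [h5 h6]; [congruence|]. tauto.
      + assert (nc : ~ conn M r r') by (intro c; apply nr; rewrite <- E, <- E'; apply rep_eq; auto).
        split.
        * intro q. apply nc. eapply conn_trans; [apply h1|]. rewrite q. apply conn_sym, h3.
        * split; [tauto|]. intro q. exfalso; apply nc. eapply conn_trans; [apply (conn_adj _ _ _ _ (h1 u) q)|].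
          apply conn_sym, h3. }
  assert (T_rep : forall v, T v -> T (rep v)) by (intros v; apply T_conn, rep_conn).
  assert (e2 : embeds M (induced X dom)).
  { apply (embeds_induced_of (H := X) dom (fun v => if excluded_middle_informative (T v) then inr (rep v, theta (rep v) v) else inl v : W)).
    - intro v. destruct (excluded_middle_informative (T v)); simpl; auto. split; auto. symmetry. apply rep_eq, rep_conn.
    - intros v w ne.
      destruct (excluded_middle_informative (T v)) as [tv|tv], (excluded_middle_informative (T w)) as [tw|tw]; simpl.
      + destruct (classic (rep v = rep w)) as [E|nE].
        * destruct (htheta (rep v) (T_rep v tv) v w) as [h1 h2]; auto.
          { apply conn_sym, rep_conn. }
          { rewrite E. apply conn_sym, rep_conn. }
          rewrite <- E. split; [congruence|tauto].
        * split; [congruence|]. split; [|tauto]. intro q. exfalso. apply nE, rep_eq, rt_step, q.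
      + split; [congruence|]. split; [|tauto]. intro q. apply tw. eapply T_conn; [apply rt_step; exact q|auto].
      + split; [congruence|]. split; [|tauto]. intro q. apply tv. eapply T_conn; [apply rt_step, adj_sym; exact q|auto].
      + split; [congruence|tauto]. }
  (* [kappa] records the original component behind a vertex of [X]; being constant along edges, it
     shows that the new graph is disconnected. *)
  pose (kappa := fun p : W => match p with inl v => rep v | inr (r, _) => rep r end).
  assert (kappa_adj : forall p q, aW p q -> kappa p = kappa q).
  { intros [v|[r u]] [w|[r' u']]; simpl; try tauto.
    - intro q. apply rep_eq, rt_step, q.
    - intros [-> _]; auto. }
  assert (kappa_conn : forall p q, conn (induced X dom) p q -> kappa (proj1_sig p) = kappa (proj1_sig q)).
  { intros p q c. induction c as [p q h|p|p q s _ IH1 _ IH2]; [|reflexivity|].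
    - apply kappa_adj, h.
    - congruence. }
  assert (Tx : T x) by apply isomorphic_refl.
  assert (co : coconnected (induced X dom)).
  { destruct e2 as [f [f1 f2]].
    assert (point : forall v, exists p : vert (induced X dom), kappa (proj1_sig p) = rep v).
    { intro v. destruct (classic (T v)) as [t|t].
      - assert (d : dom (inr (rep v, h0))). { split; auto. symmetry. apply rep_eq, rep_conn. }
        exists (exist dom (inr (rep v, h0)) d). simpl. symmetry. apply rep_eq, rep_conn.
      - exists (exist dom (inl v) t). reflexivity. }
    destruct (point x) as [p hp]. destruct (point y) as [q hq].
    apply disconnected_coconnected. intro c. apply xy, rep_conn'. rewrite <- hp, <- hq. apply kappa_conn, c. }
  destruct (uniq _ co (conj e1 e2)) as [g [h [gh1 [gh2 g3]]]].
    assert (h_conn : forall u v, conn M u v -> conn (induced X dom) (h u) (h v)).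
  { apply clos_map. intros u v q. apply g3. rewrite !gh2; auto. }
  assert (g_conn : forall u v, conn (induced X dom) u v -> conn M (g u) (g v)).
  { apply clos_map. intros u v q. apply g3; auto. }
  assert (g_inj : forall u v, g u = g v -> u = v).
  { intros u v E. rewrite <- (gh1 u), <- (gh1 v), E; auto. }
  (* If [x] goes to a kept component, that component is isomorphic to the one of [x] and should have
     been replaced. Otherwise the component of [x] is mapped onto a copy of [H]. *)
  destruct (h x) as [[v|[r u]] dx] eqn:Ehx.
  - exfalso. assert (tv : T v); [|exact (dx tv)].
    assert (dw : forall w, conn M v w -> dom (inl w)).
    { intros w c t. apply dx. eapply T_conn; [apply conn_sym; exact c|exact t]. }
    assert (cw : forall w (c : conn M v w), conn (induced X dom) (h x) (exist dom (inl w) (dw w c))).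
    { rewrite Ehx. intros w c. revert dw. apply clos_rt_rtn1 in c as c'. induction c' as [|w w' q c' IH]; intro dw.
      - replace (dw v c) with dx by apply proof_irrelevance. apply rt_refl.
      - apply clos_rtn1_rt in c'. eapply rt_trans; [apply (IH c' dw)|]. apply rt_step. exact q. }
    assert (cg : forall w (c : conn M v w), conn M x (g (exist dom (inl w) (dw w c)))).
    { intros w c. rewrite <- (gh2 x). apply g_conn, cw. }
    apply (isomorphic_of_bijection (induced M (conn M v)) (induced M (conn M x))
      (fun w => exist (conn M x) _ (cg (proj1_sig w) (proj2_sig w)))).
    + intros [w c] [w' c'] E. simpl in E. inversion E as [E']. apply g_inj in E'. inversion E'. apply sig_eq; auto.
    + intros [w c].
      assert (ch := h_conn x w c). rewrite Ehx in ch.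
      assert (inX : forall q, conn (induced X dom) (exist dom (inl v) dx) q -> exists w', proj1_sig q = inl w' /\ conn M v w').
      { intros q cq. apply clos_rt_rtn1 in cq. induction cq as [|q q' aq cq [w1 [E1 c1]]].
        - exists v. split; [reflexivity|apply rt_refl].
        - destruct q as [q dq], q' as [[w2|[r2 u2]] dq']; simpl in *; subst q; simpl in aq; [|tauto].
          exists w2; split; auto. eapply conn_adj; eauto. }
      destruct (inX _ ch) as [w' [E' c']].
      exists (exist (conn M v) w' c'). apply sig_eq. simpl.
      rewrite <- (gh2 w). f_equal. apply sig_eq. simpl. auto.
    + intros [w c] [w' c']. simpl. rewrite <- g3. simpl. tauto.
  - assert (du : forall u', dom (inr (r, u'))) by (intro u'; exact dx).
    assert (cu : forall u', conn (induced X dom) (h x) (exist dom (inr (r, u')) (du u'))).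
    { intro u'. assert (Ehx' : h x = exist dom (inr (r, u)) (du u)) by (rewrite Ehx; apply sig_eq; reflexivity).
      rewrite Ehx'.
      apply (clos_map (@adj H) (@adj (induced X dom)) (fun u' => exist dom (inr (r, u')) (du u'))); [|apply cH].
      intros u1 u2 q. simpl. auto. }
    assert (cg : forall u', conn M x (g (exist dom (inr (r, u')) (du u')))).
    { intro u'. rewrite <- (gh2 x). apply g_conn, cu. }
    apply (isomorphic_of_bijection H (induced M (conn M x)) (fun u' => exist (conn M x) _ (cg u'))).
    + intros u1 u2 E. inversion E as [E']. apply g_inj in E'. inversion E'. auto.
    + intros [w c]. assert (ch := h_conn x w c). rewrite Ehx in ch.
      assert (inX : forall q, conn (induced X dom) (exist dom (inr (r, u)) dx) q -> exists u', proj1_sig q = inr (r, u')).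
      { intros q cq. apply clos_rt_rtn1 in cq. induction cq as [|q q' aq cq [u1 E1]].
        - exists u. reflexivity.
        - destruct q as [q dq], q' as [[w2|[r2 u2]] dq']; simpl in *; subst q; simpl in aq; [tauto|].
          destruct aq as [<- _]. eauto. }
      destruct (inX _ ch) as [u' E']. exists u'. apply sig_eq. simpl.
      rewrite <- (gh2 w). f_equal. apply sig_eq. simpl. auto.
    + intros u1 u2. simpl. rewrite <- g3. simpl. tauto.
Qed.

End Component.

Lemma finite_components M : cograph M -> countable_graph M -> unique_coconnected M ->
  exists l, forall v, ~ isolated M v -> exists y, In y l /\ conn M y v.
Proof.
  intros c ct u. apply NNPP; intro no.
  assert (h : forall l, exists v, ~ isolated M v /\ forall y, In y l -> ~ conn M y v).
  { intro l. apply NNPP; intro h. apply no. exists l. intros v iv. apply NNPP; intro h'. apply h.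
    exists v; split; auto. intros y hy cy. apply h'; eauto. }
  pose (nx := fun l => proj1_sig (constructive_indefinite_description _ (h l))).
  assert (hnx : forall l, ~ isolated M (nx l) /\ forall y, In y l -> ~ conn M y (nx l)).
  { intro l. exact (proj2_sig (constructive_indefinite_description _ (h l))). }
  pose (U := fix U n := match n with 0 => nil | S n => nx (U n) :: U n end).
  assert (hU : forall i j, i < j -> In (nx (U i)) (U j)).
  { induction 1; simpl; auto. }
  apply (many_components M c ct (fun n => nx (U n))); auto.
  - intro n; apply hnx.
  - intros i j ij cij. destruct (lt_eq_lt_dec i j) as [[l|l]|l]; [|tauto|].
    + eapply hnx; [apply hU; exact l|exact cij].
    + eapply hnx; [apply hU; exact l|apply conn_sym; exact cij].
Qed.

(** Isolated vertices are all twins, and twins within a component are twins in [M]. *)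
Lemma simple_of_components M l : (forall v, ~ isolated M v -> exists y, In y l /\ conn M y v) ->
  (forall y, In y l -> simple (induced M (conn M y))) -> simple M.
Proof.
  intros h s.
  assert (hs : exists l', forall v, ~ isolated M v -> exists z, In z l' /\ twin M v z).
  { assert (g : forall l0, incl l0 l -> exists l', forall y v, In y l0 -> conn M y v -> exists z, In z l' /\ twin M v z).
    { induction l0 as [|y l0 IH]; intro hl.
      - exists nil. intros y v [].
      - destruct IH as [l' hl']; [intros z hz; apply hl; right; auto|].
        destruct (s y) as [ly hly]; [apply hl; left; auto|].
        exists (map (@proj1_sig _ _) ly ++ l'). intros y' v [<-|hy'] c.
        + destruct (hly (exist (conn M y) v c)) as [[z cz] [z1 z2]].
          exists z. split; [apply in_or_app; left; apply in_map_iff; exists (exist (conn M y) z cz); auto|].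
          intros w wv wz. destruct (classic (conn M y w)) as [cw|cw].
          * apply (z2 (exist (conn M y) w cw)); intro E; inversion E; auto.
          * split; intro a; exfalso; apply cw; eapply conn_adj; [exact c|exact a|exact cz|exact a].
        + destruct (hl' y' v hy' c) as [z [z1 z2]]. exists z; split; auto. apply in_or_app; auto. }
    destruct (g l (incl_refl l)) as [l' hl']. exists l'. intros v iv. destruct (h v iv) as [y [y1 y2]]. eauto. }
  destruct hs as [l' hl'].
  destruct (classic (exists i, isolated M i)) as [[i hi]|no].
  - exists (i :: l'). intro v. destruct (classic (isolated M v)) as [iv|iv].
    + exists i. split; [left; auto|]. intros z _ _. split; intro a; exfalso; [eapply iv|eapply hi]; eauto.
    + destruct (hl' v iv) as [z [z1 z2]]. exists z; split; [right|]; auto.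
  - exists l'. intro v. apply hl'. intro iv; eauto.
Qed.

(* Minimality gives an embedding of [M] into one of its components [C]; adding to [C] one or two
   isolated vertices then yields two siblings. *)
Lemma disconnected_case M : cograph M -> countable_graph M -> unique_coconnected M -> ~ simple M -> ~ connected M ->
  (forall B, ~ simple (induced M B) -> connected (induced M B) -> unique_connected (induced M B) -> embeds M (induced M B)) ->
  False.
Proof.
  intros c ct uq ns nc mn.
  destruct (finite_components M c ct uq) as [l hl].
  assert (exists y, ~ simple (induced M (conn M y))) as [y hy].
  { apply NNPP; intro no. apply ns, (simple_of_components M l hl). intros y _. apply NNPP; eauto. }
  set (C := conn M y) in *.
  assert (exists a, ~ C a) as [a ha].
  { apply NNPP; intro no. apply nc. intros u v. apply (conn_trans M u y v).
    - apply conn_sym. apply NNPP; eauto.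
    - apply NNPP; eauto. }
  destruct (mn C hy (component_connected M y) (component_unique_connected M ct uq y a ha)) as [g' [g1 g2]].
  pose (g := fun v => proj1_sig (g' v)).
  assert (gC : forall v, C (g v)) by (intro v; apply proj2_sig).
  assert (gi : forall v w, g v = g w -> v = w) by (intros v w E; apply g1, sig_eq, E).
  assert (ga : forall v w, adj v w <-> adj (g v) (g w)) by (intros v w; apply g2).
  (* A vertex of [C] without neighbour would be all of [C], and [C] would have a single twin
     class. *)
  assert (edge : forall v, C v -> exists w, C w /\ adj v w).
  { intros v cv. apply NNPP; intro no.
    assert (iv : isolated M v). { intros w q. apply no. exists w. split; auto. eapply conn_adj; eauto. }
    apply hy. exists (exist C v cv :: nil). intros [w cw]. exists (exist C v cv). split; [left; auto|].
    assert (w = v).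
    { apply NNPP; intro ne. apply (conn_nonisolated M w v); auto.
      - intro iw. assert (q : conn M w v) by (eapply conn_trans; [apply conn_sym; exact cw|exact cv]).
        apply clos_rt_rt1n in q. inversion q; subst; auto. eapply iw; eauto.
      - eapply conn_trans; [apply conn_sym; exact cw|exact cv]. }
    subst w. intros z z1 _. exfalso; apply z1; clear z1.
    destruct z as [z cz]. apply sig_eq. simpl.
    assert (q : conn M v z) by (eapply conn_trans; [apply conn_sym; exact cw|exact cz]).
    apply clos_rt_rt1n in q. inversion q; subst; auto. exfalso; eapply iv; eauto. }
  (* In [A] only [a] is isolated, in [B] both [a] and [g a] are. Both contain a copy of [M], through
     [g] and through [g] applied twice. *)
  pose (A := fun v => C v \/ v = a).
  pose (B := fun v => v = a \/ exists u, A u /\ v = g u).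
  assert (gg : forall v w, v <> w -> g v <> g w /\ (adj v w <-> adj (g v) (g w))).
  { intros v w ne. split; [intro E; apply ne; auto|apply ga]. }
  assert (eA : equimorphic (induced M A) M).
  { split; [apply induced_embeds|]. apply (embeds_induced_of A g); auto. intro v; left; auto. }
  assert (eB : equimorphic (induced M B) M).
  { split; [apply induced_embeds|]. apply (embeds_induced_of B (fun v => g (g v))).
    - intro v; right. exists (g v). split; auto. left; auto.
    - intros v w ne. split; [intro E; apply ne; auto|]. rewrite ga, (ga (g v)). tauto. }
  assert (iA := uq _ (induced_coconnected M A y a (or_introl (rt_refl _ _ _)) (or_intror eq_refl) ha) eA).
  assert (iB : isomorphic (induced M B) M).
  { apply uq; auto. apply (induced_coconnected M B (g y) a); [|left; auto|].
    - right. exists y. split; auto. left. apply rt_refl.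
    - intro q. apply ha. eapply conn_trans; [apply gC|exact q]. }
  destruct (isomorphic_trans _ _ _ iB (isomorphic_sym _ _ iA)) as [f [f' [f1 [f2 f3]]]].
  assert (hBa : B a) by (left; auto).
  assert (hBg : B (g a)) by (right; exists a; split; auto; right; auto).
  assert (naC : forall v, C v -> ~ adj a v).
  { intros v cv q. apply ha. eapply conn_adj; [exact cv|apply adj_sym; exact q]. }
  assert (i1 : isolated (induced M B) (exist B a hBa)).
  { intros [v [->|[u [hu ->]]]] q; simpl in q; [eapply adj_irrefl; eauto|]. exact (naC _ (gC u) q). }
  assert (i2 : isolated (induced M B) (exist B (g a) hBg)).
  { intros [v [->|[u [[hu| ->] ->]]]] q; simpl in q.
    - exact (naC _ (gC a) (adj_sym _ _ _ q)).
    - apply ga in q. exact (naC u hu q).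
    - eapply adj_irrefl; eauto. }
  assert (only : forall v : vert (induced M A), isolated (induced M A) v -> proj1_sig v = a).
  { intros [v [cv| ->]] iv; auto. exfalso. destruct (edge v cv) as [w [cw q]].
    apply (iv (exist A w (or_introl cw))). exact q. }
  assert (E : f (exist B a hBa) = f (exist B (g a) hBg)).
  { apply sig_eq. rewrite (only _ (isolated_isomorphic _ _ f f' _ f2 f3 i1)).
    rewrite (only _ (isolated_isomorphic _ _ f f' _ f2 f3 i2)). reflexivity. }
  apply (f_equal f') in E. rewrite !f1 in E. inversion E as [E']. apply ha. rewrite E'. apply gC.
Qed.

(** * Doubling words *)

Lemma wqo_minimal {T : Type} (R : T -> T -> Prop) (P : T -> Prop) :
  (forall a b c, R a b -> R b c -> R a c) -> (forall u : nat -> T, exists i j, i < j /\ R (u i) (u j)) ->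
  (exists a, P a) -> exists a, P a /\ forall b, P b -> R b a -> R a b.
Proof.
  intros tr w [a0 pa0]. apply NNPP; intro no.
  destruct (dependent_choice P (fun _ a b => R b a /\ ~ R a b) a0 pa0) as [u [_ [_ uR]]].
  { intros _ a pa. apply NNPP; intro h. apply no. exists a; split; auto. intros b pb ba. apply NNPP; intro ab.
    apply h; eauto. }
  destruct (w u) as [i [j [ij r]]].
  assert (dec : forall m, S i <= m -> m = S i \/ R (u m) (u (S i))).
  { induction 1; auto. right. destruct IHle as [->|h]; [apply uR|]. eapply tr; [apply uR|exact h]. }
  apply (proj2 (uR i)). destruct (dec j ij) as [->|h]; auto. eapply tr; eauto.
Qed.

(** Step [n] moves up and also passes the element of code [n], if [S] has one. *)
Lemma cofinal_sequence {V : Type} (r : V -> V -> Prop) (S : V -> Prop) (e : V -> nat) v0 :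
  (forall v w, e v = e w -> v = w) ->
  (forall a b, r a b -> ~ r b a) -> (forall a b c, r a b -> r a c \/ r c b) ->
  S v0 -> (forall a, S a -> exists b, S b /\ r a b) ->
  exists y : nat -> V, y 0 = v0 /\ (forall n, S (y n)) /\ (forall n m, n < m -> r (y n) (y m)) /\
    forall v, S v -> exists n, r v (y n).
Proof.
  intros inj asym weak s0 up.
  assert (tr : forall a b c, r a b -> r b c -> r a c).
  { intros a b c h1 h2. destruct (weak a b c h1); auto. exfalso; eapply asym; eauto. }
  destruct (dependent_choice S (fun n y y' => r y y' /\ forall v, S v -> e v = n -> r v y') v0 s0) as [y [y0 [yS yR]]].
  { intros n y sy. destruct (up y sy) as [a [a1 a2]].
    destruct (classic (exists v, S v /\ e v = n)) as [[v [sv ev]]|no].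
    - destruct (up v sv) as [b [b1 b2]].
      assert (un : forall v', S v' -> e v' = n -> v' = v) by (intros v' _ E; apply inj; congruence).
      destruct (weak y a v a2) as [h|h].
      + exists b. split; auto. split; [eapply tr; eauto|]. intros v' h1 h2. rewrite (un v' h1 h2); auto.
      + exists a. split; auto. split; auto. intros v' h1 h2. rewrite (un v' h1 h2); auto.
    - exists a. split; auto. split; auto. intros v sv ev. exfalso; eauto. }
  exists y. split; [exact y0|split; [exact yS|split]].
  - intros n m nm. induction nm; [exact (proj1 (yR n))|]. eapply tr; [exact IHnm|exact (proj1 (yR m))].
  - intros v sv. exists (Datatypes.S (e v)). apply (yR (e v)); auto.
Qed.

Lemma cofinal_piece {V : Type} (r : V -> V -> Prop) (y : nat -> V) k v :
  (exists n, r v (y n)) -> (forall a b, r a b -> ~ r b a) ->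
  (forall n m, n < m -> r (y n) (y m)) -> (forall a b c, r a b -> r b c -> r a c) ->
  ~ r v (y k) -> exists n, k <= n /\ ~ r v (y n) /\ r v (y (S n)).
Proof.
  intros [n h] asym mono tr nk.
  assert (kn : k < n).
  { destruct (lt_eq_lt_dec k n) as [[l|l]|l]; auto; exfalso; apply nk; [subst; auto|].
    eapply tr; [exact h|auto]. }
  replace n with (S k + (n - S k)) in h by lia. remember (n - S k) as d. clear Heqd kn n.
  induction d as [|d IH].
  - exists k. rewrite Nat.add_0_r in h. auto.
  - destruct (classic (r v (y (S k + d)))) as [q|q]; auto.
    exists (S k + d). split; [lia|split; auto]. replace (S (S k + d)) with (S k + S d) by lia. auto.
Qed.

Section Doubling.
Variable G : graph.
Hypothesis cog : cograph G.
Hypothesis cnt : countable_graph G.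
Variable x : vert G.

Notation V := (vert G).
Notation lt := (closer G x).
Notation lab v := (adj x v).
Notation rle := (rooted_embeds_in (@adj G) x).

Lemma lt_asym a b : lt a b -> ~ lt b a.
Proof. apply closer_asym; auto. Qed.

Lemma lt_weak a b c : lt a b -> lt a c \/ lt c b.
Proof. apply closer_weak; auto. Qed.

Lemma lt_tr a b c : lt a b -> lt b c -> lt a c.
Proof. intros h1 h2. destruct (lt_weak a b c h1); auto. exfalso; eapply lt_asym; eauto. Qed.

Lemma lt_ne a b : lt a b -> a <> b.
Proof. intros h ->. exact (lt_asym _ _ h h). Qed.

Lemma lt_adj a b : lt a b -> (adj a b <-> lab b).
Proof. apply closer_adj; auto. Qed.

Lemma rle_subset (A B : V -> Prop) : subset A B -> rle A B.
Proof. intro h. exists (fun v => v). split; [intros v a; split; [auto|tauto]|tauto]. Qed.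

Lemma rle_trans (A B C : V -> Prop) : rle A B -> rle B C -> rle A C.
Proof.
  intros [f [f1 f2]] [g [g1 g2]]. exists (fun v => g (f v)). split.
  - intros v a. destruct (f1 v a) as [h1 h2]. destruct (g1 _ h1) as [h3 h4]. split; [auto|tauto].
  - intros v w a b ne. destruct (f2 v w a b ne) as [h1 h2].
    destruct (g2 (f v) (f w)) as [h3 h4]; [apply f1; auto|apply f1; auto|auto|]. split; [auto|tauto].
Qed.

Definition set_lt (A B : V -> Prop) := forall a b, A a -> B b -> lt a b.

(** Between different nodes adjacency is the label of the farther vertex, so label-preserving
    embeddings of the pieces fit together once the pieces keep their order. *)
Lemma rle_glue (I : V -> Prop) (P T : nat -> V -> Prop) :
  (forall v, I v -> exists n, P n v) -> (forall n, rle (P n) (T n)) ->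
  (forall n m, n <> m -> (set_lt (P n) (P m) /\ set_lt (T n) (T m)) \/ (set_lt (P m) (P n) /\ set_lt (T m) (T n))) ->
  rle I (fun v => exists n, T n v).
Proof.
  intros cov emb ord.
  pose (idx := fun v => epsilon (inhabits 0) (fun n => P n v)).
  assert (hidx : forall v, I v -> P (idx v) v) by (intros v iv; apply epsilon_spec; auto).
  pose (f := fun n => proj1_sig (constructive_indefinite_description _ (emb n))).
  assert (hf : forall n, (forall v, P n v -> T n (f n v) /\ (lab v <-> lab (f n v))) /\
    forall v w, P n v -> P n w -> v <> w -> f n v <> f n w /\ (adj v w <-> adj (f n v) (f n w))).
  { intro n. exact (proj2_sig (constructive_indefinite_description _ (emb n))). }
  exists (fun v => f (idx v) v). split.
  - intros v iv. destruct (proj1 (hf (idx v)) v (hidx v iv)). split; eauto.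
  - assert (cross : forall v w, I v -> I w -> set_lt (P (idx v)) (P (idx w)) -> set_lt (T (idx v)) (T (idx w)) ->
      f (idx v) v <> f (idx w) w /\ (adj v w <-> adj (f (idx v) v) (f (idx w) w))).
    { intros v w iv iw h1 h2. destruct (proj1 (hf (idx v)) v (hidx v iv)) as [t1 _].
      destruct (proj1 (hf (idx w)) w (hidx w iw)) as [t2 l2].
      assert (q := h2 _ _ t1 t2). split; [apply lt_ne; auto|].
      rewrite (lt_adj _ _ q), (lt_adj v w); [auto|]. apply h1; auto. }
    intros v w iv iw ne. destruct (Nat.eq_dec (idx v) (idx w)) as [E|nE].
    + rewrite <- E. apply hf; auto. rewrite E. auto.
    + destruct (ord _ _ nE) as [[h1 h2]|[h1 h2]]; [apply cross; auto|].
      destruct (cross w v iw iv h1 h2) as [h3 h4]. split; [congruence|].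
      rewrite (gadj_iff G v w), h4. apply gadj_iff.
Qed.

(* Every node of the word is repeated twice: the two copies of a node form the node
   consisting of two copies of its letter. *)
Definition dadj (v : V) (i : bool) (w : V) (j : bool) : Prop :=
  (i = j /\ adj v w) \/ (i <> j /\ (((lab v <-> lab w) /\ lab v) \/ (~ (lab v <-> lab w) /\ adj v w))).

Definition double_embeds (I T : V -> Prop) := exists f : V -> bool -> V,
  (forall v i, I v -> T (f v i) /\ (lab v <-> lab (f v i))) /\
  forall v i w j, I v -> I w -> (v, i) <> (w, j) -> f v i <> f w j /\ (dadj v i w j <-> adj (f v i) (f w j)).

Lemma dadj_sym v i w j : dadj v i w j <-> dadj w j v i.
Proof.
  unfold dadj. rewrite (gadj_iff G v w).
  assert (i = j <-> j = i) by (split; congruence). tauto.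
Qed.

Lemma dadj_lt v i w j : lt v w -> (dadj v i w j <-> lab w).
Proof.
  intro h. assert (q := lt_adj v w h). unfold dadj. destruct (bool_dec i j); tauto.
Qed.

Lemma dadj_map v w v' w' i j : (lab v <-> lab v') -> (lab w <-> lab w') -> (v <> w -> (adj v w <-> adj v' w')) ->
  (v = w -> v' = w') -> (v, i) <> (w, j) -> (dadj v i w j <-> dadj v' i w' j).
Proof.
  intros h1 h2 h3 h4 ne. unfold dadj. destruct (classic (v = w)) as [e|e].
  - assert (i <> j) by congruence. assert (E := h4 e). subst w w'. tauto.
  - specialize (h3 e). tauto.
Qed.

Lemma double_embeds_l I J T : rle I J -> double_embeds J T -> double_embeds I T.
Proof.
  intros [g [g1 g2]] [f [f1 f2]]. exists (fun v i => f (g v) i). split.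
  - intros v i iv. destruct (g1 v iv) as [h1 h2]. destruct (f1 (g v) i h1). split; [auto|tauto].
  - intros v i w j iv iw ne.
    assert (ne' : (g v, i) <> (g w, j)).
    { intro E. apply ne. inversion E as [[E1 E2]]. subst j. f_equal. apply NNPP; intro q. destruct (g2 v w iv iw q); auto. }
    destruct (f2 (g v) i (g w) j) as [h1 h2]; [apply g1; auto|apply g1; auto|auto|]. split; auto.
    rewrite <- h2. apply dadj_map; auto.
    + apply g1; auto.
    + apply g1; auto.
    + intro q. apply g2; auto.
    + congruence.
Qed.

Lemma double_embeds_r I T T' : double_embeds I T -> rle T T' -> double_embeds I T'.
Proof.
  intros [f [f1 f2]] [g [g1 g2]]. exists (fun v i => g (f v i)). split.
  - intros v i iv. destruct (f1 v i iv) as [h1 h2]. destruct (g1 _ h1). split; [auto|tauto].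
  - intros v i w j iv iw ne. destruct (f2 v i w j iv iw ne) as [h1 h2].
    destruct (g2 (f v i) (f w j)) as [h3 h4]; [apply f1; auto|apply f1; auto|auto|]. split; [auto|tauto].
Qed.

Lemma double_glue (I : V -> Prop) (P T : nat -> V -> Prop) :
  (forall v, I v -> exists n, P n v) -> (forall n, double_embeds (P n) (T n)) ->
  (forall n m, n <> m -> (set_lt (P n) (P m) /\ set_lt (T n) (T m)) \/ (set_lt (P m) (P n) /\ set_lt (T m) (T n))) ->
  double_embeds I (fun v => exists n, T n v).
Proof.
  intros cov emb ord.
  pose (idx := fun v => epsilon (inhabits 0) (fun n => P n v)).
  assert (hidx : forall v, I v -> P (idx v) v) by (intros v iv; apply epsilon_spec; auto).
  pose (f := fun n => proj1_sig (constructive_indefinite_description _ (emb n))).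
  assert (hf : forall n, (forall v i, P n v -> T n (f n v i) /\ (lab v <-> lab (f n v i))) /\
    forall v i w j, P n v -> P n w -> (v, i) <> (w, j) -> f n v i <> f n w j /\ (dadj v i w j <-> adj (f n v i) (f n w j))).
  { intro n. exact (proj2_sig (constructive_indefinite_description _ (emb n))). }
  exists (fun v i => f (idx v) v i). split.
  - intros v i iv. destruct (proj1 (hf (idx v)) v i (hidx v iv)). split; eauto.
  - assert (cross : forall v i w j, I v -> I w -> set_lt (P (idx v)) (P (idx w)) -> set_lt (T (idx v)) (T (idx w)) ->
      f (idx v) v i <> f (idx w) w j /\ (dadj v i w j <-> adj (f (idx v) v i) (f (idx w) w j))).
    { intros v i w j iv iw h1 h2. destruct (proj1 (hf (idx v)) v i (hidx v iv)) as [t1 _].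
      destruct (proj1 (hf (idx w)) w j (hidx w iw)) as [t2 l2].
      assert (q := h2 _ _ t1 t2). split; [apply lt_ne; auto|].
      rewrite (lt_adj _ _ q), (dadj_lt v i w j); [auto|]. apply h1; auto. }
    intros v i w j iv iw ne. destruct (Nat.eq_dec (idx v) (idx w)) as [E|nE].
    + rewrite <- E. apply hf; auto. rewrite E. auto.
    + destruct (ord _ _ nE) as [[h1 h2]|[h1 h2]]; [apply cross; auto|].
      destruct (cross w j v i iw iv h1 h2) as [h3 h4]. split; [congruence|].
      rewrite dadj_sym, h4. apply gadj_iff.
Qed.

(* Finitely many copies of the word [I], one above the other, contain the doubled word. *)
Definition absorbs (I : V -> Prop) := exists m, forall B : nat -> V -> Prop,
  (forall k, k < m -> rle I (B k)) -> (forall k l, k < l -> l < m -> set_lt (B k) (B l)) ->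
  double_embeds I (fun v => exists k, k < m /\ B k v).

Lemma absorbs_self I : double_embeds I I -> absorbs I.
Proof.
  intro h. exists 1. intros B b1 _. eapply double_embeds_r; [exact h|].
  eapply rle_trans; [apply (b1 0); lia|]. apply rle_subset. intros v hv. exists 0; split; auto.
Qed.

(** The first [m] copies of [I] serve [J], the next [n] serve [K]. *)
Lemma absorbs_cut I J K : (forall v, I v -> J v \/ K v) -> subset J I -> subset K I -> set_lt J K -> absorbs J -> absorbs K -> absorbs I.
Proof.
  intros cov sJ sK lt0 [m hm] [n hn]. exists (m + n). intros B b1 b2.
  assert (dJ : double_embeds J (fun v => exists k, k < m /\ B k v)).
  { apply hm.
    - intros k hk. eapply rle_trans; [apply rle_subset; exact sJ|apply b1; lia].
    - intros; apply b2; lia. }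
  assert (dK : double_embeds K (fun v => exists k, k < n /\ B (m + k) v)).
  { apply (hn (fun k => B (m + k))).
    - intros k hk. eapply rle_trans; [apply rle_subset; exact sK|apply b1; lia].
    - intros; apply b2; lia. }
  eapply double_embeds_r; [|apply rle_subset].
  - apply (double_glue I (fun i => match i with 0 => J | 1 => K | _ => fun _ => False end)
      (fun i => match i with 0 => fun v => exists k, k < m /\ B k v | 1 => fun v => exists k, k < n /\ B (m + k) v | _ => fun _ => False end)).
    + intros v iv. destruct (cov v iv); [exists 0|exists 1]; auto.
    + intros [|[|i]]; auto. exists (fun v _ => v). split; tauto.
    + assert (h : set_lt (fun v => exists k, k < m /\ B k v) (fun v => exists k, k < n /\ B (m + k) v)).
      { intros a b [k [k1 k2]] [l [l1 l2]]. apply (b2 k (m + l)); auto; lia. }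
      intros [|[|i]] [|[|j]] ne; try (exfalso; congruence); try (left; split; auto; intros a b; tauto); right; auto.
  - intros v [[|[|i]] hv]; [destruct hv as [k [k1 k2]]; exists k; split; [lia|auto]| |tauto].
    destruct hv as [k [k1 k2]]. exists (m + k); split; [lia|auto].
Qed.

(** Within a single node two copies suffice, one for each copy index. *)
Lemma absorbs_class y I : (forall v, I v -> same V (closer G) x v y) -> absorbs I.
Proof.
  intro hs.
  assert (hl : forall v w, I v -> I w -> (lab v <-> lab w)).
  { intros v w iv iw. rewrite (same_closer_label G x v y (hs v iv)). symmetry. apply same_closer_label, hs; auto. }
  exists 2. intros B b1 b2. destruct (b1 0) as [f [f1 f2]]; [lia|]. destruct (b1 1) as [g [g1 g2]]; [lia|].
  assert (cross : forall v w, I v -> I w -> f v <> g w /\ (lab w <-> adj (f v) (g w))).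
  { intros v w iv iw. assert (q : lt (f v) (g w)). { apply (b2 0 1); [lia|lia|apply f1; auto|apply g1; auto]. }
    split; [apply lt_ne; auto|]. rewrite (lt_adj _ _ q). apply g1; auto. }
  exists (fun v i => if i : bool then g v else f v). split.
  - intros v [|] iv; [destruct (g1 v iv)|destruct (f1 v iv)]; split; auto; [exists 1|exists 0]; auto.
  - intros v i w j iv iw ne. specialize (hl v w iv iw). unfold dadj. destruct i, j.
    + destruct (g2 v w) as [h1 h2]; auto; [congruence|]. split; auto. intuition congruence.
    + destruct (cross w v iw iv) as [h1 h2]. split; [congruence|]. rewrite (gadj_iff G (g v)). intuition congruence.
    + destruct (cross v w iv iw) as [h1 h2]. split; [congruence|]. intuition congruence.
    + destruct (f2 v w) as [h1 h2]; auto; [congruence|]. split; auto. intuition congruence.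
Qed.

Lemma rle_wqo (A : nat -> V -> Prop) : exists i j, i < j /\ rle (A i) (A j).
Proof. apply cograph_rooted_wqo; auto. Qed.

(** From some [k] on every piece embeds into infinitely many later ones, so disjoint blocks of
    consecutive pieces can be reserved, each with the number of copies that one piece needs. If the
    sequence descends, the copies are listed in reverse. *)
Lemma omega_tail (v : nat -> V -> Prop) : (forall n, absorbs (v n)) ->
  (forall n m, n < m -> set_lt (v n) (v m)) \/ (forall n m, n < m -> set_lt (v m) (v n)) ->
  exists k, double_embeds (fun u => exists n, k <= n /\ v n u) (fun u => exists n, k <= n /\ v n u).
Proof.
  intros gd ori.
  destruct (wqo_recurrent rle v) as [k hk]. { intro u. apply (rle_wqo (fun i => v (u i))). }
  exists k.
  assert (block : forall n p, k <= n -> exists p', p < p' /\ double_embeds (v n) (fun u => exists j, p <= j /\ j < p' /\ v j u)).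
  { intros n p hn. destruct (gd n) as [m hm].
    destruct (hk n hn p) as [j0 [j1 j2]].
    destruct (dependent_choice (fun j => p <= j /\ rle (v n) (v j)) (fun _ j j' => j < j') j0 (conj j1 j2)) as [j [_ [jQ jR]]].
    { intros _ a [a1 a2]. destruct (hk n hn (S a)) as [b [b1 b2]]. exists b. split; [split; [lia|auto]|lia]. }
    assert (jm : forall a b, a < b -> j a < j b).
    { induction 1; [apply jR|]. specialize (jR m0). lia. }
    exists (S (j m)). split; [destruct (jQ m); lia|].
    destruct ori as [up|down].
    - eapply double_embeds_r; [apply (hm (fun i => v (j i)))|].
      + intros i _. apply jQ.
      + intros a b ab _. apply up; auto.
      + apply rle_subset. intros u [i [i1 i2]]. exists (j i). split; [apply jQ|split; auto]. specialize (jm i m i1). lia.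
    - eapply double_embeds_r; [apply (hm (fun i => v (j (m - S i))))|].
      + intros i _. apply jQ.
      + intros a b ab bm. apply down. apply jm. lia.
      + apply rle_subset. intros u [i [i1 i2]]. exists (j (m - S i)). split; [apply jQ|split; auto].
        assert (m - S i < m) by lia. specialize (jm _ _ H). lia. }
  destruct (dependent_choice (fun p => k <= p) (fun n p p' => p < p' /\
     double_embeds (v (k + n)) (fun u => exists j, p <= j /\ j < p' /\ v j u)) k (le_n _)) as [p [_ [pk pR]]].
  { intros n q hq. destruct (block (k + n) q ltac:(lia)) as [p' [h1 h2]]. exists p'. split; [lia|auto]. }
  assert (pm : forall a b, a <= b -> p a <= p b).
  { induction 1; auto. destruct (pR m). lia. }
  eapply double_embeds_r; [apply (double_glue _ (fun n => v (k + n)) (fun n u => exists j, p n <= j /\ j < p (S n) /\ v j u))|].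
  - intros u [n [n1 n2]]. exists (n - k). replace (k + (n - k)) with n by lia. auto.
  - intro n. apply pR.
  - assert (h : forall n m, n < m -> (set_lt (v (k + n)) (v (k + m)) /\
       set_lt (fun u => exists j, p n <= j /\ j < p (S n) /\ v j u) (fun u => exists j, p m <= j /\ j < p (S m) /\ v j u)) \/
       (set_lt (v (k + m)) (v (k + n)) /\
       set_lt (fun u => exists j, p m <= j /\ j < p (S m) /\ v j u) (fun u => exists j, p n <= j /\ j < p (S n) /\ v j u))).
    { intros n m nm. specialize (pm (S n) m nm). destruct ori as [up|down]; [left|right]; split.
      - apply up; lia.
      - intros a b [i [i1 [i2 i3]]] [j [j1 [j2 j3]]]. apply (up i j); auto; lia.
      - apply down; lia.
      - intros a b [i [i1 [i2 i3]]] [j [j1 [j2 j3]]]. apply (down j i); auto; lia. }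
    intros n m ne. destruct (lt_eq_lt_dec n m) as [[l|l]|l]; [auto|tauto|]. destruct (h m n l); auto.
  - apply rle_subset. intros u [n [j [j1 [j2 j3]]]]. exists j. split; auto. specialize (pk n). lia.
Qed.

(** * Words that embed into both sides of a cut *)

Section Universal.
Variable I : V -> Prop.

Definition self_embedding (f : V -> V) := (forall v, I v -> I (f v) /\ (lab v <-> lab (f v))) /\
  forall v w, I v -> I w -> v <> w -> f v <> f w /\ (adj v w <-> adj (f v) (f w)).

(** The order of two copies of [I] expressed by adjacency alone, so that composition with
    self-embeddings preserves it. *)
Definition left_of (f g : V -> V) := forall a b, I a -> I b -> f a <> g b /\ (adj (f a) (g b) <-> lab b).

Lemma self_embedding_comp f g : self_embedding f -> self_embedding g -> self_embedding (fun v => f (g v)).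
Proof.
  intros [f1 f2] [g1 g2]. split.
  - intros v iv. destruct (g1 v iv) as [h1 h2]. destruct (f1 _ h1). split; [auto|tauto].
  - intros v w iv iw ne. destruct (g2 v w iv iw ne) as [h1 h2].
    destruct (f2 (g v) (g w)) as [h3 h4]; [apply g1; auto|apply g1; auto|auto|]. split; [auto|tauto].
Qed.

Lemma left_of_comp f g h : self_embedding h -> self_embedding f -> self_embedding g -> left_of f g ->
  left_of (fun v => h (f v)) (fun v => h (g v)).
Proof.
  intros [_ h2] [f1 _] [g1 _] l a b ia ib. destruct (l a b ia ib) as [l1 l2].
  destruct (h2 (f a) (g b)) as [h3 h4]; [apply f1; auto|apply g1; auto|auto|]. split; [auto|tauto].
Qed.

Lemma left_of_precomp f g f' g' : self_embedding f' -> self_embedding g' -> left_of f g ->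
  left_of (fun v => f (f' v)) (fun v => g (g' v)).
Proof.
  intros [f1 _] [g1 _] l a b ia ib. destruct (g1 b ib) as [h1 h2].
  destruct (l (f' a) (g' b)) as [l1 l2]; [apply f1; auto|auto|]. split; [auto|tauto].
Qed.

Variables (al be : V -> V) (mid : bool -> V -> V) (e : V -> nat).
Hypothesis e_inj : forall v w, e v = e w -> v = w.
Hypothesis al_emb : self_embedding al.
Hypothesis be_emb : self_embedding be.
Hypothesis mid_emb : forall i, self_embedding (mid i).
Hypothesis al_be : left_of al be.
Hypothesis al_mid : forall i, left_of al (mid i).
Hypothesis mid_be : forall i, left_of (mid i) be.
Hypothesis mid_mid : left_of (mid false) (mid true).

(* Binary search for [z] among the elements of [I] with codes [k, k + 1, ...]. *)
Fixpoint search (n k : nat) (i : bool) (z : V) : V :=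
  match n with 0 => z | S n =>
    if excluded_middle_informative (exists v, I v /\ e v = k /\ lt z v) then al (search n (S k) i z)
    else if excluded_middle_informative (exists v, I v /\ e v = k /\ lt v z) then be (search n (S k) i z)
    else if excluded_middle_informative (exists v, I v /\ e v = k) then mid i z
    else search n (S k) i z
  end.

Lemma search_cases k z : I z -> k <= e z ->
  (exists v, I v /\ e v = k /\ lt z v /\ S k <= e z /\ forall n i, search (S n) k i z = al (search n (S k) i z)) \/
  (exists v, I v /\ e v = k /\ lt v z /\ S k <= e z /\ forall n i, search (S n) k i z = be (search n (S k) i z)) \/
  (exists v, I v /\ e v = k /\ ~ lt z v /\ ~ lt v z /\ forall n i, search (S n) k i z = mid i z) \/
  ((~ exists v, I v /\ e v = k) /\ S k <= e z /\ forall n i, search (S n) k i z = search n (S k) i z).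
Proof.
  intros iz kz.
  assert (next : forall v, e v = k -> v <> z -> S k <= e z).
  { intros v ev ne. destruct (Nat.eq_dec k (e z)) as [E|]; [|lia]. exfalso. apply ne, e_inj. congruence. }
  destruct (excluded_middle_informative (exists v, I v /\ e v = k /\ lt z v)) as [[v [v1 [v2 v3]]]|h1].
  { left. exists v. assert (v <> z) by (intros ->; exact (lt_asym _ _ v3 v3)).
    split; [auto|split; [auto|split; [auto|split; [eauto|]]]]. intros n i. simpl.
    destruct (excluded_middle_informative _) as [_|q]; [auto|exfalso; apply q; eauto]. }
  destruct (excluded_middle_informative (exists v, I v /\ e v = k /\ lt v z)) as [[v [v1 [v2 v3]]]|h2].
  { right; left. exists v. assert (v <> z) by (intros ->; exact (lt_asym _ _ v3 v3)).
    split; [auto|split; [auto|split; [auto|split; [eauto|]]]]. intros n i. simpl.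
    destruct (excluded_middle_informative _) as [q|_]; [exfalso; apply h1; exact q|].
    destruct (excluded_middle_informative _) as [_|q]; [auto|exfalso; apply q; eauto]. }
  destruct (excluded_middle_informative (exists v, I v /\ e v = k)) as [[v [v1 v2]]|h3].
  { right; right; left. exists v. split; [auto|split; [auto|split; [intro q; apply h1; eauto|split; [intro q; apply h2; eauto|]]]]. intros n i. simpl.
    destruct (excluded_middle_informative _) as [q|_]; [exfalso; apply h1; exact q|].
    destruct (excluded_middle_informative _) as [q|_]; [exfalso; apply h2; exact q|].
    destruct (excluded_middle_informative _) as [_|q]; [auto|exfalso; apply q; eauto]. }
  right; right; right. split; [auto|split].
  - destruct (Nat.eq_dec k (e z)) as [E|]; [|lia]. exfalso. apply h3. eauto.
  - intros n i. simpl.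
    destruct (excluded_middle_informative _) as [q|_]; [exfalso; apply h1; exact q|].
    destruct (excluded_middle_informative _) as [q|_]; [exfalso; apply h2; exact q|].
    destruct (excluded_middle_informative _) as [q|_]; [exfalso; apply h3; exact q|]. auto.
Qed.

Lemma search_fuel n : forall m k i z, I z -> k <= e z -> e z < k + n -> e z < k + m -> search n k i z = search m k i z.
Proof.
  induction n as [|n IH]; intros [|m] k i z iz h1 h2 h3; try lia.
  destruct (search_cases k z iz h1) as [[v [_ [_ [_ [h E]]]]]|[[v [_ [_ [_ [h E]]]]]|[[v [_ [_ [_ [_ E]]]]]|[_ [h E]]]]];
    rewrite !E; auto; rewrite (IH m); auto; lia.
Qed.

Lemma search_mem n : forall k i z, I z -> k <= e z -> e z < k + n ->
  I (search n k i z) /\ (lab z <-> lab (search n k i z)).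
Proof.
  induction n as [|n IH]; intros k i z iz h1 h2; [lia|].
  destruct (search_cases k z iz h1) as [[v [_ [_ [_ [h E]]]]]|[[v [_ [_ [_ [h E]]]]]|[[v [_ [_ [_ [_ E]]]]]|[_ [h E]]]]];
    rewrite !E.
  - destruct (IH (S k) i z) as [q1 q2]; auto; [lia|]. destruct (proj1 al_emb _ q1). split; [auto|tauto].
  - destruct (IH (S k) i z) as [q1 q2]; auto; [lia|]. destruct (proj1 be_emb _ q1). split; [auto|tauto].
  - apply mid_emb; auto.
  - apply IH; auto. lia.
Qed.

(** The two searches run in parallel until a code separates them; then the images lie in copies
    ordered like [z] and [w]. If both stop at the same code, [z] and [w] share a node and [mid]
    places its two copies. *)
Lemma search_pair n : forall k z i w j, I z -> I w -> k <= e z -> e z < k + n -> k <= e w -> e w < k + n ->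
  (z, i) <> (w, j) -> search n k i z <> search n k j w /\ (dadj z i w j <-> adj (search n k i z) (search n k j w)).
Proof.
  induction n as [|n IH]; intros k z i w j iz iw z1 z2 w1 w2 ne; [lia|].
  assert (mem := search_mem n (S k)).
  assert (cross : forall f g a b z i w j, left_of f g -> I a -> I b -> lt z w -> (lab b <-> lab w) ->
    f a <> g b /\ (dadj z i w j <-> adj (f a) (g b))).
  { intros f g a b z' i' w' j' l ia ib zw lb. destruct (l a b ia ib) as [l1 l2]. split; auto.
    rewrite (dadj_lt _ _ _ _ zw). tauto. }
  assert (swap : forall (a b z : V) i (w : V) j, b <> a /\ (dadj w j z i <-> adj b a) -> a <> b /\ (dadj z i w j <-> adj a b)).
  { intros a b z' i' w' j' [h1 h2]. split; [congruence|]. rewrite dadj_sym, h2. apply gadj_iff. }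
  assert (weak := lt_weak). assert (tr := lt_tr).
  destruct (search_cases k z iz z1) as [[v [vI [ve [vz [hz Ez]]]]]|[[v [vI [ve [vz [hz Ez]]]]]|[[v [vI [ve [vz1 [vz2 Ez]]]]]|[no [hz Ez]]]]];
  destruct (search_cases k w iw w1) as [[u [uI [ue [uw [hw Ew]]]]]|[[u [uI [ue [uw [hw Ew]]]]]|[[u [uI [ue [uw1 [uw2 Ew]]]]]|[no' [hw Ew]]]]];
  rewrite !Ez, !Ew; try (exfalso; apply no; eauto; fail); try (exfalso; apply no'; eauto; fail);
  try (assert (u = v) by (apply e_inj; congruence); subst u).
  - destruct (IH (S k) z i w j) as [q1 q2]; auto; try lia.
    destruct (proj2 al_emb (search n (S k) i z) (search n (S k) j w)) as [q3 q4]; auto; [apply mem; auto; lia|apply mem; auto; lia|].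
    split; [auto|tauto].
  - apply cross; auto; [apply mem; auto; lia|apply mem; auto; lia|eauto|symmetry; apply mem; auto; lia].
  - apply cross; auto; [apply mem; auto; lia| |tauto]. destruct (weak z v w vz); tauto.
  - apply swap, cross; auto; [apply mem; auto; lia|apply mem; auto; lia|eauto|symmetry; apply mem; auto; lia].
  - destruct (IH (S k) z i w j) as [q1 q2]; auto; try lia.
    destruct (proj2 be_emb (search n (S k) i z) (search n (S k) j w)) as [q3 q4]; auto; [apply mem; auto; lia|apply mem; auto; lia|].
    split; [auto|tauto].
  - apply swap, cross; auto; [apply mem; auto; lia| |symmetry; apply mem; auto; lia]. destruct (weak v z w vz); tauto.
  - apply swap, cross; auto; [apply mem; auto; lia| |tauto]. destruct (weak w v z uw); tauto.
  - apply cross; auto; [apply mem; auto; lia| |symmetry; apply mem; auto; lia]. destruct (weak v w z uw); tauto.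
  - assert (sl : lab z <-> lab w).
    { rewrite (same_closer_label G x z v) by (split; auto). symmetry. apply same_closer_label. split; auto. }
    unfold dadj. destruct i, j.
    + destruct (proj2 (mid_emb true) z w) as [q1 q2]; auto; [congruence|]. split; [auto|]. intuition congruence.
    + destruct (mid_mid w z iw iz) as [q1 q2]. split; [congruence|].
      rewrite (gadj_iff G (mid true z)). intuition congruence.
    + destruct (mid_mid z w iz iw) as [q1 q2]. split; [congruence|]. intuition congruence.
    + destruct (proj2 (mid_emb false) z w) as [q1 q2]; auto; [congruence|]. split; [auto|]. intuition congruence.
  - apply IH; auto; lia.
Qed.

Lemma search_embeds : double_embeds I I.
Proof.
  exists (fun v i => search (S (e v)) 0 i v). split.
  - intros v i iv. apply search_mem; auto; lia.
  - intros v i w j iv iw ne.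
    rewrite (search_fuel (S (e v)) (S (e v + e w)) 0 i v), (search_fuel (S (e w)) (S (e v + e w)) 0 j w) by (auto; lia).
    apply search_pair; auto; lia.
Qed.

End Universal.

Lemma universal_double (I L U : V -> Prop) : subset L I -> subset U I -> set_lt L U -> rle I L -> rle I U ->
  double_embeds I I.
Proof.
  intros LI UI LU [f [f1 f2]] [g [g1 g2]]. destruct cnt as [e e_inj].
  assert (fe : self_embedding I f).
  { split; auto. intros v iv. destruct (f1 v iv). auto. }
  assert (ge : self_embedding I g).
  { split; auto. intros v iv. destruct (g1 v iv). auto. }
  assert (fg : left_of I f g).
  { intros a b ia ib. destruct (f1 a ia) as [h1 h2]. destruct (g1 b ib) as [h3 h4].
    assert (q := LU _ _ h1 h3). split; [apply lt_ne; auto|]. rewrite (lt_adj _ _ q). tauto. }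
  (* The four copies come in the order [f (f v)], [f (g v)], [g (f v)], [g (g v)]. The outer ones
     continue the search, the inner ones hold the two copies of a node. *)
  pose (mid := fun i : bool => if i then fun v => g (f v) else fun v => f (g v)).
  apply (search_embeds I (fun v => f (f v)) (fun v => g (g v)) mid e e_inj).
  - apply (self_embedding_comp I f f); auto.
  - apply (self_embedding_comp I g g); auto.
  - intros [|]; [apply (self_embedding_comp I g f)|apply (self_embedding_comp I f g)]; auto.
  - apply (left_of_precomp I f g f g); auto.
  - intros [|]; [apply (left_of_precomp I f g f f)|apply (left_of_comp I f g f)]; auto.
  - intros [|]; [apply (left_of_comp I f g g)|apply (left_of_precomp I f g g g)]; auto.
  - apply (left_of_precomp I f g g f); auto.
Qed.

(** If [S] has a last node with respect to [r], cut before it. Otherwise cut [S] along a cofinal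
    sequence: the pieces are bounded, hence absorb, so by [omega_tail] some tail contains its own
    double, and what remains is bounded. *)
Lemma absorbs_limit (up : bool) (S : V -> Prop) (r := fun a b => if up then lt a b else lt b a) :
  (forall y J, S y -> (forall z, J z -> S z /\ r z y) -> absorbs J) -> absorbs S.
Proof.
  intro hyp. destruct cnt as [e e_inj].
  assert (asym : forall a b, r a b -> ~ r b a).
  { intros a b. unfold r. destruct up; apply lt_asym. }
  assert (weak : forall a b c, r a b -> r a c \/ r c b).
  { intros a b c. unfold r. destruct up; [apply lt_weak|]. intro h. destruct (lt_weak b a c h); auto. }
  assert (tr : forall a b c, r a b -> r b c -> r a c).
  { intros a b c h1 h2. destruct (weak a b c h1); auto. exfalso; eapply asym; eauto. }
  assert (cut : forall J K, (forall v, S v -> J v \/ K v) -> subset J S -> subset K S ->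
     (forall a b, J a -> K b -> r a b) -> absorbs J -> absorbs K -> absorbs S).
  { intros J K h1 h2 h3 h4 h5 h6. unfold r in h4. destruct up.
    - apply (absorbs_cut S J K); auto.
    - apply (absorbs_cut S K J); auto. + intros v sv; destruct (h1 v sv); auto. + intros a b ha hb; auto. }
  destruct (classic (exists y, S y /\ forall z, S z -> ~ r y z)) as [[y [sy top]]|no].
  - apply (cut (fun z => S z /\ r z y) (fun z => S z /\ ~ r z y)).
    + intros v sv. destruct (classic (r v y)); auto.
    + intros v [h _]; auto.
    + intros v [h _]; auto.
    + intros a b [_ h1] [_ h2]. destruct (weak a y b h1); tauto.
    + apply (hyp y); auto.
    + apply (absorbs_class y). intros v [sv h]. specialize (top v sv). unfold r in *. unfold same. destruct up; split; auto.
  - destruct (classic (exists y, S y)) as [[y0 sy0]|em].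
    2:{ apply absorbs_self. exists (fun v _ => v). split; intros; exfalso; eauto. }
    destruct (cofinal_sequence r S e y0 e_inj asym weak sy0) as [y [_ [yS [ym yc]]]].
    { intros a sa. apply NNPP; intro h. apply no. exists a; split; auto. intros z sz ra. apply h; eauto. }
    pose (v := fun n z => S z /\ ~ r z (y n) /\ r z (y (Datatypes.S n))).
    assert (vr : forall n m a b, n < m -> v n a -> v m b -> r a b).
    { intros n m a b nm [_ [_ a1]] [_ [b1 _]].
      assert (a2 : r a (y m)).
      { destruct (Nat.eq_dec (Datatypes.S n) m) as [<-|ne]; auto. eapply tr; [exact a1|apply ym; lia]. }
      destruct (weak a (y m) b a2); tauto. }
    destruct (omega_tail v) as [k hk].
    { intro n. apply (hyp (y (Datatypes.S n))); auto. intros z [h1 [h2 h3]]; auto. }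
    { unfold r in vr. destruct up; [left|right]; intros n m nm a b ha hb; eauto. }
    apply (cut (fun z => S z /\ r z (y k)) (fun u => exists n, k <= n /\ v n u)).
    + intros z sz. destruct (classic (r z (y k))) as [h|h]; [auto|right].
      destruct (cofinal_piece r y k z (yc z sz) asym ym tr h) as [n [n1 [n2 n3]]]. exists n. split; auto. split; auto.
    + intros z [h _]; auto.
    + intros z [n [_ [h _]]]; auto.
    + intros a b [_ h1] [n [n1 [_ [n2 _]]]].
      assert (h2 : r a (y n)). { destruct (Nat.eq_dec k n) as [<-|ne]; auto. eapply tr; [exact h1|apply ym; lia]. }
      destruct (weak a (y n) b h2); tauto.
    + apply (hyp (y k)); auto.
    + apply absorbs_self; auto.
Qed.

(* A minimal counterexample [J] embeds into one of the two parts of each of its cuts. If it embeds into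
   both parts of some cut, it is universal; otherwise it is a limit of strictly smaller words. *)
Theorem all_absorb I : absorbs I.
Proof.
  apply NNPP; intro bad0.
  destruct (wqo_minimal rle (fun J => ~ absorbs J) rle_trans rle_wqo (ex_intro _ I bad0)) as [J [bad min]]. clear I bad0.
  assert (small : forall K, subset K J -> ~ rle J K -> absorbs K).
  { intros K s h. apply NNPP; intro b. apply h, min; auto. apply rle_subset; auto. }
  pose (L := fun y z => J z /\ lt z y). pose (U := fun y z => J z /\ lt y z).
  assert (LJ : forall y, subset (L y) J) by (intros y z [h _]; auto).
  assert (UJ : forall y, subset (U y) J) by (intros y z [h _]; auto).
  (* If [J] embedded into neither part, both would absorb, and with the node of [y] between them so
     would [J]. *)
  assert (alt : forall y, J y -> rle J (L y) \/ rle J (U y)).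
  { intros y jy. apply NNPP; intro no. apply bad.
    assert (gL : absorbs (L y)) by (apply small; auto). assert (gU : absorbs (U y)) by (apply small; auto).
    apply (absorbs_cut J (fun z => J z /\ ~ lt y z) (U y)); auto.
    - intros v jv. unfold U. destruct (classic (lt y v)); auto.
    - intros v [h _]; auto.
    - intros a b [_ h1] [_ h2]. destruct (lt_weak y b a h2); tauto.
    - apply (absorbs_cut _ (L y) (fun z => J z /\ ~ lt y z /\ ~ lt z y)); auto.
      + intros v [jv h]. unfold L. destruct (classic (lt v y)); auto.
      + intros v [jv h]. split; auto. apply lt_asym; auto.
      + intros v [jv [h _]]. auto.
      + intros a b [_ h1] [_ [_ h2]]. destruct (lt_weak a y b h1); tauto.
      + apply (absorbs_class y). intros v [_ [h1 h2]]. split; auto. }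
  destruct (classic (exists y, J y /\ rle J (L y) /\ rle J (U y))) as [[y [jy [h1 h2]]]|no].
  { apply bad, absorbs_self, (universal_double J (L y) (U y)); auto. intros a b [_ ha] [_ hb]. eapply lt_tr; eauto. }
  (* Cut where the initial parts of [J] begin to contain [J]. Below the cut, parts bounded from
     above do not contain [J]; above it, parts bounded from below do not. *)
  apply bad. apply (absorbs_cut J (fun y => J y /\ ~ rle J (L y)) (fun y => J y /\ rle J (L y))).
  - intros v jv. destruct (classic (rle J (L v))); auto.
  - intros v [h _]; auto.
  - intros v [h _]; auto.
  - intros a b [ja ha] [jb hb]. apply NNPP; intro nl. apply ha.
    eapply rle_trans; [exact hb|apply rle_subset]. intros z [jz hz]. split; auto.
    destruct (lt_weak z b a hz); tauto.
  - apply (absorbs_limit true). intros y K [jy hy] hK. apply small.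
    + intros z hz. apply (hK z hz).
    + intro h. apply hy. eapply rle_trans; [exact h|apply rle_subset]. intros z hz. destruct (hK z hz) as [[h1 _] h2]. split; auto.
  - apply (absorbs_limit false). intros y K [jy hy] hK. apply small.
    + intros z hz. apply (hK z hz).
    + intro h. apply no. exists y. split; auto. split; auto.
      eapply rle_trans; [exact h|apply rle_subset]. intros z hz. destruct (hK z hz) as [[h1 _] h2]. split; auto.
Qed.

End Doubling.

(** * Connected and co-connected graphs *)

(* The word of [G] rooted at [r] has, beyond [y], no node with a single vertex. *)
Definition eventually_no_lone (G : graph) := exists r y : vert G, forall v, closer G r y v ->
  exists w, w <> v /\ same (vert G) (closer G) r v w.

Lemma closer_map G H (f : vert G -> vert H) x y z : (forall x y, adj x y <-> adj (f x) (f y)) ->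
  closer G x y z -> closer H (f x) (f y) (f z).
Proof.
  intros h [[a b]|[a [w [b c]]]]; [left|right].
  - rewrite <- !h; auto.
  - rewrite <- !h. split; auto. exists (f w). rewrite <- !h; auto.
Qed.

Lemma eventually_no_lone_isomorphic G H : isomorphic G H -> eventually_no_lone G -> eventually_no_lone H.
Proof.
  intros [f [g [h1 [h2 h3]]]] [r [y hy]].
  assert (g3 : forall x y, adj x y <-> adj (g x) (g y)) by (intros; rewrite h3, !h2; tauto).
  exists (f r), (f y). intros v c. apply (closer_map H G g _ _ _ g3) in c. rewrite !h1 in c.
  destruct (hy _ c) as [w [w1 [w2 w3]]]. exists (f w). split.
  - intros <-. apply w1. rewrite h1; auto.
  - split; intro q; apply (closer_map H G g _ _ _ g3) in q; rewrite !h1 in q; auto.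
Qed.

(** * Independence of the order from the root *)

Section RootChange.
Variable G : graph.
Hypothesis cog : cograph G.
Variables x r u v : vert G.
Hypothesis ru : closer G x r u.
Hypothesis uv : closer G x u v.
Hypothesis lab_uv : ~ (adj x u <-> adj x v).

Let tr := lt_tr G cog x.
Let la := lt_adj G cog x.

(** Vertices from [v] on see [r] as they see [x], so labels and intermediate vertices carry over. *)
Lemma root_change_above w : closer G x v w -> closer G r v w.
Proof.
  intro vw. assert (rv := tr _ _ _ ru uv). assert (rw := tr _ _ _ rv vw).
  assert (a1 := la _ _ rv). assert (a2 := la _ _ rw). assert (a3 := la _ _ vw).
  destruct (classic (adj x v <-> adj x w)) as [h|h]; [right|left; tauto].
  destruct (closer_between G x v w h vw) as [t [t1 [t2 t3]]].
  assert (a4 := la _ _ (tr _ _ _ rv t2)). assert (a5 := la _ _ t2). assert (a6 := la _ _ t3).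
  split; [tauto|]. exists t. tauto.
Qed.

(** If [w] lies beyond [r], an intermediate vertex for the root [x] also serves [r]. Otherwise [w]
    lies before [u], and [u] itself is intermediate because its label differs from that of [v]. *)
Lemma root_change_below w : closer G x w v -> closer G r w v.
Proof.
  intro wv. assert (rv := tr _ _ _ ru uv).
  assert (a1 := la _ _ rv). assert (a2 := la _ _ wv). assert (a3 := la _ _ uv). assert (a4 := la _ _ ru).
  destruct (classic (adj r w <-> adj r v)) as [h|h]; [right|left; tauto]. split; [exact h|].
  destruct (closer_weak G cog x r u w ru) as [rw|wu].
  - assert (a5 := la _ _ rw).
    destruct (closer_between G x w v) as [t [t1 [t2 t3]]]; [tauto|auto|].
    assert (a6 := la _ _ t2). assert (a7 := la _ _ t3). assert (a8 := la _ _ (tr _ _ _ rw t2)).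
    exists t. tauto.
  - assert (a5 := la _ _ wu). exists u. tauto.
Qed.

End RootChange.

Lemma coconnected_of_apex G : (forall p q : vert G, exists w, w <> p /\ w <> q /\ ~ adj p w /\ ~ adj q w) -> coconnected G.
Proof.
  intros h p q. destruct (h p q) as [w [h1 [h2 [h3 h4]]]].
  apply rt_trans with w; apply rt_step; simpl; split; auto. intro a; apply h4, adj_sym, a.
Qed.

(** * Words without a last node *)

Section Limit.
Variable M : graph.
Hypothesis cog : cograph M.
Hypothesis cnt : countable_graph M.
Hypothesis con : connected M.
Hypothesis cocon : coconnected M.
Variables x x1 : vert M.
Hypothesis x_x1 : x1 <> x.

Notation V := (vert M).
Notation lt := (closer M x).
Notation lab v := (adj x v).
Notation same := (same V (closer M) x).

Let asym := lt_asym M cog x.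
Let weak := lt_weak M cog x.
Let tr := lt_tr M cog x.
Let ladj := lt_adj M cog x.

(** If [y] were in the last node, every vertex outside [A] would be joined to all of [A] or to none
    of it, according to the label of [y]: [M] or its complement would be disconnected. *)
Lemma no_top y : y <> x -> exists z, lt y z.
Proof.
  intro yx. apply NNPP; intro no.
  pose (A := fun v => v = x \/ lt v y).
  assert (nAy : ~ A y) by (intros [h|h]; [auto|exact (asym _ _ h h)]).
  assert (key : forall u w, A u -> ~ A w -> (lab w <-> lab y) /\ (adj u w <-> lab y)).
  { intros u w hu hw. assert (nwy : ~ lt w y) by (intro h; apply hw; right; auto).
    assert (sl : lab w <-> lab y).
    { apply same_closer_label. split; auto. intro h; apply no; eauto. }
    split; auto. destruct hu as [->|hu]; auto. rewrite ladj; auto. destruct (weak u y w hu); tauto. }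
  assert (closed : forall R : V -> V -> Prop, (forall u w, A u -> R u w -> A w) -> ~ clos_refl_trans V R x y).
  { intros R hR.
    assert (h : forall z, clos_refl_trans_n1 V R x z -> A z).
    { intros z c. induction c as [|z z' q c IH]; [left; auto|exact (hR _ _ IH q)]. }
    intro c. apply nAy, h, clos_rt_rtn1, c. }
  destruct (classic (lab y)) as [l|l].
  - apply (closed (compl_adj M)); [|apply cocon].
    intros u w hu [h1 h2]. apply NNPP; intro hw. destruct (key u w hu hw). tauto.
  - apply (closed (@adj M)); [|apply con].
    intros u w hu h. apply NNPP; intro hw. destruct (key u w hu hw). tauto.
Qed.

Lemma neighbour : exists w, lab w.
Proof.
  assert (c := con x x1). apply clos_rt_rt1n in c. inversion c; subst; [exfalso; auto|]. eauto.
Qed.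

Lemma unbounded y : exists z, lt y z.
Proof.
  destruct (classic (y = x)) as [->|ne]; [|apply no_top; auto].
  destruct neighbour as [w hw]. exists w. left. split; [|tauto]. intro h. apply (adj_irrefl M x). tauto.
Qed.

(** Between two nodes of one label there is a vertex of the other label. *)
Lemma unbounded_nonadjacent y : exists z, lt y z /\ ~ lab z.
Proof.
  destruct (unbounded y) as [a ha]. destruct (unbounded a) as [b hb].
  destruct (classic (lab a)) as [la|la]; [|eauto].
  destruct (classic (lab b)) as [lb|lb]; [|exists b; split; [eapply tr; eauto|auto]].
  destruct (closer_between M x a b ltac:(tauto) hb) as [t [t1 [t2 t3]]].
  exists t. split; [eapply tr; eauto|tauto].
Qed.

Variable y : nat -> V.
Hypothesis x_y : forall n, lt x (y n).
Hypothesis y_mono : forall n m, n < m -> lt (y n) (y m).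
Hypothesis y_cofinal : forall v, exists n, lt v (y n).

Definition piece (n : nat) (v : V) := ~ lt v (y n) /\ lt v (y (S n)).

Lemma y_le v n m : n <= m -> lt v (y n) -> lt v (y m).
Proof. intros h a. destruct (Nat.eq_dec n m) as [<-|ne]; auto. eapply tr; [exact a|apply y_mono; lia]. Qed.

Lemma in_piece k v : ~ lt v (y k) -> exists n, k <= n /\ piece n v.
Proof. intro h. destruct (cofinal_piece lt y k v) as [n [h1 h2]]; eauto. Qed.

Lemma piece_lt n m : n < m -> set_lt M x (piece n) (piece m).
Proof.
  intros nm a b [_ a1] [b1 _]. assert (a2 := y_le a (S n) m nm a1). destruct (weak _ _ b a2); tauto.
Qed.

Definition above (k : nat) (v : V) := ~ lt v (y k).

Lemma below_lt_above k v w : lt v (y k) -> above k w -> lt v w.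
Proof. unfold above. intros h1 h2. destruct (weak _ _ w h1); tauto. Qed.

Lemma exists_double_tail : exists k, double_embeds M x (above k) (above k).
Proof.
  destruct (omega_tail M cog cnt x piece) as [k hk].
  - intro n. apply all_absorb; auto.
  - left. exact piece_lt.
  - exists k.
    assert (E : forall v, above k v <-> exists n, k <= n /\ piece n v).
    { intro v. split; [apply in_piece|]. intros [n [h1 [h2 _]]] h. apply h2. eapply y_le; eauto. }
    eapply double_embeds_l; [apply rle_subset|eapply double_embeds_r; [exact hk|apply rle_subset]];
      intros v hv; apply E; auto.
Qed.

(** * The sibling with a doubled final segment *)

Section DoubledTail.
Variable k : nat.

(** The copy index matters only between vertices of the final segment; elsewhere [doubled] keeps
    only the copy [false]. *)
Definition tail_adj (p q : V * bool) : Prop :=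
  (above k (fst p) /\ above k (fst q) /\ dadj M x (fst p) (snd p) (fst q) (snd q)) \/
  (~ (above k (fst p) /\ above k (fst q)) /\ adj (fst p) (fst q)).

Lemma tail_adj_sym p q : tail_adj p q -> tail_adj q p.
Proof.
  intros [[h1 [h2 h3]]|[h1 h2]]; [left|right]; repeat split; auto.
  - apply dadj_sym; auto.
  - tauto.
  - apply adj_sym; auto.
Qed.

Lemma tail_adj_irrefl p : ~ tail_adj p p.
Proof.
  intros [[h1 [h2 [[h3 h4]|[h3 _]]]]|[h1 h2]]; [eapply adj_irrefl; eauto|auto|eapply adj_irrefl; eauto].
Qed.

Definition doubled : graph := induced (Graph (V * bool) tail_adj tail_adj_sym tail_adj_irrefl)
  (fun p => snd p = false \/ above k (fst p)).

Lemma tail_adj_false v w : tail_adj (v, false) (w, false) <-> adj v w.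
Proof. unfold tail_adj, dadj; simpl. assert (false = false) by auto. tauto. Qed.

Lemma tail_adj_below v i w j : lt v w -> above k w -> (tail_adj (v, i) (w, j) <-> lab w).
Proof.
  intros h a. unfold tail_adj; simpl. rewrite (dadj_lt M cog x v i w j h), (ladj v w h).
  destruct (classic (above k v)); tauto.
Qed.

Lemma tail_adj_labels v i w j : ~ (lab v <-> lab w) -> (tail_adj (v, i) (w, j) <-> adj v w).
Proof.
  intro h. unfold tail_adj, dadj; simpl. destruct (bool_dec i j); destruct (classic (above k v /\ above k w)); tauto.
Qed.

Definition doubled_vertex (v : V) : vert doubled :=
  exist (fun p : V * bool => snd p = false \/ above k (fst p)) (v, false) (or_introl eq_refl).

Lemma doubled_vertex_adj v w : adj v w <-> @adj doubled (doubled_vertex v) (doubled_vertex w).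
Proof. symmetry. apply tail_adj_false. Qed.

Lemma doubled_equimorphic : double_embeds M x (above k) (above k) -> equimorphic doubled M.
Proof.
  intros [f [f1 f2]]. split.
  - apply (embeds_of_induced (G := Graph (V * bool) tail_adj tail_adj_sym tail_adj_irrefl) _
      (fun p : V * bool => if excluded_middle_informative (above k (fst p)) then f (fst p) (snd p) else fst p)).
    assert (low : forall v w j, ~ above k v -> above k w -> v <> f w j /\ (tail_adj (v, false) (w, j) <-> adj v (f w j))).
    { intros v w j hv hw. assert (hv' : lt v (y k)) by (apply NNPP; exact hv).
      destruct (f1 w j hw) as [h1 h2].
      assert (q := below_lt_above k v (f w j) hv' h1).
      split; [apply lt_ne with x; auto|].
      rewrite (ladj _ _ q), (tail_adj_below v false w j); auto. exact (below_lt_above k v w hv' hw). }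
    intros [v i] [w j] hv hw ne; simpl in *.
    destruct (excluded_middle_informative (above k v)) as [av|av], (excluded_middle_informative (above k w)) as [aw|aw].
    + destruct (f2 v i w j av aw ne) as [h1 h2]. split; auto. unfold tail_adj; simpl. tauto.
    + destruct hw as [->|hw]; [|tauto]. destruct (low w v i aw av) as [h1 h2]. split; [congruence|].
      rewrite (gadj_iff M (f v i)), <- h2. split; apply tail_adj_sym.
    + destruct hv as [->|hv]; [|tauto]. apply low; auto.
    + destruct hv as [->|hv]; [|tauto]. destruct hw as [->|hw]; [|tauto]. split; [congruence|apply tail_adj_false].
  - exists doubled_vertex. split; [|apply doubled_vertex_adj]. intros v w E. inversion E; auto.
Qed.

Lemma doubled_coconnected : coconnected doubled.
Proof.
  apply coconnected_of_apex. intros [[p i] hp] [[q j] hq].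
  destruct (y_cofinal p) as [n1 h1]. destruct (y_cofinal q) as [n2 h2].
  destruct (unbounded_nonadjacent (y (n1 + n2 + k))) as [w [w1 w2]].
  assert (aw : above k w).
  { intro h. apply (asym _ _ w1). eapply y_le; [|exact h]. lia. }
  assert (ap : lt p w) by (eapply tr; [eapply (y_le p n1); [|exact h1]|exact w1]; lia).
  assert (aq : lt q w) by (eapply tr; [eapply (y_le q n2); [|exact h2]|exact w1]; lia).
  exists (doubled_vertex w). split; [|split; [|split]].
  - intro E. inversion E; subst. exact (asym _ _ ap ap).
  - intro E. inversion E; subst. exact (asym _ _ aq aq).
  - intro a. apply w2. apply (tail_adj_below p i w false ap aw). exact a.
  - intro a. apply w2. apply (tail_adj_below q j w false aq aw). exact a.
Qed.

(** The two copies of [v] share a node: separating vertices of equal label requires a vertex of the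
    other label, and adjacency between different labels ignores the copy index. *)
Lemma doubled_no_lone : cograph doubled -> eventually_no_lone doubled.
Proof.
  intro cd. exists (doubled_vertex x), (doubled_vertex (y k)). intros [[v i] hv] c.
  assert (av : above k v).
  { destruct (classic (above k v)) as [h|h]; auto. exfalso.
    assert (hv' := hv). destruct hv' as [E|E]; [|auto]. simpl in E. subst i.
    assert (h' : lt v (y k)) by (apply NNPP; exact h).
    apply (closer_map M doubled doubled_vertex _ _ _ doubled_vertex_adj) in h'.
    apply (closer_asym doubled cd _ _ _ h').
    replace (doubled_vertex v) with (exist (fun p : V * bool => snd p = false \/ above k (fst p)) (v, false) hv)
      by (apply sig_eq; auto). exact c. }
  assert (lx : forall u j hu, @adj doubled (doubled_vertex x) (exist _ (u, j) hu) <-> lab u).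
  { intros u j hu. unfold adj; simpl. unfold tail_adj; simpl.
    assert (~ above k x) by (intro h; apply h; apply x_y). tauto. }
  assert (nolt : forall i j hi hj, ~ closer doubled (doubled_vertex x) (exist _ (v, i) hi) (exist _ (v, j) hj)).
  { intros i' j' hi hj [[h1 h2]|[h1 [[[u l] hu] [h2 [h3 h4]]]]].
    - rewrite !lx in h1. tauto.
    - rewrite !lx in *.
      assert (h3' : tail_adj (v, i') (u, l) <-> lab u) by exact h3.
      assert (h4' : tail_adj (u, l) (v, j') <-> lab v) by exact h4.
      rewrite tail_adj_labels in h3' by tauto. rewrite tail_adj_labels in h4' by tauto.
      rewrite (gadj_iff M u v) in h4'. tauto. }
  exists (exist _ (v, negb i) (or_intror av)). split.
  - intro E. inversion E as [E']. destruct i; discriminate.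
  - split; apply nolt.
Qed.

End DoubledTail.

(** * The sibling with cofinally many one-vertex nodes *)

Section Thinned.
Variables (k : nat) (s : nat -> nat).
Hypothesis s_low : forall n, k + n <= s n.
Hypothesis s_gap : forall n m, n < m -> s n + 2 <= s m.
Hypothesis s_emb : forall n, rooted_embeds_in (@adj M) x (piece (k + n)) (piece (s n)).

(* The nodes of the vertices [y (s n + 1)] are reduced to these vertices. *)
Definition thinned (v : V) := forall n, same v (y (s n + 1)) -> v = y (s n + 1).

Lemma y_not_same n m : n <> m -> ~ same (y n) (y m).
Proof. intros ne [h1 h2]. destruct (lt_eq_lt_dec n m) as [[l|l]|l]; auto. Qed.

Lemma s_special n : thinned (y (s n + 1)).
Proof.
  intros m h. destruct (Nat.eq_dec (s n + 1) (s m + 1)) as [E|ne]; [rewrite E; auto|].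
  exfalso; eapply y_not_same; eauto.
Qed.

Lemma piece_thinned n v : piece (s n) v -> thinned v.
Proof.
  intros [h1 h2] m [h3 h4]. exfalso.
  destruct (lt_eq_lt_dec n m) as [[l|<-]|l].
  - specialize (s_gap _ _ l). apply h3. eapply y_le; [|exact h2]. lia.
  - apply h3. eapply y_le; [|exact h2]. lia.
  - specialize (s_gap _ _ l). apply h1.
    assert (q : lt (y (s m + 1)) (y (s n))) by (apply y_mono; lia).
    destruct (weak _ _ v q); tauto.
Qed.

Lemma low_thinned v : lt v (y k) -> thinned v.
Proof.
  intros h m [h3 _]. exfalso. apply h3. eapply y_le; [|exact h]. specialize (s_low m). lia.
Qed.

(** The node of [y (s n + 1)] avoids all pieces [piece (s m)], so these stay intact and receive the
    pieces from [k] on. *)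
Lemma thinned_embeds : embeds M (induced M thinned).
Proof.
  assert (h : rooted_embeds_in (@adj M) x (fun _ => True) thinned).
  { eapply rle_trans; [apply (rle_glue M cog x (fun _ => True)
      (fun n => match n with 0 => fun v => lt v (y k) | S n => piece (k + n) end)
      (fun n => match n with 0 => fun v => lt v (y k) | S n => piece (s n) end))|].
    - intros v _. destruct (classic (lt v (y k))) as [h|h]; [exists 0; auto|].
      destruct (in_piece k v h) as [n [n1 n2]]. exists (S (n - k)). replace (k + (n - k)) with n by lia. auto.
    - intros [|n]; [apply rle_subset; intros v hv; auto|apply s_emb].
    - assert (low : forall n, k <= n -> set_lt M x (fun v => lt v (y k)) (piece n)).
      { intros n hn a b ha [hb _]. assert (ha' := y_le a k n hn ha). destruct (weak _ _ b ha'); tauto. }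
      assert (up : forall n m, n < m -> set_lt M x (piece (k + n)) (piece (k + m)) /\ set_lt M x (piece (s n)) (piece (s m))).
      { intros n m l. specialize (s_gap _ _ l). split; apply piece_lt; lia. }
      intros [|n] [|m] ne; [tauto| | |].
      + left. split; apply low; [lia|specialize (s_low m); lia].
      + right. split; apply low; [lia|specialize (s_low n); lia].
      + destruct (lt_eq_lt_dec n m) as [[l|l]|l]; [left; auto|lia|right; auto].
    - apply rle_subset. intros v [[|n] hv]; [apply low_thinned; auto|eapply piece_thinned; eauto]. }
  destruct h as [f [f1 f2]]. apply (embeds_induced_of thinned f).
  - intro v; apply f1; auto.
  - intros v w ne; apply f2; auto.
Qed.

Lemma thinned_coconnected : coconnected (induced M thinned).
Proof.
  apply coconnected_of_apex. intros [p hp] [q hq].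
  destruct (y_cofinal p) as [n1 h1]. destruct (y_cofinal q) as [n2 h2].
  destruct (unbounded_nonadjacent (y (n1 + n2 + k))) as [w [w1 w2]].
  destruct (in_piece (n1 + n2 + k) w) as [n [hn pw]].
  { intro h. exact (asym _ _ w1 h). }
  destruct (s_emb (n - k)) as [f [f1 _]]. replace (k + (n - k)) with n in f1 by lia.
  destruct (f1 w pw) as [g1 g2].
  assert (sn : n <= s (n - k)) by (specialize (s_low (n - k)); lia).
  assert (lt_f : forall v m, lt v (y m) -> m <= n -> lt v (f w)).
  { intros v m hv hm. assert (hv' : lt v (y (s (n - k)))) by (eapply y_le; [|exact hv]; lia).
    destruct (weak _ _ (f w) hv') as [q'|q']; auto. exfalso. apply (proj1 g1 q'). }
  assert (ap : lt p (f w)) by (eapply lt_f; [exact h1|lia]).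
  assert (aq : lt q (f w)) by (eapply lt_f; [exact h2|lia]).
  exists (exist thinned (f w) (piece_thinned _ _ g1)). split; [|split; [|split]].
  - intro E. inversion E; subst. exact (asym _ _ ap ap).
  - intro E. inversion E; subst. exact (asym _ _ aq aq).
  - intro a. apply w2, g2. apply (ladj _ _ ap). exact a.
  - intro a. apply w2, g2. apply (ladj _ _ aq). exact a.
Qed.

Lemma thinned_x : thinned x.
Proof. intros n [h _]. exfalso. apply h, x_y. Qed.

(** An intermediate vertex may have been deleted, but the survivor of its node has the same label
    and position. *)
Lemma thinned_closer (a b : vert (induced M thinned)) :
  closer (induced M thinned) (exist thinned x thinned_x) a b <-> lt (proj1_sig a) (proj1_sig b).
Proof.
  split; [apply (closer_map (induced M thinned) M (@proj1_sig _ _)); tauto|].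
  intro h. destruct (classic (lab (proj1_sig a) <-> lab (proj1_sig b))) as [l|l].
  - destruct (closer_between M x _ _ l h) as [w [w1 [w2 w3]]].
    assert (exists w', thinned w' /\ same w' w) as [w' [t' s']].
    { destruct (classic (thinned w)) as [t|t]; [exists w; split; auto; split; intro q; exact (asym _ _ q q)|].
      apply not_all_ex_not in t. destruct t as [n t].
      exists (y (s n + 1)). split; [apply s_special|]. assert (q : same w (y (s n + 1))) by tauto.
      destruct q; split; auto. }
    assert (sl := same_closer_label M x _ _ s'). destruct s' as [s1 s2].
    assert (w2' : lt (proj1_sig a) w') by (destruct (weak _ _ w' w2); tauto).
    assert (w3' : lt w' (proj1_sig b)) by (destruct (weak _ _ w' w3); tauto).
    right. split; [exact l|]. exists (exist thinned w' t'). simpl.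
    assert (q1 := ladj _ _ w2'). assert (q2 := ladj _ _ w3'). tauto.
  - left. split; [exact l|]. exact (ladj _ _ h).
Qed.

(** For any root [r] and bound [y0], far enough out there is [u] beyond [r] whose label differs from
    that of [z (S n)]. The root change lemmas then show that [z (S n)] is alone in its node also as
    seen from [r]. *)
Lemma thinned_lone : ~ eventually_no_lone (induced M thinned).
Proof.
  assert (ct : cograph (induced M thinned)) by (eapply cograph_embeds; [apply induced_embeds|auto]).
  pose (X := exist thinned x thinned_x : vert (induced M thinned)).
  pose (z := fun n => exist thinned (y (s n + 1)) (s_special n) : vert (induced M thinned)).
  intros [r [y0 hy]].
  destruct (y_cofinal (proj1_sig r)) as [n1 h1]. destruct (y_cofinal (proj1_sig y0)) as [n2 h2].
  pose (n := n1 + n2).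
  assert (rz : closer (induced M thinned) X r (z n)).
  { apply thinned_closer. eapply y_le; [|exact h1]. specialize (s_low n). unfold n in *; lia. }
  assert (yz : closer (induced M thinned) X y0 (z n)).
  { apply thinned_closer. eapply y_le; [|exact h2]. specialize (s_low n). unfold n in *; lia. }
  assert (zz : closer (induced M thinned) X (z n) (z (S n))).
  { apply thinned_closer. apply y_mono. specialize (s_gap n (S n)). lia. }
  assert (exists u, closer (induced M thinned) X r u /\ closer (induced M thinned) X y0 u /\
     closer (induced M thinned) X u (z (S n)) /\ ~ (adj X u <-> adj X (z (S n)))) as [u [u1 [u2 [u3 u4]]]].
  { destruct (classic (adj X (z n) <-> adj X (z (S n)))) as [l|l]; [|exists (z n); auto].
    destruct (closer_between _ X _ _ l zz) as [w [w1 [w2 w3]]].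
    exists w. split; [|split; [|split]]; auto; try (eapply lt_tr; eauto). tauto. }
  assert (y0z : closer (induced M thinned) X y0 (z (S n))) by (eapply lt_tr; eauto).
  destruct (hy (z (S n))) as [w [w1 [w2 w3]]].
  { apply (root_change_below _ ct X r u); auto. }
  assert (nw : ~ same (proj1_sig w) (y (s (S n) + 1))).
  { intro q. apply w1. apply sig_eq. simpl. apply (proj2_sig w (S n)), q. }
  destruct (classic (lt (proj1_sig w) (y (s (S n) + 1)))) as [l|l].
  - apply w3. apply (root_change_below _ ct X r u); auto. apply thinned_closer. exact l.
  - destruct (classic (lt (y (s (S n) + 1)) (proj1_sig w))) as [l'|l']; [|apply nw; split; auto].
    apply w2. apply (root_change_above _ ct X r u); auto. apply thinned_closer. exact l'.
Qed.

End Thinned.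

Lemma limit_contradiction : ~ unique_coconnected M.
Proof.
  intro uq. destruct exists_double_tail as [k hk].
  assert (eq1 := doubled_equimorphic k hk).
  assert (i1 := uq _ (doubled_coconnected k) eq1).
  assert (n1 : eventually_no_lone (doubled k)).
  { apply doubled_no_lone. eapply cograph_embeds; [apply eq1|auto]. }
  destruct (wqo_recurrent (rooted_embeds_in (@adj M) x) piece) as [m hm].
  { intro u. apply (rle_wqo M cog cnt x (fun i => piece (u i))). }
  destruct (hm m (le_n _) m) as [s0 [s0k s0e]].
  (* Steps of at least 2 leave the piece after each [piece (s n)] free for thinning. *)
  destruct (dependent_choice (fun _ : nat => True)
    (fun n a a' => a + 2 <= a' /\ rooted_embeds_in (@adj M) x (piece (m + S n)) (piece a')) s0 I) as [s [e0 [_ sR]]].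
  { intros n a _. destruct (hm (m + S n) ltac:(lia) (a + 2)) as [j [j1 j2]]. exists j. auto. }
  assert (s_gap : forall a b, a < b -> s a + 2 <= s b).
  { induction 1; [apply sR|]. destruct (sR m0). lia. }
  assert (s_low : forall n, m + n <= s n).
  { induction n; [lia|]. destruct (sR n). lia. }
  assert (s_emb : forall n, rooted_embeds_in (@adj M) x (piece (m + n)) (piece (s n))).
  { intros [|n]; [rewrite Nat.add_0_r, e0; auto|apply sR]. }
  assert (i2 : isomorphic (induced M (thinned s)) M).
  { apply uq; [apply (thinned_coconnected m s); auto|]. split; [apply induced_embeds|]. apply (thinned_embeds m s); auto. }
  apply (thinned_lone m s s_low s_gap).
  apply (eventually_no_lone_isomorphic (doubled k)); auto.
  eapply isomorphic_trans; [exact i1|apply isomorphic_sym; auto].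
Qed.

End Limit.

Lemma connected_case M : cograph M -> countable_graph M -> connected M -> coconnected M -> ~ simple M ->
  ~ unique_coconnected M.
Proof.
  intros c ct cn cc ns.
  assert (exists x x1 : vert M, x1 <> x) as [x [x1 ne]].
  { apply NNPP; intro no. apply ns. destruct (classic (inhabited (vert M))) as [[v]|em].
    - exists (v :: nil). intro w. exists v. split; [left; auto|]. replace w with v; [apply twin_refl|].
      apply NNPP; intro q. apply no; eauto.
    - exists nil. intro w. exfalso; apply em; constructor; auto. }
  assert (ct' := ct). destruct ct' as [e e_inj].
  destruct (unbounded M c cn cc x x1 ne x) as [w xw].
  destruct (cofinal_sequence (closer M x) (fun _ => True) e w e_inj (lt_asym M c x) (lt_weak M c x) I)
    as [y [y0 [_ [ym yc]]]].
  { intros a _. destruct (unbounded M c cn cc x x1 ne a) as [b hb]. eauto. }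
  apply (limit_contradiction M c ct cn cc x x1 ne y); auto.
  intro n. destruct (Nat.eq_dec n 0) as [->|h]; [rewrite y0; auto|].
  eapply lt_tr; [auto|exact xw|]. rewrite <- y0. apply ym. lia.
Qed.

(** * Minimal critical subgraphs *)

(** Both kinds are minimized together: passing to a component of a disconnected graph turns
    uniqueness among co-connected siblings into uniqueness among connected ones. *)
Definition critical (side : bool) (M : graph) := ~ simple M /\
  if side then connected M /\ unique_connected M else coconnected M /\ unique_coconnected M.

Lemma unique_coconnected_complement M : unique_connected M -> unique_coconnected (complement M).
Proof.
  intros u H cH [e1 e2].
  assert (i : isomorphic (complement H) M).
  { apply u; auto. apply (equimorphic_trans _ (complement (complement M))).
    - apply complement_equimorphic. split; auto.
    - apply isomorphic_equimorphic, complement_involutive. }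
  eapply isomorphic_trans; [apply isomorphic_sym, complement_involutive|]. apply complement_isomorphic, i.
Qed.

Lemma unique_isomorphic M N : isomorphic M N -> unique_coconnected M -> unique_coconnected N.
Proof.
  intros i u H cH e. apply (isomorphic_trans _ M); auto. apply u; auto.
  eapply equimorphic_trans; [exact e|]. apply isomorphic_equimorphic, isomorphic_sym, i.
Qed.

Lemma complement_induced M (B : vert M -> Prop) : isomorphic (complement (induced (complement M) B)) (induced M B).
Proof.
  exists (fun v => v), (fun v => v). split; [auto|split; [auto|]]. intros [v hv] [w hw]. simpl.
  unfold compl_adj; simpl. unfold compl_adj. split.
  - intros [h1 h2]. apply NNPP; intro h. apply h2. split; auto. intros ->. apply h1, sig_eq; auto.
  - intro h. split; [intro E; inversion E; subst; eapply adj_irrefl; eauto|tauto].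
Qed.

Lemma no_critical_minimal M : cograph M -> countable_graph M -> critical false M ->
  (forall B, critical true (induced M B) -> embeds M (induced M B)) -> False.
Proof.
  intros c ct [ns [cc uq]] mn. destruct (classic (connected M)) as [cn|nc].
  - exact (connected_case M c ct cn cc ns uq).
  - apply (disconnected_case M c ct uq ns nc). intros B h1 h2 h3. apply mn. split; auto.
Qed.

Lemma no_critical G side : cograph G -> countable_graph G -> critical side G -> False.
Proof.
  intros c ct cr.
  destruct (wqo_minimal (embeds_in (@adj G)) (fun A => exists side, critical side (induced G A))) as [A [[sd cA] mn]].
  - intros A B D h1 h2. apply embeds_in_of_induced.
    eapply embeds_trans; eapply induced_induced_embeds; eauto.
  - intro u. apply cograph_subsets_wqo; auto.
  - exists (fun _ => True), side.
    assert (i : isomorphic G (induced G (fun _ => True))).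
    { exists (fun v => exist _ v I), (@proj1_sig _ _). split; [auto|split].
      - intros [v []]; auto.
      - simpl; tauto. }
    destruct cr as [ns cr]. split; [intro s; apply ns; eapply simple_isomorphic; [apply isomorphic_sym, i|exact s]|].
    destruct side, cr as [c1 c2]; split.
    + eapply connected_isomorphic; eauto.
    + intros H cH e. apply (isomorphic_trans _ G); auto. apply c2; auto.
      eapply equimorphic_trans; [exact e|]. apply isomorphic_equimorphic, isomorphic_sym, i.
    + eapply coconnected_isomorphic; eauto.
    + eapply unique_isomorphic; eauto.
  - set (M := induced G A) in *.
    assert (cM : cograph M) by (eapply cograph_embeds; [apply induced_embeds|auto]).
    assert (ctM : countable_graph M) by (eapply countable_embeds; [apply induced_embeds|auto]).
    assert (minM : forall side (B : vert M -> Prop), critical side (induced M B) -> embeds M (induced M B)).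
    { intros sd' B cB.
      (* Minimality concerns sets of vertices of [G]; [B'] is [B] seen as such a set. *)
      pose (B' := fun v => exists a : A v, B (exist A v a)).
      assert (i : isomorphic (induced M B) (induced G B')).
      { assert (hB : forall v : vert (induced M B), B' (proj1_sig (proj1_sig v))).
        { intros [[v a] b]. exists a. exact b. }
        apply (isomorphic_of_bijection (induced M B) (induced G B') (fun v => exist B' _ (hB v))).
        - intros v w E. inversion E as [E']. apply sig_eq, sig_eq, E'.
        - intros [v [a b]]. exists (exist B (exist A v a) b). apply sig_eq; auto.
        - intros v w. simpl. tauto. }
      apply (embeds_trans _ (induced G B')); [|apply isomorphic_embeds, isomorphic_sym, i].
      apply induced_induced_embeds. apply mn.
      - exists sd'. destruct cB as [ns cB].
        split; [intro s; apply ns; eapply simple_isomorphic; [apply isomorphic_sym, i|exact s]|].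
        destruct sd', cB as [c1 c2]; split.
        + eapply connected_isomorphic; eauto.
        + intros H cH e. apply (isomorphic_trans _ (induced M B)); auto. apply c2; auto.
          eapply equimorphic_trans; [exact e|]. apply isomorphic_equimorphic, isomorphic_sym, i.
        + eapply coconnected_isomorphic; eauto.
        + eapply unique_isomorphic; eauto.
      - exists (fun v => v). split; [intros v [a _]; auto|tauto]. }
    (* If [M] is critical on the connected side, its complement is critical on the other side, and
       minimality passes to it because complements commute with induced subgraphs. *)
    destruct sd.
    + destruct cA as [ns [cn uq]].
      apply (no_critical_minimal (complement M)).
      * apply complement_cograph; auto.
      * apply complement_countable; auto.
      * split; [|split].
        -- intro s. apply ns. eapply simple_isomorphic; [apply complement_involutive|]. apply simple_complement; auto.
        -- unfold coconnected. eapply connected_isomorphic; [apply isomorphic_sym, complement_involutive|auto].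
        -- apply unique_coconnected_complement; auto.
      * intros B [nsB [cB uB]].
        assert (i := complement_induced M B).
        assert (e : embeds M (induced M B)).
        { apply (minM false). split; [|split].
          - intro s. apply nsB. eapply simple_isomorphic; [apply complement_involutive|]. apply simple_complement.
            eapply simple_isomorphic; [apply isomorphic_sym, i|exact s].
          - eapply coconnected_isomorphic; [exact i|].
            unfold coconnected. eapply connected_isomorphic; [apply isomorphic_sym, complement_involutive|auto].
          - eapply unique_isomorphic; [exact i|]. apply unique_coconnected_complement; auto. }
        apply complement_embeds in e. eapply embeds_trans; [exact e|].
        apply isomorphic_embeds. eapply isomorphic_trans; [apply complement_isomorphic, isomorphic_sym, i|].
        apply complement_involutive.
    + apply (no_critical_minimal M cM ctM cA). intros B cB. eapply minM; eauto.
Qed.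

Theorem theorem1p7 (G : graph) :
  cograph G -> countable_graph G ->
  (sib_is_one G <-> sib_c_is_one G) /\
  (sib_c_is_one G <-> finite_lexsum_of_cliques_or_indeps G).
Proof.
  intros c ct.
  assert (u1 : sib_is_one G -> forall H, equimorphic H G -> isomorphic H G).
  { intros [H0 [e0 h0]] H e. apply (isomorphic_trans _ H0); auto. apply isomorphic_sym, h0. split; apply embeds_refl. }
  assert (s1 : sib_is_one G -> sib_c_is_one G).
  { intro s. assert (u := u1 s). split.
    - intro cn. exists G. split; [split; [auto|split; apply embeds_refl]|]. intros H [_ e]; auto.
    - intro nc. exists (complement G). split; [split; [apply disconnected_coconnected; auto|split; apply embeds_refl]|].
      intros H [_ e].
      eapply isomorphic_trans; [apply isomorphic_sym, complement_involutive|]. apply complement_isomorphic, u.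
      apply (equimorphic_trans _ (complement (complement G))); [apply complement_equimorphic; auto|].
      apply isomorphic_equimorphic, complement_involutive. }
  assert (s2 : sib_c_is_one G -> finite_lexsum_of_cliques_or_indeps G).
  { intros [h1 h2]. apply lexsum_of_simple. apply NNPP; intro ns.
    assert (uc : forall K, connected K -> sib_conn_is_one K -> unique_connected K).
    { intros K cK [H0 [e0 h0]] H cH e. apply (isomorphic_trans _ H0); auto. apply isomorphic_sym, h0.
      split; [auto|split; apply embeds_refl]. }
    destruct (classic (connected G)) as [cn|nc].
    - apply (no_critical G true c ct). split; auto.
    - apply (no_critical (complement G) true).
      + apply complement_cograph; auto.
      + apply complement_countable; auto.
      + assert (cc := disconnected_coconnected G nc). split; [|split; auto].
        intro s. apply ns. eapply simple_isomorphic; [apply complement_involutive|]. apply simple_complement; auto. }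
  assert (s3 : finite_lexsum_of_cliques_or_indeps G -> sib_is_one G).
  { intro f. apply simple_of_lexsum in f. exists G. split; [split; apply embeds_refl|].
    intros H e. apply simple_sibling; auto. }
  tauto.
Qed.
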